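(* Let $k\in\widetilde{\mathbb R}_{>0}$ be a positive infinite number, $K:=[-k,k]^n$, $K\subseteq X\subseteq\widetilde{\mathbb R}^n$, $f\in{}^{\rho}\mathcal{GC}^\infty(X)$, $h\in\widetilde{\mathbb R}$ a positive infinite number, and $\delta\in(0,1]$. Let $\delta_h^n$ be the $n$-dimensional Dirichlet delta function and set $(\delta_h^n*_kf)(y):=\int_K\delta_h^n(y-x)f(x)\,\mathrm dx$. Then: (i) $\delta_h^n(z)=\delta_h^1(z_1)\cdot\ldots\cdot\delta_h^1(z_n)$ for all $z\in\widetilde{\mathbb R}^n$; (ii) $\lim_{h\to+\infty}\int_{K}\delta_h^n(x)\,\mathrm dx=1$; (iii) $\lim_{h\to+\infty}\int_{[-k,-\delta]^n}\delta_h^n(x)\,\mathrm dx=\lim_{h\to+\infty}\int_{[\delta,k]^n}\delta_h^n(x)\,\mathrm dx=0$; (iv) $\lim_{h\to+\infty}\int_{K}\delta_h^n(x)f(x)\,\mathrm dx=f(0)$ if $0\in\mathring K$; (v) $\lim_{h\to+\infty}(\delta_h^n*_kf)(y)=f(y)$ for all $y\in\mathring K$; (vi) $\lim_{h\to+\infty}\mathcal F_k(\delta_h^n)=1$ and $\mathcal F_h^{-1}(1)=\delta_h^n$; (vii) $\mathcal F_h^{-1}(\mathcal F_k(f))=\mathcal F_h(\mathcal F_k^{-1}(f))=\delta_h^n*_kf$. If $\sigma$ is a gauge with $\sigma\ll\rho$, and $k\in{}^\sigma\widetilde{\mathbb R}$ satisfies $k\gg\partial\rho^{-*}$ (everything being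 considered over ${}^\sigma\widetilde{\mathbb R}$ instead of ${}^\rho\widetilde{\mathbb R}$), then in the previous properties the limits can be replaced by $=_\rho$, with $h\in{}^\sigma\widetilde{\mathbb R}$ sufficiently large.
   Context: Fix a gauge $\rho=(\rho_\varepsilon)_{\varepsilon\in(0,1]}$: a net in $(0,1]$ with $\rho_\varepsilon\to0$ as $\varepsilon\to0^+$. ''For $\varepsilon$ small'' means for all $\varepsilon\in(0,\varepsilon_0]$, for some $\varepsilon_0$. A net $(x_\varepsilon)$ of reals is $\rho$-moderate if for some $N\in\mathbb N$, $|x_\varepsilon|\le\rho_\varepsilon^{-N}$ for $\varepsilon$ small; $(x_\varepsilon)\sim_\rho(y_\varepsilon)$ if for every $m\in\mathbb N$, $|x_\varepsilon-y_\varepsilon|\le\rho_\varepsilon^m$ for $\varepsilon$ small. $\widetilde{\mathbb R}={}^\rho\widetilde{\mathbb R}$ is the quotient ring of moderate nets by $\sim_\rho$, with classes $[x_\varepsilon]$; $\widetilde{\mathbb C}:=\widetilde{\mathbb R}+i\widetilde{\mathbb R}$; $\mathrm d\rho:=[\rho_\varepsilon]$. Order: $[x_\varepsilon]\le[y_\varepsilon]$ iff there are representatives with $x_\varepsilon\le y_\varepsilon$ for all $\varepsilon$; $x<y$ means $x\le y$ and $y-x$ invertible. $|[x_\varepsilon]|:=[|x_\varepsilon|]$ on $\widetilde{\mathbb R}^n$; intervals are taken in $\widetilde{\mathbb R}$ w.r.t. $\le$ and $<$. The sharp topology on $\widetilde{\mathbb R}^n$ has as base the balls $B_r(c)=\{x\mid|x-c|<r\}$,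 $r\in\widetilde{\mathbb R}_{>0}$; $\mathring K$ is the sharp interior of $K$. $x$ is infinite if $|x|\ge r$ for all $r\in\mathbb R_{>0}$. Generalized smooth functions (GSF): for $X\subseteq\widetilde{\mathbb R}^n$, $f\in{}^{\rho}\mathcal{GC}^\infty(X)$ means $f:X\to\widetilde{\mathbb C}$ and there is a net $f_\varepsilon\in\mathcal C^\infty(\mathbb R^n,\mathbb C)$ such that for all $[x_\varepsilon]\in X$: $f([x_\varepsilon])=[f_\varepsilon(x_\varepsilon)]$ and $(\partial^\alpha f_\varepsilon(x_\varepsilon))$ is $\rho$-moderate for all $\alpha\in\mathbb N^n$. For a box, $\int_{\prod_i[a_i,b_i]}f\,\mathrm dx:=\big[\int_{a_{1,\varepsilon}}^{b_{1,\varepsilon}}\mathrm dx_1\dots\int_{a_{n,\varepsilon}}^{b_{n,\varepsilon}}f_\varepsilon\,\mathrm dx_n\big]$. For infinite $k\in\widetilde{\mathbb R}_{>0}$, $K=[-k,k]^n$, and $\omega,x\in\widetilde{\mathbb R}^n$: $\mathcal F_k(f)(\omega):=\int_Kf(x)e^{-ix\cdot\omega}\,\mathrm dx$, $\mathcal F_k^{-1}(f)(x):=(2\pi)^{-n}\int_Kf(\omega)e^{ix\cdot\omega}\,\mathrm d\omega$. $S(x):=\frac12\int_{-1}^1\cos(xt)\,\mathrm dt$ is the smooth extension of $\sin(x)/x$. The Dirichlet delta function is $\delta_h^n(z):=\prod_{j=1}^n\frac{h}{\pi}S(hz_j)$, $z\in\widetilde{\mathbb R}^n$, a GSF; it is the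 class of $\varepsilon\mapsto$ the classical inverse Fourier transform $(2\pi)^{-n}\int_{[-h_\varepsilon,h_\varepsilon]^n}e^{iz\cdot\omega}\,\mathrm d\omega$. $\lim_{h\to+\infty}a(h)=l$ means (sharp topology): $\forall q\in\mathbb N\,\exists\bar h\in\widetilde{\mathbb R}\,\forall h\in\widetilde{\mathbb R}$, $h\ge\bar h$: $|a(h)-l|\le\mathrm d\rho^q$; for functions the limit is pointwise. For a second gauge $\sigma$: $\sigma\ll\rho$ means $\exists Q\in\mathbb N\,\forall q\in\mathbb N$: $\sigma_\varepsilon^Q\le\rho_\varepsilon^q$ for $\varepsilon$ small. ${}^\sigma\widetilde{\mathbb R}$ is defined as ${}^\rho\widetilde{\mathbb R}$ with $\sigma$ in place of $\rho$; in it put $\partial\rho:=[\rho_\varepsilon]$. For $x,y$ over ${}^\sigma\widetilde{\mathbb R}$, $x=_\rho y$ means $|x-y|\le\partial\rho^q$ for all $q\in\mathbb N$. $k\gg\partial\rho^{-*}$ means $k\ge\partial\rho^{-Q}$ for all $Q\in\mathbb N$. *)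

(* Defs.v *)
From HB Require Import structures.
From mathcomp Require Import all_boot all_order all_algebra.
From mathcomp Require Import generic_quotient ring_quotient.
From mathcomp Require Import all_classical all_reals all_analysis.
From mathcomp.real_closed Require Import complex.

Set Implicit Arguments.
Unset Strict Implicit.
Unset Printing Implicit Defensive.
Import Order.TTheory GRing.Theory Num.Theory.
Import numFieldNormedType.Exports.
Local Open Scope classical_set_scope.
Local Open Scope ring_scope.
Local Open Scope quotient_scope.

(* A net indexed by (0,1] is a total function on R whose values outside (0,1]
   are never looked at. "For e small" is the filter 0^'+. *)
Record gauge (R : realType) := Gauge {
  gauge_fun :> R -> R;
  gauge_itv : forall e, 0 < e <= 1 -> 0 < gauge_fun e <= 1;
  gauge_cvg0 : gauge_fun e @[e --> 0^'+] --> (0 : R) }.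

Section Rtilde.
Context {R : realType} (rho : gauge R).

Definition moderate (x : R -> R) : Prop :=
  exists N : nat, \forall e \near 0^'+, `|x e| <= rho e ^- N.

Definition negligible (x : R -> R) : Prop :=
  forall m : nat, \forall e \near 0^'+, `|x e| <= rho e ^+ m.

Lemma near_itv01 : \forall e \near (0 : R)^'+, 0 < e <= 1.
Proof.
near=> e; apply/andP; split; near: e; first exact: nbhs_right_gt.
exact: nbhs_right_le.
Unshelve. all: by end_near. Qed.

Lemma gauge_near : \forall e \near 0^'+, 0 < rho e <= 1.
Proof. by apply: filterS near_itv01 => e; exact: gauge_itv. Qed.

Lemma gauge_near_le (c : R) : 0 < c -> \forall e \near 0^'+, rho e <= c.
Proof.
move=> c0; have /cvgrPdist_le/(_ c c0) := @gauge_cvg0 _ rho.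
by apply: filterS => e; rewrite sub0r normrN; apply: le_trans; rewrite ler_norm.
Qed.

Definition moderate_pred : {pred (R -> R)} := fun x => `[< moderate x >].

Lemma moderate_subring : subring_closed moderate_pred.
Proof.
split.
- apply/asboolP; exists 0%N; apply: filterS gauge_near => e _.
  by rewrite expr0 invr1 normr1.
- move=> x y /asboolP[N hN] /asboolP[M hM]; apply/asboolP.
  exists (N + M).+1; near=> e.
  have /andP[r0 r1] : 0 < rho e <= 1 by near: e; exact: gauge_near.
  have r2 : rho e <= 2^-1 by near: e; exact: gauge_near_le.
  have xN : `|x e| <= rho e ^- N by near: e.
  have yM : `|y e| <= rho e ^- M by near: e.
  apply: (le_trans (ler_normB _ _)); apply: (le_trans (lerD xN yM)).
  have mono a b : (a <= b)%N -> rho e ^- a <= rho e ^- b.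
    by move=> ab; rewrite lef_pV2 ?posrE ?exprn_gt0// ler_wiXn2l// ltW.
  apply: (le_trans (lerD (mono _ _ (leq_addr M N)) (mono _ _ (leq_addl N M)))).
  rewrite exprS invfM -mulr2n -[leLHS]mulr_natl ler_wpM2r//.
    by rewrite invr_ge0 exprn_ge0// ltW.
  by rewrite -[leLHS]invrK lef_pV2// posrE.
- move=> x y /asboolP[N hN] /asboolP[M hM]; apply/asboolP.
  exists (N + M)%N; near=> e.
  have xN : `|x e| <= rho e ^- N by near: e.
  have yM : `|y e| <= rho e ^- M by near: e.
  have -> : (x * y) e = x e * y e by [].
  by rewrite normrM exprD invfM ler_pM.
Unshelve. all: by end_near. Qed.

HB.instance Definition _ :=
  GRing.isSubringClosed.Build (R -> R) moderate_pred moderate_subring.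

Record mnet := Mnet { mnet_val :> R -> R; _ : mnet_val \in moderate_pred }.
HB.instance Definition _ := [isSub for mnet_val].
HB.instance Definition _ := [Choice of mnet by <:].
HB.instance Definition _ := [SubChoice_isSubComNzRing of mnet by <:].

Definition negligible_pred : {pred mnet} := fun x => `[< negligible x >].

Lemma negligible_idealr : idealr_closed negligible_pred.
Proof.
split.
- apply/asboolP => m; apply: filterS gauge_near => e /andP[r0 _].
  have -> : (0 : mnet) e = 0 by [].
  by rewrite normr0 exprn_ge0// ltW.
- apply/negP => /asboolP /(_ 1%N) h.
  have h' : \forall e \near (0 : R)^'+, False.
    near=> e.
    have : rho e <= 2^-1 by near: e; exact: gauge_near_le.
    have : `|(1 : mnet) e| <= rho e ^+ 1 by near: e.
    have -> : (1 : mnet) e = 1 by [].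
    rewrite expr1 normr1 => /le_trans h1 /h1.
    by rewrite leNgt invf_lt1// ltr1n.
  by have [? []] := filter_ex h'.
- move=> a u v /asboolP hu /asboolP hv; apply/asboolP => m.
  have /asboolP[N hN] := valP a.
  near=> e.
  have /andP[r0 r1] : 0 < rho e <= 1 by near: e; exact: gauge_near.
  have r2 : rho e <= 2^-1 by near: e; exact: gauge_near_le.
  have aN : `|a e| <= rho e ^- N by near: e.
  have ue : `|u e| <= rho e ^+ (N + m.+1) by near: e; exact: hu.
  have ve : `|v e| <= rho e ^+ m.+1 by near: e; exact: hv.
  have -> : (a * u + v) e = a e * u e + v e.  by [].
  apply: (le_trans (ler_normD _ _)); rewrite normrM.
  have h1 : `|a e| * `|u e| <= rho e ^+ m.+1.
    apply: (le_trans (ler_pM _ _ aN ue)) => //.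
    by rewrite exprD mulrA mulVf ?mul1r// expf_neq0// gt_eqF.
  apply: (le_trans (lerD h1 ve)).
  rewrite -mulr2n -[leLHS]mulr_natl exprS mulrA -[leRHS]mul1r ler_wpM2r//.
    by rewrite exprn_ge0// ltW.
  by rewrite -ler_pdivlMl// mulr1.
Unshelve. all: by end_near. Qed.

HB.instance Definition _ := isIdealr.Build mnet negligible_pred negligible_idealr.

Definition gR : Type := {ideal_quot negligible_pred}.
HB.instance Definition _ := GRing.ComNzRing.on gR.
HB.instance Definition _ := EqQuotient.on gR.

(* The inverse of a non-invertible element is itself, by the convention of
   unitRingType. *)
Definition gunit : {pred gR} := fun x => `[< exists y, y * x = 1 >].
Definition ginv (x : gR) : gR := xget x [set y | y * x = 1].

Lemma gmulVx : {in gunit, left_inverse 1 ginv *%R}.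
Proof. by move=> x /asboolP[y yx]; rewrite /ginv; case: xgetP => // /(_ y). Qed.

Lemma gunitPl (x y : gR) : y * x = 1 -> x \in gunit.
Proof. by move=> yx; apply/asboolP; exists y. Qed.

Lemma ginv_out : {in [predC gunit], ginv =1 id}.
Proof.
move=> x /negP xU; rewrite /ginv; case: xgetP => // y _ /= yx.
by case: xU; apply: gunitPl yx.
Qed.

HB.instance Definition _ :=
  GRing.ComNzRing_hasMulInverse.Build gR gmulVx gunitPl ginv_out.

(* The class [x_e]; the class of a net that is not moderate is 0. *)
Definition gcls (x : R -> R) : gR := \pi_gR (insubd (0 : mnet) x).

Definition gnet (x : gR) : R -> R := mnet_val (repr x).

Definition gconst (r : R) : gR := gcls (fun=> r).

Definition dgauge : gR := gcls rho.

(* A partial order; [glt] below is not its strict part. *)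
Definition gle (x y : gR) : Prop :=
  exists u v : mnet, [/\ \pi_gR u = x, \pi_gR v = y &
    forall e, 0 < e <= 1 -> u e <= v e].

Definition glt (x y : gR) : Prop := gle x y /\ y - x \is a GRing.unit.

Definition gabs (x : gR) : gR := gcls (fun e => `|gnet x e|).

Definition ginfinite (x : gR) : Prop :=
  forall r : R, 0 < r -> gle (gconst r) (gabs x).

Definition gC : Type := complex gR.
HB.instance Definition _ := GRing.Zmodule.on gC.

Fact gC_mul1 : left_id (Complex 1 0 : gC) (@ComplexField.mulc gR).
Proof. by case=> a b /=; rewrite !mul1r !mul0r subr0 addr0. Qed.

Fact gC_mulDl : left_distributive (@ComplexField.mulc gR) (+%R : gC -> gC -> gC).
Proof.
move=> [a b] [c d] [x y]; rewrite /GRing.add /= !mulrDl !opprD -!addrA.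
by congr (Complex (_ + _) (_ + _)); rewrite addrCA.
Qed.

Fact gC_one_neq0 : (Complex 1 0 : gC) != 0.
Proof. by rewrite eq_complex /= oner_eq0. Qed.

HB.instance Definition _ := GRing.Zmodule_isComNzRing.Build gC
  (@ComplexField.mulcA gR) (@ComplexField.mulcC gR) gC_mul1 gC_mulDl gC_one_neq0.

Definition gRtoC (x : gR) : gC := Complex x 0.

Definition gcclass (z : R -> R[i]%C) : gC :=
  Complex (gcls (fun e => complex.Re (z e))) (gcls (fun e => complex.Im (z e))).

Definition gcabs (z : gC) : gR :=
  gcls (fun e => Normc.normc (Complex (gnet (complex.Re z) e) (gnet (complex.Im z) e))).

Definition cmoderate (z : R -> R[i]%C) : Prop :=
  moderate (fun e => Normc.normc (z e)).

Section Vectors.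
Variable n : nat.

Definition vmoderate (x : R -> 'rV[R]_n) : Prop :=
  forall j, moderate (fun e => x e 0 j).

Definition gvcls (x : R -> 'rV[R]_n) : 'rV[gR]_n :=
  \row_j gcls (fun e => x e 0 j).

Definition gvnet (x : 'rV[gR]_n) : R -> 'rV[R]_n :=
  fun e => \row_j gnet (x 0 j) e.

(* Euclidean norm; the norm of the library on row vectors is the max norm. *)
Definition gvabs (x : 'rV[gR]_n) : gR :=
  gcls (fun e => Num.sqrt (\sum_j (gvnet x e 0 j) ^+ 2)).

Definition gdot (x y : 'rV[gR]_n) : gR := \sum_j x 0 j * y 0 j.

Definition gball (r : gR) (c : 'rV[gR]_n) : set 'rV[gR]_n :=
  [set x | glt (gvabs (x - c)) r].

Definition sharp_interior (A : set 'rV[gR]_n) : set 'rV[gR]_n :=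
  [set x | exists r c, [/\ glt 0 r, gball r c x & gball r c `<=` A]].

Definition gbox (a b : 'rV[gR]_n) : set 'rV[gR]_n :=
  [set x | forall j, gle (a 0 j) (x 0 j) /\ gle (x 0 j) (b 0 j)].

Definition gcube (a b : gR) : set 'rV[gR]_n := gbox (const_mx a) (const_mx b).
End Vectors.
End Rtilde.

Arguments gball {R rho n}.
Arguments sharp_interior {R rho n}.
Arguments gcube {R rho} n a b.

Section Calculus.
Context {R : realType}.

Definition partial n (j : 'I_n) (g : 'rV[R]_n -> R) : 'rV[R]_n -> R :=
  'D_(delta_mx 0 j) g.

Definition partials n (s : seq 'I_n) (g : 'rV[R]_n -> R) : 'rV[R]_n -> R :=
  foldr (@partial n) g s.

Definition mpartial n (alpha : 'I_n -> nat) (g : 'rV[R]_n -> R) :=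
  partials (flatten [seq nseq (alpha j) j | j <- enum 'I_n]) g.

(* s ranges over all orders of differentiation, mixed ones included. *)
Definition smooth n (g : 'rV[R]_n -> R) : Prop := forall s : seq 'I_n,
  continuous (partials s g) /\
  forall j x, derivable (partials s g) x (delta_mx 0 j).

Definition csmooth n (f : 'rV[R]_n -> R[i]%C) : Prop :=
  smooth (fun x => complex.Re (f x)) /\ smooth (fun x => complex.Im (f x)).

Definition cmpartial n (alpha : 'I_n -> nat) (f : 'rV[R]_n -> R[i]%C)
    (x : 'rV[R]_n) : R[i]%C :=
  Complex (mpartial alpha (fun y => complex.Re (f y)) x)
          (mpartial alpha (fun y => complex.Im (f y)) x).

(* Oriented: boxes are given by arbitrary representatives of their endpoints,
   so a <= b may fail for some values of the index. *)
Definition oint (a b : R) (g : R -> R) : R :=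
  if a <= b then \int[lebesgue_measure]_(t in `[a, b]) g t
  else - \int[lebesgue_measure]_(t in `[b, a]) g t.

(* \int_(a_1)^(b_1) dx_1 ... \int_(a_n)^(b_n) g dx_n *)
Fixpoint itint n : 'rV[R]_n -> 'rV[R]_n -> ('rV[R]_n -> R) -> R :=
  match n with
  | 0%N => fun _ _ g => g 0
  | m.+1 => fun (a b : 'rV[R]_(1 + m)) g => oint (a 0 0) (b 0 0) (fun t =>
      itint (rsubmx a) (rsubmx b) (fun x => g (row_mx (t%:M : 'rV_1) x)))
  end.

Definition citint n (a b : 'rV[R]_n) (f : 'rV[R]_n -> R[i]%C) : R[i]%C :=
  Complex (itint a b (fun x => complex.Re (f x))) (itint a b (fun x => complex.Im (f x))).

Definition sinc (x : R) : R := 2^-1 * oint (-1) 1 (fun t => cos (x * t)).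
End Calculus.

Section GSF.
Context {R : realType} {rho : gauge R}.
Local Notation gR := (gR rho).
Local Notation gC := (gC rho).

(* The net F defines f on X. A map X -> gC is a total map of which only the
   values on X matter. *)
Definition gsf_net n (X : set 'rV[gR]_n) (f : 'rV[gR]_n -> gC)
    (F : R -> 'rV[R]_n -> R[i]%C) : Prop :=
  (forall e, 0 < e <= 1 -> csmooth (F e)) /\
  forall x : R -> 'rV[R]_n, vmoderate rho x -> X (gvcls rho x) ->
    f (gvcls rho x) = gcclass rho (fun e => F e (x e)) /\
    forall alpha : 'I_n -> nat,
      cmoderate rho (fun e => cmpartial alpha (F e) (x e)).

Definition gsf n (X : set 'rV[gR]_n) (f : 'rV[gR]_n -> gC) : Prop :=
  exists F, gsf_net X f F.

(* The value does not depend on the net F defining f on the box, nor on the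
   representatives of a and b; it is 0 if no net defines f there. *)
Definition gint n (a b : 'rV[gR]_n) (f : 'rV[gR]_n -> gC) : gC :=
  xget 0 [set I | exists2 F, gsf_net (gbox a b) f F &
    I = gcclass rho (fun e => citint (gvnet a e) (gvnet b e) (F e))].

Definition gcubint n (a b : gR) (f : 'rV[gR]_n -> gC) : gC :=
  gint (const_mx a) (const_mx b) f.

(* e^(i t), from cos + i sin on representatives *)
Definition gexpi (t : gR) : gC :=
  Complex (gcls rho (fun e => cos (gnet t e)))
          (gcls rho (fun e => sin (gnet t e))).

Definition gfourier n (k : gR) (f : 'rV[gR]_n -> gC) (omega : 'rV[gR]_n) : gC :=
  gcubint (- k) k (fun x => f x * gexpi (- gdot x omega)).

Definition gfourierV n (k : gR) (f : 'rV[gR]_n -> gC) (x : 'rV[gR]_n) : gC :=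
  gRtoC (gconst rho (2 * pi) ^- n) *
  gcubint (- k) k (fun omega => f omega * gexpi (gdot x omega)).

Definition gsinc (x : gR) : gR := gcls rho (fun e => sinc (gnet x e)).

Definition dirichlet n (h : gR) (z : 'rV[gR]_n) : gR :=
  \prod_j (h / gconst rho pi * gsinc (h * z 0 j)).

Definition dirichletC n (h : gR) (z : 'rV[gR]_n) : gC := gRtoC (dirichlet h z).

Definition dirichlet_conv n (h k : gR) (f : 'rV[gR]_n -> gC) (y : 'rV[gR]_n) : gC :=
  gcubint (- k) k (fun x => dirichletC h (y - x) * f x).

Definition glim (a : gR -> gC) (l : gC) : Prop :=
  forall q : nat, exists hbar : gR, forall h : gR, gle hbar h ->
    gle (gcabs (a h - l)) (dgauge rho ^+ q).
End GSF.

Definition gauge_ll (R : realType) (sigma rho : gauge R) : Prop :=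
  exists Q : nat, forall q : nat,
    \forall e \near 0^'+, sigma e ^+ Q <= rho e ^+ q.

(* x =_rho y over the gauge sigma; [gcls sigma rho] is the class of the net rho
   there. *)
Definition geq_upto (R : realType) (sigma rho : gauge R) (x y : gC sigma) : Prop :=
  forall q : nat, gle (gcabs (x - y)) (gcls sigma rho ^+ q).

(* k >> [rho]^(-star) over the gauge sigma *)
Definition gg_gauge (R : realType) (sigma rho : gauge R) (k : gR sigma) : Prop :=
  forall Q : nat, gle (gcls sigma rho ^- Q) k.

Definition for_large (R : realType) (sigma : gauge R) (P : gR sigma -> Prop) : Prop :=
  exists hbar, forall h, gle hbar h -> P h.

(* Main.v *)
(** At a fixed value of the index everything is a statement about iterated
integrals of smooth functions. The kernel [h / pi * S (h t)] has the primitive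
[Si (h t) / pi], which differs from [1/2] (for [t > 0]) by [O (1 / (h t))], by
the Dirichlet integral; integrating by parts one variable at a time bounds the
error of the convolution at [y] by [M * ((1 + c) ^ n - 1)], where [M] bounds the
mixed first derivatives of [f] on the box and [c] tends to [0] like a power of
[1 / h]. Since the points of a box where a derivative is maximal form again a
net of points of that box, [M] is moderate, so [h >= drho ^ (- P)] with [P] large
makes the error smaller than any prescribed power of the gauge: this is (v).
The limits (ii), (iv) and (vi) are (v) at [y = 0], and (vii) is Fubini together
with [delta_h (z) = (2 pi) ^ (- n) \int_([-h, h]^n) cos (z . w) dw].
Over [sigma << rho], a bound by [dsigma ^ Q] is a bound by every power of [rho],
so the second half is the first one over [sigma], with [q := Q]. *)

Require Import Defs.
From HB Require Import structures.
From mathcomp Require Import all_boot all_order all_algebra.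
From mathcomp Require Import generic_quotient ring_quotient.
From mathcomp Require Import all_classical all_reals all_analysis.
From mathcomp.real_closed Require Import complex.
From mathcomp Require Import ring lra zify.

Set Implicit Arguments.
Unset Strict Implicit.
Unset Printing Implicit Defensive.
Import Order.TTheory GRing.Theory Num.Theory.
Import numFieldNormedType.Exports.
Local Open Scope classical_set_scope.
Local Open Scope ring_scope.

(** * Iterated integrals of continuous functions *)

(** The limit in [h] runs over all generalized numbers above a threshold, so convergence at each
    fixed index does not suffice: an explicit rate, polynomial in [1 / h], is required. This is why
    the Dirichlet integral is proved together with its error term. Two features of the definitions
    shape the rest. Representatives of [a <= b] may be misordered at some values of the index, and
    the generalized integral is a choice among defining nets; so integrals are oriented, and
    independence of all representatives is established before any integral is computed. Moderateness
    is given only for derivatives taken in one fixed order of the variables, and no symmetry of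
    mixed derivatives is used; so derivatives are words over the variables, and only sorted words
    carry bounds. *)

Section OrientedIntegral.
Context {R : realType}.
Implicit Types (f g F G : R -> R) (a b c : R).

Local Lemma integrable_continuous f a b : continuous f ->
  lebesgue_measure.-integrable `[a, b] (EFin \o f).
Proof.
move=> cf; apply: continuous_compact_integrable; first exact: segment_compact.
exact: continuous_subspaceT.
Qed.

Lemma is_derive_continuous F f : (forall x : R, is_derive x 1 F (f x)) ->
  continuous F.
Proof.
by move=> dF x; apply/differentiable_continuous/derivable1_diffP; case: (dF x).
Qed.

Lemma ointE a b f : a <= b -> oint a b f = \int[lebesgue_measure]_(t in `[a, b]) f t.
Proof. by move=> ab; rewrite /oint ab. Qed.

Lemma ointxx a f : oint a a f = 0.
Proof. by rewrite ointE// set_itv1 Rintegral_set1. Qed.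

(** Orientation removes the case distinction on [a] and [b]; together with [ex_primitive] this
    reduces the algebra of integrals to that of primitives. *)
Lemma oint_FTC F f a b : (forall x : R, is_derive x 1 F (f x)) ->
  continuous f -> oint a b f = F b - F a.
Proof.
move=> dF cf; have cF := is_derive_continuous dF.
have ftc u v : u < v -> \int[lebesgue_measure]_(t in `[u, v]) f t = F v - F u.
  move=> uv; rewrite /Rintegral (@continuous_FTC2 _ _ F)//.
  - exact: continuous_subspaceT.
  - split; first by move=> x _; case: (dF x).
    + exact: cvg_at_right_filter (cF u).
    + exact: cvg_at_left_filter (cF v).
  - by move=> x _; rewrite derive1E derive_val.
have [ab|ba|->] := ltgtP a b.
- by rewrite ointE ?ltW// ftc.
- by rewrite /oint leNgt ba/= ftc// opprB.
- by rewrite ointxx subrr.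
Qed.

Lemma ex_primitive f : continuous f ->
  exists F, forall x : R, is_derive x 1 F (f x).
Proof.
move=> cf; exists (fun x => oint 0 x f) => x.
(* A base point to the left of both [0] and [x]: the fundamental theorem applies on [[c, x + 1]]
   with [x] inside, and [P y - P 0] agrees near [x] with the oriented integral from [0], whatever
   the sign of [y]. *)
pose c := Num.min 0 x - 1.
have c0 : c < 0 by rewrite /c ltrBlDr; apply: (@le_lt_trans _ _ 0); rewrite ?ge_min ?lexx//; lra.
have cx : c < x.
  by rewrite /c; apply: (@le_lt_trans _ _ (x - 1)); [rewrite lerD2r ge_min lexx orbT|lra].
pose P := fun y => \int[lebesgue_measure]_(t in `[c, y]) f t.
have dP : is_derive x 1 P (f x).
  have [] := @continuous_FTC1_closed _ f c x (x + 1) _ _ cx (cf x).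
  - by rewrite ltrDl.
  - exact: integrable_continuous.
  by move=> dP P'; apply: DeriveDef; [exact: dP|rewrite -derive1E].
have split_c u v : c <= u -> u <= v -> \int[lebesgue_measure]_(t in `[u, v]) f t = P v - P u.
  move=> cu uv; rewrite -Rintegral_itv_obnd_cbnd.
    by rewrite -(@Rintegral_itvB _ _ (BLeft c))//; exact: integrable_continuous.
  by apply: (@integrableS _ _ _ lebesgue_measure `[u, v]) => //;
    [exact: subset_itv_oc_cc|exact: integrable_continuous].
have dPc : is_derive x 1 (fun y => P y - P 0) (f x).
  by apply: (@is_derive_eq _ _ _ _ _ _ _ _ (@is_deriveB _ _ _ _ _ _ _ _ _ dP (is_derive_cst (P 0) _ _))); rewrite subr0.
apply: near_eq_is_derive dPc.
near=> y.
have cy : c < y by near: y; exact: lt_nbhsr.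
have [y0|y0] := leP 0 y.
  by rewrite ointE// split_c// ltW.
by rewrite /oint leNgt y0/= split_c ?ltW// opprB.
Unshelve. all: by end_near. Qed.

Lemma eq_oint f g a b : f =1 g -> oint a b f = oint a b g.
Proof. by move=> /funext ->. Qed.

Lemma ointD f g a b : continuous f -> continuous g ->
  oint a b (fun t => f t + g t) = oint a b f + oint a b g.
Proof.
move=> cf cg; have [F dF] := ex_primitive cf; have [G dG] := ex_primitive cg.
rewrite (@oint_FTC (F + G) (fun t => f t + g t)).
- by rewrite (oint_FTC a b dF)// (oint_FTC a b dG)// !fctE; ring.
- by move=> x; apply: cvgD; [exact: cf|exact: cg].
Qed.

Lemma ointZ (k : R) f a b : continuous f ->
  oint a b (fun t => k * f t) = k * oint a b f.
Proof.
move=> cf; have [F dF] := ex_primitive cf.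
rewrite (@oint_FTC (k \*: F) (fun t => k * f t)).
- by rewrite (oint_FTC a b dF)// mulrBr.
- by move=> x; apply: cvgM; [exact: cvg_cst|exact: cf].
Qed.

Lemma oint_cat f a b c : continuous f -> oint a b f + oint b c f = oint a c f.
Proof.
move=> cf; have [F dF] := ex_primitive cf.
by rewrite !(oint_FTC _ _ dF)//; ring.
Qed.

Lemma oint_rev f a b : continuous f -> oint b a f = - oint a b f.
Proof.
move=> cf; have [F dF] := ex_primitive cf.
by rewrite !(oint_FTC _ _ dF)//; ring.
Qed.

Lemma is_derive_oint f a : continuous f ->
  forall x : R, is_derive x 1 (fun y => oint a y f) (f x).
Proof.
move=> cf x; have [F dF] := ex_primitive cf.
have -> : (fun y => oint a y f) = F - cst (F a).
  by apply/funext => y; rewrite (oint_FTC _ _ dF).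
by apply: is_derive_eq; rewrite subr0.
Qed.

(** The mean value theorem for a primitive evaluates [f] at an interior point, so a bound on the
    open interval is enough. Later bounds on derivatives are available only there. *)
Lemma le_oint f a b M : continuous f ->
  (forall t, Num.min a b < t < Num.max a b -> `|f t| <= M) ->
  `|oint a b f| <= M * `|b - a|.
Proof.
wlog ab : a b / a <= b.
  move=> H cf; have [ab|/ltW ba] := leP a b; first by have := H a b ab cf; rewrite min_l// max_r.
  by rewrite oint_rev// normrN distrC => fM; apply: H => //; rewrite min_l// max_r.
rewrite min_l// max_r// => cf fM; have [F dF] := ex_primitive cf.
rewrite (oint_FTC _ _ dF)//.
move: ab; rewrite le_eqVlt => /orP[/eqP ->|ab]; first by rewrite !subrr normr0 mulr0.
have [|t] := @MVT _ F f a b ab (fun x _ => dF x).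
  exact/continuous_subspaceT/(is_derive_continuous dF).
rewrite in_itv/= => tab ->; rewrite normrM ler_wpM2r// fM//.
Qed.

End OrientedIntegral.

(** * Continuity of composite functions *)

Section ContinuousCombinators.
Context {R : realType}.

Lemma continuousT_comp {S T U : topologicalType} (f : S -> T) (g : T -> U) :
  continuous f -> continuous g -> continuous (fun x => g (f x)).
Proof. by move=> cf cg x; apply: continuous_comp; [exact: cf|exact: cg]. Qed.

Lemma continuousT_pair {S T U : topologicalType} (f : S -> T) (g : S -> U) :
  continuous f -> continuous g -> continuous (fun x => (f x, g x)).
Proof. by move=> cf cg x; apply: cvg_pair; [exact: cf|exact: cg]. Qed.

Lemma continuousT_fst {S T U : topologicalType} (f : S -> T * U) :
  continuous f -> continuous (fun x => (f x).1).
Proof. by move=> cf x; apply: cvg_comp (cf x) _; exact: cvg_fst. Qed.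

Lemma continuousT_snd {S T U : topologicalType} (f : S -> T * U) :
  continuous f -> continuous (fun x => (f x).2).
Proof. by move=> cf x; apply: cvg_comp (cf x) _; exact: cvg_snd. Qed.

Lemma continuousT_id {S : topologicalType} : continuous (fun x : S => x).
Proof. by move=> x; exact: cvg_id. Qed.

Lemma continuousT_cst {S T : topologicalType} (c : T) : continuous (fun _ : S => c).
Proof. by move=> x; exact: cvg_cst. Qed.

Lemma continuousT_add {S : topologicalType} (f g : S -> R) :
  continuous f -> continuous g -> continuous (fun x => f x + g x).
Proof. by move=> cf cg x; apply: cvgD; [exact: cf|exact: cg]. Qed.

Lemma continuousT_opp {S : topologicalType} (f : S -> R) :
  continuous f -> continuous (fun x => - f x).
Proof. by move=> cf x; apply: cvgN; exact: cf. Qed.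

Lemma continuousT_mul {S : topologicalType} (f g : S -> R) :
  continuous f -> continuous g -> continuous (fun x => f x * g x).
Proof. by move=> cf cg x; apply: cvgM; [exact: cf|exact: cg]. Qed.

Lemma continuousT_cos {S : topologicalType} (f : S -> R) :
  continuous f -> continuous (fun x : S => cos (f x)).
Proof.
by move=> cf x; apply: (@continuous_comp _ _ _ f cos); [exact: cf|exact: continuous_cos].
Qed.

Lemma continuousT_sin {S : topologicalType} (f : S -> R) :
  continuous f -> continuous (fun x : S => sin (f x)).
Proof.
by move=> cf x; apply: (@continuous_comp _ _ _ f sin); [exact: cf|exact: continuous_sin].
Qed.

Lemma continuousT_expR {S : topologicalType} (f : S -> R) :
  continuous f -> continuous (fun x : S => expR (f x)).
Proof.
by move=> cf x; apply: (@continuous_comp _ _ _ f expR); [exact: cf|exact: continuous_expR].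
Qed.

Lemma continuousT_coord {S : topologicalType} m (f : S -> 'rV[R]_m) j :
  continuous f -> continuous (fun x : S => f x 0 j).
Proof.
move=> cf x; apply: (@continuous_comp _ _ _ f (fun v : 'rV[R]_m => v 0 j)).
  exact: cf.
exact: coord_continuous.
Qed.

Lemma continuousT_sum {S : topologicalType} (I : finType) (f : I -> S -> R) :
  (forall i, continuous (f i)) -> continuous (fun x : S => \sum_i f i x).
Proof.
move=> cf; have : forall r : seq I, continuous (fun x : S => \sum_(i <- r) f i x).
  elim=> [|i r IH].
    rewrite (_ : (fun _ => _) = (fun=> 0)); first exact: continuousT_cst.
    by apply/funext => x; rewrite big_nil.
  rewrite (_ : (fun _ => _) = (fun x => f i x + \sum_(j <- r) f j x)).
    by apply: (@continuousT_add _ (f i)).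
  by apply/funext => x; rewrite big_cons.
exact.
Qed.

Lemma continuousT_prod {S : topologicalType} (I : finType) (f : I -> S -> R) :
  (forall i, continuous (f i)) -> continuous (fun x : S => \prod_i f i x).
Proof.
move=> cf; have : forall r : seq I, continuous (fun x : S => \prod_(i <- r) f i x).
  elim=> [|i r IH].
    rewrite (_ : (fun _ => _) = (fun=> 1)); first exact: continuousT_cst.
    by apply/funext => x; rewrite big_nil.
  rewrite (_ : (fun _ => _) = (fun x => f i x * \prod_(j <- r) f j x)).
    by apply: (@continuousT_mul _ (f i)).
  by apply/funext => x; rewrite big_cons.
exact.
Qed.

End ContinuousCombinators.

Ltac cont := repeat first [assumption | lazymatch goal with
  | |- continuous (fun x => x) => refine (@continuousT_id _)
  | |- continuous (fun _ => ?c) => refine (@continuousT_cst _ _ _)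
  | |- continuous (@cos _) => exact: continuous_cos
  | |- continuous (@sin _) => exact: continuous_sin
  | |- continuous (@expR _) => exact: continuous_expR
  | |- continuous fst => refine (@continuousT_fst _ _ _ _ (@continuousT_id _))
  | |- continuous snd => refine (@continuousT_snd _ _ _ _ (@continuousT_id _))
  | |- continuous (fun x => cos (@?f x)) => refine (@continuousT_cos _ _ f _)
  | |- continuous (fun x => sin (@?f x)) => refine (@continuousT_sin _ _ f _)
  | |- continuous (fun x => expR (@?f x)) => refine (@continuousT_expR _ _ f _)
  | |- continuous (fun x => fun_of_matrix (@?f x) 0 ?j) => refine (@continuousT_coord _ _ _ f j _)
  | |- continuous (fun x => \sum_i @?f x i) => refine (@continuousT_sum _ _ _ (fun i x => f x i) _); move=> ?; cbv beta
  | |- continuous (fun x => \prod_i @?f x i) => refine (@continuousT_prod _ _ _ (fun i x => f x i) _); move=> ?; cbv beta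
  | |- continuous (fun x => fst (@?f x)) => refine (@continuousT_fst _ _ _ f _)
  | |- continuous (fun x => snd (@?f x)) => refine (@continuousT_snd _ _ _ f _)
  | |- continuous (fun x => (@?f x, @?g x)) => refine (@continuousT_pair _ _ _ f g _ _)
  | |- continuous (fun x => @?f x + @?g x) => refine (@continuousT_add _ _ f g _ _)
  | |- continuous (fun x => - @?f x) => refine (@continuousT_opp _ _ f _)
  | |- continuous (fun x => @?f x * @?g x) => refine (@continuousT_mul _ _ f g _ _)
  end].

(** * Integrals depending on parameters, and Fubini *)

Section ParametricIntegral.
Context {R : realType}.

Local Lemma continuous_slice {S T U : topologicalType} (phi : S * T -> U) (v : T) :
  continuous phi -> continuous (fun t => phi (t, v)).
Proof.
by move=> cphi; refine (continuousT_comp (g := phi) _ cphi); cont.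
Qed.

Local Lemma continuous_slicer {S T U : topologicalType} (phi : S * T -> U) (t : S) :
  continuous phi -> continuous (fun v => phi (t, v)).
Proof.
by move=> cphi; refine (@continuousT_comp _ _ _ (fun v => (t, v)) phi _ cphi); cont.
Qed.

Lemma oint_cst (c a b : R) : oint a b (fun=> c) = c * (b - a).
Proof.
have dF (x : R) : is_derive x 1 (c \*: id) c by apply: is_derive_eq; rewrite [LHS]mulr1.
by rewrite (oint_FTC a b dF); [rewrite mulrBr|cont].
Qed.

(** [T] is only a topological space, so uniform continuity is not at hand; compactness of the
    segment provides a single neighbourhood of [v] that is good for all [t] at once. *)
Lemma continuous_oint {T : topologicalType} (a b : R) (phi : R * T -> R) :
  continuous phi -> continuous (fun v => oint a b (fun t => phi (t, v))).
Proof.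
move=> cphi v; apply/cvgrPdist_le => e e0.
(* The [+ 1] keeps the denominator positive when [a = b]. *)
pose d := e / (`|b - a| + 1).
have ba0 : 0 < `|b - a| + 1 by rewrite ltr_wpDl.
have d0 : 0 < d by rewrite divr_gt0.
have := @segment_compact R (Num.min a b) (Num.max a b).
move=> /compact_near_coveringP/(_ T (nbhs v)
  (fun v' t => `|phi (t, v) - phi (t, v')| <= d) _).
have near_le (t : R) : \forall t' \near t & v' \near v, `|phi (t', v) - phi (t', v')| <= d.
  have d20 : 0 < d / 2 by rewrite divr_gt0.
  have c1 : \forall z \near (t, v), `|phi (t, v) - phi z| <= d / 2.
    by have /cvgrPdist_le := cphi (t, v); apply.
  have c2 : \forall t' \near t, `|phi (t, v) - phi (t', v)| <= d / 2.
    by have /cvgrPdist_le := @continuous_slice _ _ _ _ v cphi t; apply.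
  case: c1 => -[/= A B] [At Bv] AB.
  exists ((A `&` [set t' | `|phi (t, v) - phi (t', v)| <= d / 2]), B).
    by split => //=; exact: filterI.
  move=> [t' v'] [/= [At' Pt'] Bv'].
  have := AB (t', v') (conj At' Bv'); rewrite /= distrC in Pt' *.
  move=> h; rewrite (_ : _ - _ = phi (t', v) - phi (t, v) + (phi (t, v) - phi (t', v'))); last by ring.
  by rewrite (le_trans (ler_normD _ _))// [leRHS]splitr lerD// distrC.
move=> /(_ (fun t _ => near_le t)); apply: filterS => v' Pv'.
have -> : oint a b (fun t => phi (t, v)) - oint a b (fun t => phi (t, v')) =
    oint a b (fun t => phi (t, v) + (-1) * phi (t, v')).
  rewrite ointD ?ointZ ?mulN1r//; do ?exact: continuous_slice.
  by move=> t; apply: cvgM; [exact: cvg_cst|exact: continuous_slice].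
apply: (@le_trans _ _ (d * `|b - a|)).
  apply: le_oint.
    move=> t; apply: cvgD; first exact: continuous_slice.
    by apply: cvgM; [exact: cvg_cst|exact: continuous_slice].
  by move=> t /andP[t1 t2]; rewrite mulN1r; apply: Pv'; rewrite /= in_itv/= !ltW.
by rewrite /d -mulrA ler_piMr ?(ltW e0)// [leLHS]mulrC ler_pdivrMr// mul1r lerDl.
Qed.

Definition cons_rv m (t : R) (x : 'rV[R]_m) : 'rV[R]_(1 + m) :=
  row_mx (t%:M : 'rV_1) x.

Lemma cons_rv_continuous m :
  continuous (fun z : R * 'rV[R]_m => cons_rv z.1 z.2 : 'rV[R]_(1 + m)).
Proof.
move=> -[t x] A /nbhs_ballP[e /= e0 eA]; apply/nbhs_ballP; exists e => //=.
move=> [t' x'] [/= tt' [_ xx']]; apply: eA; split => // i j.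
rewrite /cons_rv !mxE; case: split_ordP => k _; last by rewrite !ord1; exact: xx'.
by rewrite !mxE !ord1 eqxx !mulr1n.
Qed.

Lemma itintS m (a b : 'rV[R]_(1 + m)) (g : 'rV[R]_(1 + m) -> R) :
  @itint R m.+1 a b g = oint (a 0 0) (b 0 0) (fun t =>
    itint (rsubmx a) (rsubmx b) (fun x => g (cons_rv t x))).
Proof. by []. Qed.

(** The parameter space is generalized in the induction: the first integration variable joins the
    parameters, so the hypothesis is used over [R * T]. *)
Lemma continuous_itint_param m (T : topologicalType) (a b : 'rV[R]_m)
    (phi : 'rV[R]_m * T -> R) :
  continuous phi -> continuous (fun v => itint a b (fun x => phi (x, v))).
Proof.
elim: m T a b phi => [|m IH] T a b phi cphi.
  exact: (@continuous_slicer _ _ _ phi 0).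
apply: (@continuous_oint T _ _ (fun z : R * T => itint _ _ (fun x => phi (cons_rv z.1 x, z.2)))).
apply: (IH (R * T)%type _ _ (fun w : 'rV[R]_m * (R * T) => phi (cons_rv w.2.1 w.1, w.2.2))).
refine (continuousT_comp (g := phi) _ cphi); refine (@continuousT_pair _ _ _ _ _ _ _); last by cont.
refine (@continuousT_comp _ _ _ (fun w => (w.2.1, w.1)) (fun z => cons_rv z.1 z.2 : 'rV[R]_(1 + m)) _ (@cons_rv_continuous m)); cont.
Qed.

Lemma continuous_cons_rv m (g : 'rV[R]_(1 + m) -> R) : continuous g ->
  continuous (fun z : R * 'rV[R]_m => g (cons_rv z.1 z.2)).
Proof. by move=> cg z; apply: continuous_comp; [exact: cons_rv_continuous|exact: cg]. Qed.

Lemma continuous_cons_rvr m (g : 'rV[R]_(1 + m) -> R) t : continuous g ->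
  continuous (fun x => g (cons_rv t x)).
Proof.
move=> cg; refine (@continuousT_comp _ _ _ (fun x => (t, x)) _ _ (continuous_cons_rv cg)); cont.
Qed.

Lemma continuous_cons_rvl m (g : 'rV[R]_(1 + m) -> R) x : continuous g ->
  continuous (fun t => g (cons_rv t x)).
Proof.
move=> cg; refine (continuousT_comp (f := fun t => (t, x)) _ (continuous_cons_rv cg)); cont.
Qed.

Lemma continuous_itint_cons m (a b : 'rV[R]_m) (g : 'rV[R]_(1 + m) -> R) :
  continuous g -> continuous (fun t => itint a b (fun x => g (cons_rv t x))).
Proof.
move=> cg; apply: (@continuous_itint_param _ _ _ _ (fun z => g (cons_rv z.2 z.1))).
refine (continuousT_comp (f := fun z => (z.2, z.1)) _ (continuous_cons_rv cg)); cont.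
Qed.

Lemma eq_itint m (a b : 'rV[R]_m) f g : f =1 g -> itint a b f = itint a b g.
Proof. by move=> /funext ->. Qed.

Lemma itintD m (a b : 'rV[R]_m) f g : continuous f -> continuous g ->
  itint a b (fun x => f x + g x) = itint a b f + itint a b g.
Proof.
elim: m a b f g => // m IH a b f g cf cg; rewrite !itintS -ointD; last 2 first.
- exact: continuous_itint_cons.
- exact: continuous_itint_cons.
by apply: eq_oint => t; rewrite IH//; exact: continuous_cons_rvr.
Qed.

Lemma itintZ m (a b : 'rV[R]_m) (k : R) f : continuous f ->
  itint a b (fun x => k * f x) = k * itint a b f.
Proof.
elim: m a b f => // m IH a b f cf; rewrite !itintS -ointZ; last first.
  exact: continuous_itint_cons.
by apply: eq_oint => t; rewrite IH//; exact: continuous_cons_rvr.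
Qed.

Lemma itintN m (a b : 'rV[R]_m) f : continuous f ->
  itint a b (fun x => - f x) = - itint a b f.
Proof. by move=> cf; rewrite -mulN1r -itintZ//; apply: eq_itint => x; rewrite mulN1r. Qed.

Lemma itintB m (a b : 'rV[R]_m) f g : continuous f -> continuous g ->
  itint a b (fun x => f x - g x) = itint a b f - itint a b g.
Proof.
by move=> cf cg; rewrite itintD ?itintN//; cont.
Qed.

Lemma itint0 m (a b : 'rV[R]_m) : itint a b (fun=> 0) = 0.
Proof.
have c0 : continuous (fun _ : 'rV[R]_m => 0 : R) by cont.
by have := itintZ a b 0 c0; rewrite !mul0r.
Qed.

(** The closed box on which an oriented integral depends, whatever the order of its endpoints. *)
Definition in_box m (a b x : 'rV[R]_m) : Prop :=
  forall j, Num.min (a 0 j) (b 0 j) <= x 0 j <= Num.max (a 0 j) (b 0 j).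

Lemma cons_rv0 m (t : R) (x : 'rV[R]_m) : cons_rv t x 0 0 = t.
Proof. by rewrite /cons_rv !mxE; case: split_ordP => [k _|[]//]; rewrite ord1 mxE eqxx. Qed.

Lemma cons_rvS m (t : R) (x : 'rV[R]_m) j : cons_rv t x 0 (rshift 1 j) = x 0 j.
Proof. by rewrite /cons_rv row_mxEr. Qed.

Lemma in_box_cons m (a b : 'rV[R]_(1 + m)) t x :
  Num.min (a 0 0) (b 0 0) <= t <= Num.max (a 0 0) (b 0 0) ->
  in_box (rsubmx a) (rsubmx b) x -> in_box a b (cons_rv t x).
Proof.
move=> tab xab j; case: (split_ordP j) => k ->{j}.
  by have -> : lshift m k = 0 :> 'I_m.+1; [apply: val_inj; rewrite ord1|rewrite cons_rv0].
by rewrite cons_rvS; have := xab k; rewrite !mxE.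
Qed.

Lemma le_itint m (a b : 'rV[R]_m) g M : continuous g ->
  (forall x, in_box a b x -> `|g x| <= M) ->
  `|itint a b g| <= M * \prod_j `|b 0 j - a 0 j|.
Proof.
elim: m a b g => [|m IH] a b g cg gM; first by rewrite big_ord0 mulr1; apply: gM => -[].
rewrite itintS big_ord_recl mulrCA [leRHS]mulrC.
apply: le_oint; first exact: continuous_itint_cons.
move=> t /andP[t1 t2].
have -> : \prod_(i < m) `|b 0 (lift ord0 i) - a 0 (lift ord0 i)| =
    \prod_i `|rsubmx (b : 'rV_(1 + m)) 0 i - rsubmx (a : 'rV_(1 + m)) 0 i|.
  by apply: eq_bigr => i _; rewrite !mxE !rshift1.
apply: IH; first exact: continuous_cons_rvr.
by move=> x xab; apply: gM; apply: in_box_cons => //; rewrite !ltW.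
Qed.

(** Caratheodory's form of the derivative: when [K] is itself a continuous integral, no limit has to
    be moved through an integral sign. *)
Lemma is_derive_caratheodory (H K : R -> R) (t : R) :
  (forall s, H (t + s) - H t = s * K s) -> {for 0, continuous K} ->
  is_derive t 1 H (K 0).
Proof.
move=> HK cK.
have lim0 : h^-1 *: (H (h *: 1 + t) - H t) @[h --> 0^'] --> K 0.
  have : K h @[h --> 0^'] --> K 0 by apply: cvg_trans cK; apply: cvg_app; exact: cvg_within.
  apply: cvg_trans; apply: near_eq_cvg; near=> h.
  have h0 : h != 0 by near: h; exact: nbhs_dnbhs_neq.
  rewrite (_ : h *: 1 + t = t + h); last by rewrite [h *: 1]mulr1 addrC.
  by rewrite HK; apply/esym; exact: mulKf.
by apply: DeriveDef; [apply/cvg_ex; exists (K 0)|exact: cvg_lim].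
Unshelve. all: by end_near. Qed.

(* [phi (t + s) x - phi t x = s * Psi (x, s)] with [Psi] an integral of [phi'],
   jointly continuous; hence so is the difference quotient of the integral. *)
Lemma is_derive_itint m (a b : 'rV[R]_m) (phi phi' : R -> 'rV[R]_m -> R) :
  (forall t, continuous (phi t)) ->
  (forall x (t : R), is_derive t 1 (phi^~ x) (phi' t x)) ->
  continuous (fun z : R * 'rV[R]_m => phi' z.1 z.2) ->
  forall t : R, is_derive t 1 (fun t => itint a b (phi t)) (itint a b (phi' t)).
Proof.
move=> cphi dphi cphi' t.
pose Psi (z : 'rV[R]_m * R) := oint 0 1 (fun tau => phi' (t + z.2 * tau) z.1).
have cPsi0 : continuous (fun w : R * ('rV[R]_m * R) => phi' (t + w.2.2 * w.1) w.2.1).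
  refine (@continuousT_comp _ _ _ (fun w : R * ('rV[R]_m * R) => (t + w.2.2 * w.1, w.2.1)) (fun z => phi' z.1 z.2) _ cphi'); cont.
have cPsi : continuous Psi by exact: continuous_oint cPsi0.
have cPs (s : R) (x : 'rV[R]_m) : continuous (fun tau => phi' (t + s * tau) x).
  by have := @continuous_slice _ _ _ _ (x, s) cPsi0.
pose K s := itint a b (fun x => Psi (x, s)).
have -> : itint a b (phi' t) = K 0.
  apply: eq_itint => x; rewrite /Psi/=.
  rewrite -[LHS]mulr1 -[X in _ * X](subr0 1) -oint_cst.
  by apply: eq_oint => tau; rewrite mul0r addr0.
apply: is_derive_caratheodory; last exact: continuous_itint_param cPsi 0.
move=> s; rewrite -itintB// /K -itintZ; last exact: continuous_slice.
apply: eq_itint => x; rewrite /Psi/= -ointZ; last exact: cPs.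
have dF (tau : R) : is_derive tau 1 (fun tau => phi (t + s * tau) x) (s * phi' (t + s * tau) x).
  have dlin : is_derive tau 1 (fun tau => t + s * tau) s.
    have -> : (fun tau => t + s * tau) = cst t + s \*: id by [].
    by apply: is_derive_eq; rewrite add0r [LHS]mulr1.
  have := @is_derive1_comp _ (phi^~ x) (fun tau => t + s * tau) tau _ _ (dphi x (t + s * tau)) dlin.
  by rewrite mulrC.
rewrite (oint_FTC _ _ dF); last by cont; exact: cPs.
by rewrite mulr1 mulr0 addr0.
Qed.

(* Both sides have the same derivative with respect to [d]. *)
Lemma oint_itint m (a b : 'rV[R]_m) (c d : R) (phi : R * 'rV[R]_m -> R) :
  continuous phi ->
  oint c d (fun t => itint a b (fun x => phi (t, x))) =
  itint a b (fun x => oint c d (fun t => phi (t, x))).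
Proof.
move=> cphi.
have cl x : continuous (fun t => phi (t, x)) by exact: continuous_slice.
have csw : continuous (fun z : 'rV[R]_m * R => phi (z.2, z.1)).
  refine (continuousT_comp (f := fun z : 'rV[R]_m * R => (z.2, z.1)) (g := phi) _ cphi); cont.
have cI : continuous (fun t => itint a b (fun x => phi (t, x))).
  exact: continuous_itint_param csw.
have crx d' : continuous (fun x => oint c d' (fun t => phi (t, x))).
  exact: continuous_oint.
pose D d' := itint a b (fun x => oint c d' (fun t => phi (t, x))).
have dD : forall d' : R, is_derive d' 1 D (itint a b (fun x => phi (d', x))).
  apply: (@is_derive_itint _ _ _ (fun d' x => oint c d' (fun t => phi (t, x))) (fun d' x => phi (d', x))).
  - exact: crx.
  - move=> x d'; exact: (is_derive_oint c (cl x) d').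
  - by rewrite (_ : (fun z => _) = phi)//; apply/funext => -[].
rewrite (oint_FTC _ _ dD)// /D.
suff -> : itint a b (fun x => oint c c (fun t => phi (t, x))) = 0 by rewrite subr0.
rewrite -(itint0 a b); apply: eq_itint => x; exact: ointxx.
Qed.

Lemma itint_itint m p (a b : 'rV[R]_m) (c d : 'rV[R]_p) (phi : 'rV[R]_m * 'rV[R]_p -> R) :
  continuous phi ->
  itint a b (fun x => itint c d (fun y => phi (x, y))) =
  itint c d (fun y => itint a b (fun x => phi (x, y))).
Proof.
elim: m a b phi => // m IH a b phi cphi; rewrite itintS.
have cr (t : R) : continuous (fun z : 'rV[R]_m * 'rV[R]_p => phi (cons_rv t z.1 : 'rV[R]_m.+1, z.2)).
  refine (continuousT_comp (g := phi) _ cphi); refine (@continuousT_pair _ _ _ _ _ _ _); last by cont.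
  refine (continuousT_comp (f := fun w => (t, w.1)) _ (@cons_rv_continuous m)); cont.
under [LHS]eq_oint => t.
  rewrite (IH _ _ (fun z => phi (cons_rv t z.1, z.2)) (cr t)).
  over.
rewrite (@oint_itint _ _ _ _ _ (fun z : R * 'rV[R]_p => itint (rsubmx (a : 'rV_(1 + m))) (rsubmx (b : 'rV_(1 + m)))
   (fun x => phi (cons_rv z.1 x, z.2))))//.
apply: (@continuous_itint_param _ _ _ _ (fun w : 'rV[R]_m * (R * 'rV[R]_p) => phi (cons_rv w.2.1 w.1, w.2.2))).
refine (continuousT_comp (g := phi) _ cphi); refine (@continuousT_pair _ _ _ _ _ _ _); last by cont.
refine (@continuousT_comp _ _ _ (fun w => (w.2.1, w.1)) (fun z => cons_rv z.1 z.2 : 'rV[R]_(1 + m)) _ (@cons_rv_continuous m)); cont.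
Qed.

End ParametricIntegral.

(** * The Dirichlet kernel *)

Section SineIntegral.
Context {R : realType}.
Implicit Types (h x y z t u : R).

Lemma is_derive_lin (c d : R) x : is_derive x 1 (fun t => c + d * t) d.
Proof.
have -> : (fun t => c + d * t) = cst c + d \*: id by [].
by apply: is_derive_eq; rewrite add0r [LHS]mulr1.
Qed.

Lemma is_derive_comp_lin (c d : R) (F : R -> R) f x :
  is_derive (c + d * x) 1 F f -> is_derive x 1 (fun t => F (c + d * t)) (d * f).
Proof.
move=> dF; have := @is_derive1_comp _ F (fun t => c + d * t) x _ _ dF (is_derive_lin c d x).
by rewrite mulrC.
Qed.

Lemma oint_cos_lin x a b : x != 0 ->
  oint a b (fun t => cos (x * t)) = (sin (x * b) - sin (x * a)) / x.
Proof.
move=> x0; have dF (t : R) : is_derive t 1 (fun t => x^-1 * sin (0 + x * t)) (cos (x * t)).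
  have -> : (fun t => x^-1 * sin (0 + x * t)) = x^-1 \*: (fun t => sin (0 + x * t)) by [].
  have dsx := @is_derive_comp_lin 0 x sin _ t (is_derive_sin _).
  by apply: is_derive_eq; rewrite add0r; exact: mulKf.
rewrite (oint_FTC _ _ dF).
  by rewrite !add0r -mulrBr mulrC.
by cont.
Qed.

Lemma sincE x : x != 0 -> sinc x = sin x / x.
Proof.
move=> x0; rewrite /sinc oint_cos_lin// mulr1 mulrN1 sinN opprK.
by field.
Qed.

Lemma sinc0 : sinc 0 = 1 :> R.
Proof.
rewrite /sinc (_ : (fun t => _) = (fun=> 1)); last by apply/funext => t; rewrite mul0r cos0.
by rewrite oint_cst; field.
Qed.

Lemma sinx_sinc x : sin x = x * sinc x.
Proof.
have [->|x0] := eqVneq x 0; first by rewrite sin0 mul0r.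
by rewrite sincE// mulrC divfK.
Qed.

Lemma sincN x : sinc (- x) = sinc x.
Proof.
have [->|x0] := eqVneq x 0; first by rewrite oppr0.
by rewrite !sincE ?oppr_eq0// sinN invrN mulrNN.
Qed.

Lemma norm_cos_le1 x : `|cos x| <= 1.
Proof. by rewrite ler_norml cos_geN1 cos_le1. Qed.

Lemma norm_sin_le1 x : `|sin x| <= 1.
Proof. by rewrite ler_norml sin_geN1 sin_le1. Qed.

Lemma norm_sinc_le1 x : `|sinc x| <= 1.
Proof.
rewrite /sinc normrM ger0_norm// -ler_pdivlMl// invrK mulr1.
apply: le_trans (@le_oint _ _ _ _ 1 _ _) _.
- by cont.
- by move=> t _; exact: norm_cos_le1.
- by rewrite mul1r opprK ger0_norm.
Qed.

Lemma cos_lip x y : `|cos x - cos y| <= `|x - y|.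
Proof.
have dc (t : R) : is_derive t 1 (fun t => cos t) (- sin t) by exact: is_derive_cos.
rewrite -(oint_FTC y x dc); last by cont.
rewrite -[leRHS]mul1r; apply: le_oint; first by cont.
by move=> t _; rewrite normrN norm_sin_le1.
Qed.

Lemma sin_lip x y : `|sin x - sin y| <= `|x - y|.
Proof.
have dc (t : R) : is_derive t 1 (fun t => sin t) (cos t) by exact: is_derive_sin.
rewrite -(oint_FTC y x dc); last by cont.
rewrite -[leRHS]mul1r; apply: le_oint; first by cont.
by move=> t _; rewrite norm_cos_le1.
Qed.

Lemma sinc_lip x y : `|sinc x - sinc y| <= `|x - y|.
Proof.
rewrite /sinc -mulrBr normrM ger0_norm// -ler_pdivlMl// invrK.
have cc z : continuous (fun t => cos (z * t)) by cont.
have -> : oint (-1) 1 (fun t => cos (x * t)) - oint (-1) 1 (fun t => cos (y * t)) =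
    oint (-1) 1 (fun t => cos (x * t) + -1 * cos (y * t)).
  by rewrite ointD ?ointZ ?mulN1r//; cont.
apply: le_trans (@le_oint _ _ _ _ `|x - y| _ _) _.
- by cont; exact: cc.
- move=> t; rewrite min_l ?max_r; [|lra|lra] => t1.
  rewrite mulN1r (le_trans (cos_lip _ _))// -mulrBl normrM ler_piMr//.
  by rewrite ler_norml; lra.
- by rewrite opprK [X in _ * X]ger0_norm// mulrC.
Qed.

Lemma continuous_lip (f : R -> R) : (forall x y, `|f x - f y| <= `|x - y|) -> continuous f.
Proof.
move=> fL x A /nbhs_ballP[e /= e0 eA]; apply/nbhs_ballP; exists e => //= y xy.
by apply: eA; apply: le_lt_trans (fL _ _) xy.
Qed.

Lemma continuousT_sinc {S : topologicalType} (f : S -> R) :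
  continuous f -> continuous (fun x : S => sinc (f x)).
Proof. by move=> cf x; apply: (@continuous_comp _ _ _ f sinc); [exact: cf|exact/continuous_lip/sinc_lip]. Qed.

(** With primitives [F] and [G] of [f] and [g], both [G + F] and [G - F] have a nonnegative
    derivative inside the interval. *)
Lemma le_oint_fun (f g : R -> R) a b : a <= b -> continuous f -> continuous g ->
  (forall t, a < t < b -> `|f t| <= g t) -> `|oint a b f| <= oint a b g.
Proof.
rewrite le_eqVlt => /orP[/eqP-> _ _ _|ab cf cg fg]; first by rewrite !ointxx normr0.
have [F dF] := ex_primitive cf; have [G dG] := ex_primitive cg.
have mono (H k : R -> R) : (forall t, is_derive t 1 H (k t)) ->
    (forall t, a < t < b -> 0 <= k t) -> 0 <= H b - H a.
  move=> dH k0; have [|t] := @MVT _ H k a b ab (fun x _ => dH x).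
    exact/continuous_subspaceT/(is_derive_continuous dH).
  rewrite in_itv/= => tab ->; rewrite mulr_ge0 ?k0// subr_ge0 ltW//.
rewrite (oint_FTC _ _ dF)// (oint_FTC _ _ dG)//.
have h1 : 0 <= (G + F) b - (G + F) a.
  apply: (mono _ (fun t => g t + f t)) => t tab.
  by have := fg _ tab; rewrite ler_norml => /andP[]; lra.
have h2 : 0 <= (G - F) b - (G - F) a.
  apply: (mono _ (fun t => g t - f t)) => t tab.
  by have := fg _ tab; rewrite ler_norml => /andP[]; lra.
move: h1 h2; rewrite !fctE => h1 h2.
by rewrite ler_norml; apply/andP; split; lra.
Qed.

(** The scalar case of [oint_itint], reached through row vectors of length one. *)
Lemma oint_oint (phi : R * R -> R) a b c d : continuous phi ->
  oint a b (fun t => oint c d (fun s => phi (t, s))) =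
  oint c d (fun s => oint a b (fun t => phi (t, s))).
Proof.
move=> cphi.
have cphi' : continuous (fun z : R * 'rV[R]_1 => phi (z.1, z.2 0 0)).
  refine (@continuousT_comp _ _ _ (fun z : R * 'rV[R]_1 => (z.1, z.2 0 0)) phi _ cphi).
  by cont.
have := @oint_itint _ 1 (const_mx c) (const_mx d) a b _ cphi'.
rewrite itintS !mxE.
rewrite (_ : (fun t => itint _ _ _) = (fun t => oint c d (fun s => phi (t, s)))); last first.
  apply/funext => t; rewrite [LHS]itintS !mxE; apply: eq_oint => s /=.
  by rewrite cons_rv0.
move=> ->; apply: eq_oint => s /=; apply: eq_oint => t; by rewrite cons_rv0.
Qed.

Definition Si x : R := oint 0 x sinc.

Lemma SiN x : Si (- x) = - Si x.
Proof.
have cs : continuous (@sinc R) by exact/continuous_lip/sinc_lip.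
have dS := is_derive_oint 0 cs.
have dSN (t : R) : is_derive t 1 (fun t => - Si (0 + -1 * t)) (sinc t).
  have -> : (fun t => - Si (0 + -1 * t)) = - (fun t => Si (0 + -1 * t)) by [].
  have := @is_derive_comp_lin 0 (-1) Si _ t (dS _) => dc.
  by apply: is_derive_eq; rewrite add0r mulN1r mulN1r opprK sincN.
have := oint_FTC 0 x dSN cs; rewrite /Si -/(Si x).
by rewrite mulr0 add0r mulN1r add0r ointxx oppr0 subr0 => ->; rewrite opprK.
Qed.

Local Lemma laplace_sin_ds u N : oint 0 N (fun s => sin u * expR (- (u * s))) =
  sinc u - sinc u * expR (- (N * u)).
Proof.
have dF (s : R) : is_derive s 1 (fun s => - sinc u * expR (0 + - u * s)) (sin u * expR (- (u * s))).
  have -> : (fun s => - sinc u * expR (0 + - u * s)) = (- sinc u) \*: (fun s => expR (0 + - u * s)) by [].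
  have dc := @is_derive_comp_lin 0 (- u) expR _ s (is_derive_expR _).
  by apply: is_derive_eq; rewrite /GRing.scale/= add0r sinx_sinc [- u * s]mulNr; ring.
rewrite (oint_FTC _ _ dF); last by cont.
by rewrite mulr0 !add0r expR0 mulr1 !mulNr (mulrC u) opprK addrC.
Qed.

(** The primitive is the one behind the Laplace transform [1 / (1 + s ^ 2)] of the sine. The main
    term will integrate to [atan N]; the remainder carries the factor [exp (- T s)]. *)
Local Lemma laplace_sin_du s T : oint 0 T (fun u => sin u * expR (- (u * s))) =
  (1 + s ^+ 2)^-1 - (1 + s ^+ 2)^-1 * (expR (- (T * s)) * (cos T + s * sin T)).
Proof.
have s20 : 1 + s ^+ 2 != 0 by rewrite gt_eqF// ltr_wpDr// sqr_ge0.
have dF (u : R) : is_derive u 1 (fun u => - (1 + s ^+ 2)^-1 * (expR (0 + - s * u) * (cos u + s * sin u)))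
    (sin u * expR (- (u * s))).
  have -> : (fun u => - (1 + s ^+ 2)^-1 * (expR (0 + - s * u) * (cos u + s * sin u))) =
    (- (1 + s ^+ 2)^-1) \*: ((fun u => expR (0 + - s * u)) * (cos + s \*: sin)) by [].
  have dc := @is_derive_comp_lin 0 (- s) expR _ u (is_derive_expR _).
  apply: is_derive_eq; rewrite add0r mulNr (mulrC s u) !fctE.
  rewrite /GRing.scale/= (_ : s *: sin u = s * sin u)//; field; exact: s20.
rewrite (oint_FTC _ _ dF); last first.
  by cont.
by rewrite mulr0 !add0r expR0 cos0 sin0 mulr0 addr0 !mulr1 !mulNr (mulrC s T) opprK addrC.
Qed.

Local Lemma expR_oint_le u N : 0 < u -> 0 <= N ->
  oint 0 N (fun s => expR (- (u * s))) <= u^-1.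
Proof.
move=> u0 N0.
have dF (s : R) : is_derive s 1 (fun s => - u^-1 * expR (0 + - u * s)) (expR (- (u * s))).
  have -> : (fun s => - u^-1 * expR (0 + - u * s)) = (- u^-1) \*: (fun s => expR (0 + - u * s)) by [].
  have dc := @is_derive_comp_lin 0 (- u) expR _ s (is_derive_expR _).
  by apply: is_derive_eq; rewrite /GRing.scale/= add0r [- u * s]mulNr; field; rewrite gt_eqF.
rewrite (oint_FTC _ _ dF); last by cont.
rewrite mulr0 !add0r expR0 mulr1 opprK mulNr gerDr oppr_le0.
by rewrite mulr_ge0 ?expR_ge0// invr_ge0 ltW.
Qed.

(* Fubini for [sin u * exp (- u s)] on [[0, T] * [0, N]]. *)
Lemma Si_sub_atan T N : 0 < T -> 0 < N -> `|Si T - atan N| <= T^-1 + N^-1.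
Proof.
move=> T0 N0.
have cphi : continuous (fun z : R * R => sin z.1 * expR (- (z.1 * z.2))).
  by cont.
have := oint_oint 0 T 0 N cphi => /=.
under eq_oint do rewrite laplace_sin_ds.
under [in RHS]eq_oint do rewrite laplace_sin_du.
have cs : continuous (@sinc R) by exact/continuous_lip/sinc_lip.
have s20 (s : R) : 1 + s ^+ 2 != 0 by rewrite gt_eqF// ltr_wpDr// sqr_ge0.
have cV : continuous (fun s : R => (1 + s ^+ 2)^-1).
  move=> s; apply: cvgV => //; apply: cvgD; first exact: cvg_cst.
  by apply: cvgM; exact: cvg_id.
have c1 : continuous (fun u => sinc u * expR (- (N * u))).
  by cont.
have c2 : continuous (fun s : R => (1 + s ^+ 2)^-1 * (expR (- (T * s)) * (cos T + s * sin T))).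
  by cont.
rewrite (_ : (fun x => sinc x - _) = (fun x => sinc x + - 1 * (sinc x * expR (- (N * x))))); last first.
  by apply/funext => x; rewrite mulN1r.
rewrite (_ : (fun x => _ - _) = (fun s => (1 + s ^+ 2)^-1 + -1 * ((1 + s ^+ 2)^-1 * (expR (- (T * s)) * (cos T + s * sin T))))); last first.
  by apply/funext => x; rewrite mulN1r.
rewrite ointD ?(ointZ (-1))//; last by cont.
rewrite ointD ?(ointZ (-1))//; last by cont.
rewrite (oint_FTC _ _ (@is_derive1_atan R))// atan0 subr0 !mulN1r -/(Si T) => E.
(* Fubini's equality with the two main terms on one side; each remainder is then compared with the
   integral of an exponential. *)
rewrite (_ : Si T - atan N = oint 0 T (fun u => sinc u * expR (- (N * u))) -
  oint 0 N (fun s => (1 + s ^+ 2)^-1 * (expR (- (T * s)) * (cos T + s * sin T)))); last first.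
  by lra.
rewrite addrC (le_trans (ler_normD _ _))// normrN lerD//.
  apply: le_trans (expR_oint_le T0 (ltW N0)).
  apply: le_oint_fun; [exact: ltW|exact: c2|by cont|].
  move=> s _; rewrite !normrM mulrCA (ger0_norm (expR_ge0 _)) ler_piMr ?expR_ge0//.
  have s2 : 0 < 1 + s ^+ 2 by rewrite ltr_wpDr// sqr_ge0.
  rewrite normfV (gtr0_norm s2) mulrC ler_pdivrMr// mul1r.
  rewrite -(@ler_pXn2r _ 2)// ?nnegrE ?(ltW s2)// real_normK ?num_real//.
  (* With [c ^ 2 + d ^ 2 = 1] one has [(c + s d) ^ 2 + (s c - d) ^ 2 = 1 + s ^ 2], and [1 + s ^ 2]
     is at most its own square. *)
  have := cos2Dsin2 T; have := sqr_ge0 (s * cos T - sin T); have := sqr_ge0 s.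
  set c := cos T; set d := sin T; nra.
apply: le_trans (expR_oint_le N0 (ltW T0)).
apply: le_oint_fun; [exact: ltW|exact: c1|by cont|].
by move=> s _; rewrite normrM (ger0_norm (expR_ge0 _)) ler_piMl ?expR_ge0// norm_sinc_le1.
Qed.

(** Letting [N] tend to infinity in [Si_sub_atan] leaves only [1 / T]: the Dirichlet integral comes
    with its rate. *)
Lemma Si_bound T : 0 < T -> `|Si T - pi / 2| <= T^-1.
Proof.
move=> T0; apply/ler_addgt0Pr => e e0.
have := @cvgy_atan R => /cvgrPdist_le /(_ (e / 2)); rewrite divr_gt0// => /(_ isT) atan_e.
have inv_e : \forall N \near +oo, (N : R)^-1 <= e / 2.
  near=> N; have N0 : 0 < N by near: N; exact: nbhs_pinfty_gt.
  by rewrite -(invrK (e / 2)) lef_pV2 ?posrE ?invr_gt0 ?divr_gt0//; near: N; exact: nbhs_pinfty_ge.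
have [N [N0 aN iN]] : exists N : R, [/\ 0 < N, `|pi / 2 - atan N| <= e / 2 & N^-1 <= e / 2].
  near (pinfty_nbhs R) => N; exists N; split; near: N => //.
  by apply: nbhs_pinfty_gt; exact: num_real.
have := Si_sub_atan T0 N0.
rewrite (_ : Si T - pi / 2 = (Si T - atan N) + - (pi / 2 - atan N)); last by ring.
move=> h; apply: le_trans (ler_normD _ _) _; rewrite normrN.
by move: h aN iN; lra.
Unshelve. all: by end_near. Qed.

(** Near [0] the bound [1 / T] is useless. There [|Si T| <= T <= 1], and [1 + pi / 2 <= pi] because
    [pi >= 2]. *)
Lemma Si_bound_le T : 0 <= T -> `|Si T - pi / 2| <= pi.
Proof.
move=> T0; have := @pi_ge2 R => pi2.
have [T1|T1] := lerP 1 T.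
  apply: le_trans (Si_bound (lt_le_trans ltr01 T1)) _.
  by apply: (@le_trans _ _ 1); [rewrite invf_le1// (lt_le_trans ltr01 T1)|lra].
have : `|Si T| <= 1 * `|T - 0|.
  by apply: le_oint => [|t _]; [exact/continuous_lip/sinc_lip|exact: norm_sinc_le1].
rewrite mul1r subr0 (ger0_norm T0) !ler_norml => /andP[? ?]; apply/andP; split; lra.
Qed.

End SineIntegral.

(** * The kernel in one variable *)

Section DirichletKernel.
Context {R : realType}.
Implicit Types (h y t u tau s c : R) (G : R -> R).

Definition kern h t : R := h / pi * sinc (h * t).

(** For [h > 0], the odd primitive of [kern h], which tends to [1 / 2] at infinity. *)
Definition kernI h t : R := pi^-1 * Si (h * t).

Lemma continuousT_kern {S : topologicalType} h (f : S -> R) :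
  continuous f -> continuous (fun x : S => kern h (f x)).
Proof.
move=> cf; refine (@continuousT_mul _ _ (fun=> _) (fun x => sinc (h * f x)) _ _); first by cont.
by apply: (@continuousT_sinc _ _ (fun x => h * f x)); cont.
Qed.

Lemma continuousT_kernI {S : topologicalType} h (f : S -> R) :
  continuous f -> continuous (fun x : S => kernI h (f x)).
Proof.
move=> cf; have cSi : continuous (@Si R).
  by apply: (is_derive_continuous (is_derive_oint 0 _)); exact/continuous_lip/sinc_lip.
refine (@continuousT_mul _ _ (fun=> _) (fun x => Si (h * f x)) _ _); first by cont.
by refine (@continuousT_comp _ _ _ (fun x => h * f x) _ _ cSi); cont.
Qed.

Lemma kernN h t : kern h (- t) = kern h t.
Proof. by rewrite /kern mulrN sincN. Qed.

Lemma kernIN h t : kernI h (- t) = - kernI h t.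
Proof. by rewrite /kernI mulrN SiN mulrN. Qed.

Lemma is_derive_kernI h y t :
  is_derive t 1 (fun t => kernI h (t - y)) (kern h (y - t)).
Proof.
have dS : is_derive (- (h * y) + h * t) 1 Si (sinc (- (h * y) + h * t)).
  by apply: is_derive_oint; exact/continuous_lip/sinc_lip.
have dc := is_derive_comp_lin dS.
have -> : (fun t => kernI h (t - y)) = pi^-1 \*: (fun t => Si (- (h * y) + h * t)).
  by apply/funext => u; rewrite /kernI mulrBr addrC.
apply: is_derive_eq; rewrite /GRing.scale/= /kern mulrBr -[in RHS]sincN opprB.
by rewrite (addrC (h * t)); ring.
Qed.

Lemma kernI_half h u : 0 < h -> 0 <= u -> `|kernI h u - 2^-1| <= 1.
Proof.
move=> h0 u0; have p0 := @pi_gt0 R.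
rewrite (_ : _ - _ = pi^-1 * (Si (h * u) - pi / 2)); last first.
  by rewrite /kernI mulrBr [pi^-1 * (pi / 2)]mulrA mulVf ?mul1r// gt_eqF.
rewrite normrM normfV (gtr0_norm p0) ler_pdivrMl// mulr1.
by apply: Si_bound_le; rewrite mulr_ge0// ltW.
Qed.

Lemma kernI_half_tail h tau u : 0 < h -> 0 < tau -> tau <= u ->
  `|kernI h u - 2^-1| <= (h * tau)^-1.
Proof.
move=> h0 t0 tu; have p0 := @pi_gt0 R.
have u0 := lt_le_trans t0 tu.
rewrite (_ : _ - _ = pi^-1 * (Si (h * u) - pi / 2)); last first.
  by rewrite /kernI mulrBr [pi^-1 * (pi / 2)]mulrA mulVf ?mul1r// gt_eqF.
rewrite normrM normfV (gtr0_norm p0) ler_pdivrMl//.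
apply: le_trans (Si_bound (mulr_gt0 h0 u0)) _.
apply: (@le_trans _ _ ((h * tau)^-1)).
  by rewrite lef_pV2 ?posrE ?mulr_gt0// ler_pM2l.
rewrite ler_peMl ?invr_ge0 ?mulr_ge0 ?(ltW h0) ?(ltW t0)//.
by have := @pi_ge2 R; lra.
Qed.

Lemma strictly_between (a b t : R) : Num.min a b < t < Num.max a b ->
  a < t < b \/ b < t < a.
Proof. by case: (leP a b) => _; [left|right]. Qed.

(* [sg] tells on which side of [y] the endpoint [c] lies. *)
Lemma kern_half (sg : bool) h tau s y c M G G' :
  let eps := (-1) ^+ sg in
  0 < h -> 0 < tau -> tau <= s -> s <= eps * (c - y) ->
  continuous G' -> (forall t, is_derive t 1 G (G' t)) ->
  `|G c| <= M -> (forall t, y < t < c \/ c < t < y -> `|G' t| <= M) ->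
  `|oint y c (fun t => kern h (y - t) * G t) - eps / 2 * G y| <=
  M * ((h * s)^-1 + tau + eps * (c - y) / (h * tau)).
Proof.
move=> eps h0 t0 ts scy cG' dG GM G'M.
have cG := is_derive_continuous dG.
have M0 : 0 <= M := le_trans (normr_ge0 _) GM.
have e2 : eps * eps = 1 by rewrite /eps; case: (sg) => /=; rewrite ?expr1 ?expr0; lra.
have en : `|eps| = 1 by rewrite /eps normr_sign.
(* The primitive of the kernel used in the integration by parts is shifted so that it is small far
   away on the side of [c]. Its value at [y] is then [- eps / 2], which produces the main term. *)
pose E t := kernI h (t - y) - eps / 2.
have EN t : `|E t| = `|kernI h (eps * (t - y)) - 2^-1|.
  have -> : `|E t| = `|eps * E t| by rewrite normrM en mul1r.
  congr (`|_|); rewrite /E mulrBr [eps * (eps / 2)]mulrA e2 mul1r; congr (_ - _).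
  by rewrite /eps; case: (sg); rewrite ?expr1 ?expr0 ?mul1r// !mulN1r kernIN.
have E1 u : 0 <= eps * (u - y) -> `|E u| <= 1.
  by rewrite EN => ?; apply: kernI_half.
have E2 u v : 0 < u -> u <= eps * (v - y) -> `|E v| <= (h * u)^-1.
  by rewrite EN => ? ?; apply: kernI_half_tail.
have cE : continuous E by rewrite /E; cont; apply: continuousT_kernI; cont.
have cEG' : continuous (fun t => E t * G' t) by cont.
have ck : continuous (fun t => kern h (y - t) * G t).
  by cont; apply: continuousT_kern; cont.
have dEG t : is_derive t 1 (E * G) (kern h (y - t) * G t + E t * G' t).
  have dE : is_derive t 1 E (kern h (y - t)).
    have dk := is_derive_kernI h y t.
    have -> : E = (fun t => kernI h (t - y)) - cst (eps / 2) by [].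
    by apply: is_derive_eq; rewrite subr0.
  by apply: is_derive_eq; rewrite /GRing.scale/= addrC [G t * _]mulrC.
have := oint_FTC y c dEG (continuousT_add ck cEG'); rewrite ointD// !fctE.
rewrite [E y]/E subrr /kernI mulr0 /Si ointxx mulr0 sub0r => H.
(* The integral of [E * G'] is cut at distance [tau] from [y]. On the near piece [|E| <= 1] and the
   length is [tau]; on the far piece [|E| <= 1 / (h tau)]. The boundary term at [c], at distance at
   least [s], gives [1 / (h s)]. *)
pose m := y + eps * tau.
have := oint_cat y m c cEG'.
set I1 := oint y m _; set I2 := oint m c _ => H2.
have sc : 0 <= eps * (c - y) by lra.
have hI1 : `|I1| <= M * tau.
  have -> : tau = `|m - y| by rewrite /m addrAC subrr add0r normrM en mul1r gtr0_norm.
  apply: le_oint => // t /strictly_between tym.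
  rewrite normrM -[leRHS]mul1r ler_pM//.
    by apply: E1; move: tym e2; rewrite /m /eps; case: (sg); rewrite ?expr1 ?expr0 => -[] ?; lra.
  apply: G'M; move: tym scy; rewrite /m /eps; case: (sg); rewrite ?expr1 ?expr0 => -[] ?;
    by [left; lra|right; lra|move=> ?; exfalso; lra|move=> ?; left; lra|move=> ?; right; lra].
have ht0 : 0 < h * tau by rewrite mulr_gt0.
have hI2 : `|I2| <= M * (eps * (c - y) / (h * tau)).
  apply: (@le_trans _ _ (M / (h * tau) * `|c - m|)).
    apply: le_oint => // t /strictly_between tmc.
    rewrite normrM mulrC ler_pM//.
      apply: G'M; move: tmc scy; rewrite /m /eps; case: (sg); rewrite ?expr1 ?expr0 => -[] ?;
        by [move=> ?; exfalso; lra|move=> ?; left; lra|move=> ?; right; lra].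
    by apply: E2 => //; move: tmc scy; rewrite /m /eps; case: (sg); rewrite ?expr1 ?expr0 => -[] ? ?; lra.
  rewrite -mulrA ler_wpM2l// mulrC ler_wpM2r ?invr_ge0 ?(ltW ht0)//.
  rewrite -[leLHS]mul1r -en -normrM ger0_norm.
    by rewrite /m opprD addrA [leLHS]mulrBr mulrA e2 mul1r; lra.
  by rewrite /m opprD addrA [leRHS]mulrBr mulrA e2 mul1r; lra.
have hE : `|E c * G c| <= M * (h * s)^-1.
  by rewrite normrM mulrC ler_pM// E2//; lra.
rewrite (_ : _ - _ = E c * G c - (I1 + I2)); last by rewrite H2; move: H; lra.
rewrite !mulrDr; apply: le_trans (ler_normB _ _) _.
by have := ler_normD I1 I2; move: hI1 hI2 hE; lra.
Qed.

(** Each side of [y] contributes half of [G y]. The derivative is bounded on the open interval only,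
    since in the application the bound comes from [is_derive_norm_le] at points with a whole
    neighbourhood in the interval. *)
Lemma kern_estimate h tau s a b y M G G' :
  0 < h -> 0 < tau -> tau <= s -> a + s <= y -> y + s <= b ->
  continuous G' -> (forall t, is_derive t 1 G (G' t)) ->
  (forall t, a <= t <= b -> `|G t| <= M) ->
  (forall t, a < t < b -> `|G' t| <= M) ->
  `|oint a b (fun t => kern h (y - t) * G t) - G y| <=
  M * (2 / (h * s) + 2 * tau + (b - a) / (h * tau)).
Proof.
move=> h0 t0 ts ay yb cG' dG GM G'M.
have cG := is_derive_continuous dG.
have ck : continuous (fun t => kern h (y - t) * G t).
  by cont; apply: continuousT_kern; cont.
have := @kern_half false h tau s y b M G G' h0 t0 ts.
rewrite expr0 !mul1r => /(_ ltac:(lra) cG' dG) h1.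
have := @kern_half true h tau s y a M G G' h0 t0 ts.
rewrite expr1 => /(_ ltac:(lra) cG' dG) h2.
have {}h1 := h1 (GM b ltac:(lra)) (fun t tyb => G'M t ltac:(case: tyb; lra)).
have {}h2 := h2 (GM a ltac:(lra)) (fun t tyb => G'M t ltac:(case: tyb; lra)).
rewrite -(oint_cat a y b ck) (oint_rev y a ck).
move: h1 h2; set Ib := oint y b _; set Ia := oint y a _ => h1 h2.
rewrite (_ : - Ia + Ib - G y = (Ib - 2^-1 * G y) - (Ia - -1 / 2 * G y)); last by lra.
apply: le_trans (ler_normB _ _) _; apply: le_trans (lerD h1 h2) _.
rewrite -mulrDr le_eqVlt; apply/orP; left; apply/eqP; congr (_ * _).
have s0 : 0 < s by exact: lt_le_trans t0 ts.
by field; rewrite !gt_eqF.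
Qed.

End DirichletKernel.

(** * Smooth functions of several variables and their slices *)

Section Smooth.
Context {R : realType}.

(** A directional derivative sees only the restriction to a line, so it can be carried between
    functions on different spaces: from a vector to its first coordinate, or to its tail. *)
Lemma derive_transfer {V W : normedModType R} (g : V -> R) (f : W -> R) a w b v :
  (forall h : R, g (h *: w + a) = f (h *: v + b)) ->
  'D_w g a = 'D_v f b /\ (derivable g a w <-> derivable f b v).
Proof.
move=> gf; have gfab : g a = f b by have := gf 0; rewrite !scale0r !add0r.
have E : (fun h : R => h^-1 *: ((g \o shift a) (h *: w) - g a)) =
    (fun h => h^-1 *: ((f \o shift b) (h *: v) - f b)).
  by apply/funext => h; rewrite /= gf gfab.
by rewrite /derive /derivable E.
Qed.

(** Coinduction: a class of continuous functions stable under partial derivatives consists of smooth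
    functions. Closure properties then need no formula for iterated derivatives. *)
Lemma smooth_coind n (P : ('rV[R]_n -> R) -> Prop) :
  (forall g, P g -> continuous g /\
    forall j, (forall x, derivable g x (delta_mx 0 j)) /\ P (partial j g)) ->
  forall g, P g -> smooth g.
Proof.
move=> HP g Pg s; suff /HP[cg dg] : P (partials s g).
  by split=> // j x; have [] := dg j.
elim: s => //= j s IH; have [_ /(_ j)[]] := HP _ IH; exact.
Qed.

Lemma smooth_continuous n (g : 'rV[R]_n -> R) : smooth g -> continuous g.
Proof. by move=> /(_ [::])[]. Qed.

Lemma smooth_derivable n (g : 'rV[R]_n -> R) j x : smooth g -> derivable g x (delta_mx 0 j).
Proof. by move=> /(_ [::])[_]; apply. Qed.

Lemma smooth_partials n (g : 'rV[R]_n -> R) s : smooth g -> smooth (partials s g).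
Proof. by move=> sg s'; have := sg (s' ++ s); rewrite /partials foldr_cat. Qed.

Lemma smooth_partial n (g : 'rV[R]_n -> R) j : smooth g -> smooth (partial j g).
Proof. exact: (@smooth_partials n g [:: j]). Qed.

Lemma smoothB n (f g : 'rV[R]_n -> R) : smooth f -> smooth g ->
  smooth (fun x => f x - g x).
Proof.
move=> sf sg; apply: (@smooth_coind _ (fun k => exists f g, [/\ smooth f, smooth g &
  k = (fun x => f x - g x)])); last by exists f, g.
move=> _ [{sf sg}f [{}g [sf sg ->]]]; split.
  by have := smooth_continuous sf; have := smooth_continuous sg => ? ?; cont.
move=> j; split.
  by move=> x; apply: (@derivableB _ _ _ f g); exact: smooth_derivable.
exists (partial j f), (partial j g); split; [exact: smooth_partial..|].
by apply/funext => x; apply: (@deriveB _ _ _ f g); exact: smooth_derivable.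
Qed.

Lemma partialsB n (f g : 'rV[R]_n -> R) s : smooth f -> smooth g ->
  partials s (fun x => f x - g x) = (fun x => partials s f x - partials s g x).
Proof.
move=> sf sg; elim: s => //= j s ->; apply/funext => x.
by apply: (@deriveB _ _ _ (partials s f) (partials s g)); apply: smooth_derivable; exact: smooth_partials.
Qed.

Lemma cons_rvl m t (x : 'rV[R]_m) k : cons_rv t x 0 (lshift m k) = t.
Proof. by rewrite /cons_rv row_mxEl mxE !ord1 eqxx. Qed.

Lemma cons_rv_shiftr m (t h : R) (x : 'rV[R]_m) j :
  cons_rv t (h *: delta_mx 0 j + x) = h *: delta_mx 0 (rshift 1 j) + cons_rv t x.
Proof.
apply/rowP => i; case: (split_ordP i) => k ->{i}.
  by rewrite [RHS]mxE !cons_rvl [X in X + _]mxE [X in _ * X]mxE eq_lrshift andbF mulr0 add0r.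
by rewrite [RHS]mxE !cons_rvS [LHS]mxE; congr (_ + _); rewrite !mxE eq_rshift.
Qed.

Lemma cons_rv_shiftl m (t h : R) (x : 'rV[R]_m) :
  cons_rv (h *: (1 : R^o) + t) x = h *: delta_mx 0 0 + cons_rv t x :> 'rV[R]_(1 + m).
Proof.
apply/rowP => i; case: (split_ordP i) => k ->{i}.
  rewrite [RHS]mxE !cons_rvl [X in _ = X + _]mxE [X in _ = _ * X + _]mxE.
  by rewrite (_ : lshift m k = 0 :> 'I_m.+1) ?eqxx//; apply: val_inj; rewrite ord1.
by rewrite [RHS]mxE !cons_rvS [X in _ = X + _]mxE [X in _ = _ * X + _]mxE /= mulr0 add0r.
Qed.

Lemma partials_cons m (f : 'rV[R]_(1 + m) -> R) t s :
  partials s (fun x => f (cons_rv t x)) =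
  (fun x => partials (map (@rshift 1 m) s) f (cons_rv t x)).
Proof.
elim: s => //= j s ->; apply/funext => x.
by apply: (derive_transfer _).1 => h; rewrite cons_rv_shiftr.
Qed.

Lemma smooth_cons m (f : 'rV[R]_(1 + m) -> R) t : smooth f ->
  smooth (fun x => f (cons_rv t x)).
Proof.
move=> sf s; rewrite partials_cons; split.
  exact/continuous_cons_rvr/smooth_continuous/smooth_partials.
move=> j x; set F := partials _ f.
have E (h : R) : F (cons_rv t (h *: delta_mx 0 j + x)) =
    F (h *: delta_mx 0 (rshift 1 j) + cons_rv t x) by rewrite cons_rv_shiftr.
apply: (derive_transfer (g := fun x => F (cons_rv t x)) E).2.2.
by apply: smooth_derivable; exact: smooth_partials.
Qed.

Lemma is_derive_cons_rv m (f : 'rV[R]_(1 + m) -> R) (x : 'rV[R]_m) (t : R) : smooth f ->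
  is_derive t 1 (fun t => f (cons_rv t x)) (partial 0 f (cons_rv t x)).
Proof.
move=> sf.
have E (h : R) : f (cons_rv (h *: (1 : R^o) + t) x) = f (h *: delta_mx 0 0 + cons_rv t x).
  by rewrite cons_rv_shiftl.
have [D1 D2] := @derive_transfer R^o _ (fun t => f (cons_rv t x)) f t 1 _ _ E.
by apply: DeriveDef; [apply/D2; exact: smooth_derivable|exact: D1].
Qed.

(** Recovers a bound on the derivative from local increments: a derivative larger than [L] would
    show in a difference quotient close to [t]. *)
Lemma is_derive_norm_le (H : R -> R) (H' L t : R) : is_derive t 1 H H' ->
  (\forall t' \near t, `|H t' - H t| <= L * `|t' - t|) -> `|H'| <= L.
Proof.
move=> [dH <-] HL; rewrite leNgt; apply/negP => LH'.
have /cvgrPdist_lt := dH; rewrite -/('D_1 H t) => /(_ (`|'D_1 H t| - L)).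
rewrite subr_gt0 => /(_ LH') near1.
have near2 : \forall h \near (0 : R)^', `|H (h + t) - H t| <= L * `|h|.
  have h2 : \forall h \near (0 : R), `|H (h + t) - H t| <= L * `|h|.
    have ca : continuous (fun h : R => h + t) by cont.
    have := ca 0; rewrite /continuous_at add0r => /(_ _ HL) HL'.
    by apply: (@filterS _ (nbhs (0 : R)) _ _ _ _ HL') => h; rewrite /= addrK.
  exact: nbhs_dnbhs h2.
have near3 : \forall h \near (0 : R)^', h != 0 by exact: nbhs_dnbhs_neq.
have [h [[h1 h2] h3]] := filter_ex (filterI (filterI near1 near2) near3).
move: h1; rewrite [h *: 1]mulr1 => h1.
have : `|h^-1 *: (H (h + t) - H t)| <= L.
  by rewrite normrZ normfV ler_pdivrMl ?normr_gt0// mulrC.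
have := ler_normD ('D_1 H t - h^-1 *: (H (h + t) - H t)) (h^-1 *: (H (h + t) - H t)).
by rewrite subrK; move: h1 => /=; lra.
Qed.

End Smooth.

(** * The kernel in several variables *)

Section DirichletKernelN.
Context {R : realType}.

Definition kernn n (h : R) (z : 'rV[R]_n) : R := \prod_j kern h (z 0 j).

Lemma kernn_cons m h (y : 'rV[R]_(1 + m)) t x :
  kernn h (y - cons_rv t x) = kern h (y 0 0 - t) * kernn h (rsubmx y - x).
Proof.
rewrite /kernn big_ord_recl; congr (kern h _ * _).
  by have := cons_rv0 t x; rewrite !mxE => ->.
apply: eq_bigr => i _; congr (kern h _).
by have := cons_rvS t x i; rewrite !mxE -rshift1 => ->.
Qed.

Lemma continuous_kernn n h (y : 'rV[R]_n) : continuous (fun x : 'rV[R]_n => kernn h (y - x)).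
Proof.
refine (@continuousT_prod _ _ _ (fun j (x : 'rV[R]_n) => kern h ((y - x) 0 j)) _) => j.
apply: continuousT_kern.
rewrite (_ : (fun x : 'rV[R]_n => (y - x) 0 j) = (fun x => y 0 j - x 0 j)); first by cont.
by apply/funext => x; rewrite !mxE.
Qed.

(* Without symmetry of second derivatives, only the partial derivatives taken in
   the order of the variables are available; the derivative of the partial
   integral [G] is therefore bounded through a Lipschitz constant of [G]. *)
Lemma kernn_estimate n h tau s l (a b y : 'rV[R]_n) f M :
  0 < h -> 0 < tau -> tau <= s ->
  (forall j, a 0 j + s <= y 0 j /\ y 0 j + s <= b 0 j) ->
  (forall j, b 0 j - a 0 j <= l) -> 0 <= l -> smooth f ->
  (forall p, subseq p (enum 'I_n) -> forall x, in_box a b x -> `|partials p f x| <= M) ->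
  let c := 2 / (h * s) + 2 * tau + l / (h * tau) in
  let I := itint a b (fun x => kernn h (y - x) * f x) in
  `|I| <= M * (1 + c) ^+ n /\ `|I - f y| <= M * ((1 + c) ^+ n - 1).
Proof.
move=> h0 t0 ts yab abl l0 sf fM /=; set c := _ + _ + _.
have s0 : 0 < s by exact: lt_le_trans t0 ts.
have c0 : 0 <= c.
  have hs0 := mulr_gt0 h0 s0; have ht0 := mulr_gt0 h0 t0.
  by rewrite /c addr_ge0 ?addr_ge0 ?divr_ge0 ?mulr_ge0// ltW.
(* The two bounds travel together. The first one controls the partial integral [G] and its
   increments; the second one gives the error of [G (y 0 0)] against [f y]. Adding the error
   [M (1 + c) ^ m c] of the first variable to [M ((1 + c) ^ m - 1)] telescopes to the claim. *)
elim: n a b y f M yab abl sf fM => [|m IH] a b y f M yab abl sf fM.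
  have -> : itint a b (fun x => kernn h (y - x) * f x) = f y.
    by rewrite /= /kernn big_ord0 mul1r; congr f; apply/rowP => -[].
  have fy : `|f y| <= M by apply: (fM [::] (sub0seq _)) => -[].
  by rewrite subrr normr0 expr0 subrr mulr0 mulr1.
have y_box : in_box a b y.
  move=> j; have [? ?] := yab j.
  by rewrite min_l ?max_r; [apply/andP; split; lra|lra|lra].
have fy : `|f y| <= M by exact: (fM [::] (sub0seq _)).
have M0 : 0 <= M by exact: le_trans fy.
have cf := smooth_continuous sf.
pose y' := rsubmx (y : 'rV[R]_(1 + m)); pose a' := rsubmx (a : 'rV[R]_(1 + m)).
pose b' := rsubmx (b : 'rV[R]_(1 + m)).
pose G t := itint a' b' (fun x => kernn h (y' - x) * f (cons_rv t x)).
pose G' t := itint a' b' (fun x => kernn h (y' - x) * partial 0 f (cons_rv t x)).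
have yab' j : a' 0 j + s <= y' 0 j /\ y' 0 j + s <= b' 0 j by rewrite !mxE; exact: yab.
have abl' j : b' 0 j - a' 0 j <= l by rewrite !mxE; exact: abl.
have ck := @continuous_kernn m h y'.
have cpf : continuous (partial 0 f) by exact/smooth_continuous/smooth_partial.
have [ya0 yb0] := yab 0.
have ab0 : a 0 0 <= b 0 0 by lra.
(* Variable [0] heads the word, so it is differentiated last; this is what keeps the longer word a
   subsequence of the enumeration. *)
have sub_shift p : subseq p (enum 'I_m) ->
    subseq (0 :: map (@rshift 1 m) p) (enum 'I_m.+1).
  move=> pm; rewrite enum_ordSl (eq_map (@rshift1 m)) /= ?eqxx.
  exact: map_subseq.
have boundp p x t : subseq p (enum 'I_m) -> in_box a' b' x -> a 0 0 <= t <= b 0 0 ->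
   `|partials (map (@rshift 1 m) p) f (cons_rv t x)| <= M /\
   `|partial 0 (partials (map (@rshift 1 m) p) f) (cons_rv t x)| <= M.
  move=> pm xab tab.
  have box : in_box a b (cons_rv t x : 'rV[R]_m.+1).
    by apply: (@in_box_cons _ _ a b) => //; rewrite min_l// max_r.
  split; last by apply: (fM (0 :: map _ p)) => //; exact: sub_shift.
  by apply: fM => //; apply: subseq_trans (sub_shift p pm); exact: subseq_cons.
have slice t : a 0 0 <= t <= b 0 0 ->
    `|G t| <= M * (1 + c) ^+ m /\ `|G t - f (cons_rv t y')| <= M * ((1 + c) ^+ m - 1).
  move=> tab; apply: (IH a' b' y' (fun x => f (cons_rv t x)) M) => //.
    exact: smooth_cons.
  by move=> p pm x xab; rewrite partials_cons; have [] := boundp p x t pm xab tab.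
have lipG t t' : a 0 0 <= t <= b 0 0 -> a 0 0 <= t' <= b 0 0 ->
    `|G t - G t'| <= M * (1 + c) ^+ m * `|t - t'|.
  move=> tab tab'.
  have -> : G t - G t' = itint a' b' (fun x => kernn h (y' - x) * (f (cons_rv t x) - f (cons_rv t' x))).
    rewrite /G -itintB; last 2 first.
    - by have := continuous_cons_rvr (t := t) cf => ?; cont.
    - by have := continuous_cons_rvr (t := t') cf => ?; cont.
    by apply: eq_itint => x; rewrite mulrBr.
  have sft u := smooth_cons u sf.
  have sB : smooth (fun x => f (cons_rv t x) - f (cons_rv t' x)) by exact: smoothB.
  (* The induction hypothesis is applied to a difference of two slices. Its derivatives are
     integrals over [[t', t]] of derivatives of [f] along variable [0], hence at most
     [M |t - t'|]. *)
  have bnd p : subseq p (enum 'I_m) -> forall x, in_box a' b' x ->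
      `|partials p (fun x => f (cons_rv t x) - f (cons_rv t' x)) x| <= M * `|t - t'|.
    move=> pm x xab; rewrite partialsB// !partials_cons.
    set g := partials _ f; have sg : smooth g by exact: smooth_partials.
    rewrite -(oint_FTC t' t (fun u => is_derive_cons_rv x u sg)); last first.
      exact/continuous_cons_rvl/smooth_continuous/smooth_partial.
    apply: le_oint; first exact/continuous_cons_rvl/smooth_continuous/smooth_partial.
    move=> u tu; apply: (boundp p x u pm xab _).2.
    by move: tu => /strictly_between[] /andP[? ?]; apply/andP; split; lra.
  have [+ _] := IH a' b' y' _ _ yab' abl' sB bnd.
  by rewrite mulrAC.
have dG : forall t : R, is_derive t 1 G (G' t).
  apply: (@is_derive_itint _ _ _ _ (fun t x => kernn h (y' - x) * f (cons_rv t x)) (fun t x => kernn h (y' - x) * partial 0 f (cons_rv t x))).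
  - by move=> t; have := continuous_cons_rvr (t := t) cf => ?; cont.
  - move=> x t; have df := is_derive_cons_rv x t sf.
    have -> : (fun t => kernn h (y' - x) * f (cons_rv t x)) =
      kernn h (y' - x) \*: (fun t => f (cons_rv t x)) by [].
    exact: is_deriveZ.
  - refine (@continuousT_mul _ _ (fun z : R * 'rV[R]_m => kernn h (y' - z.2)) (fun z => partial 0 f (cons_rv z.1 z.2)) _ _).
      by refine (@continuousT_comp _ _ _ snd _ _ ck); cont.
    exact: continuous_cons_rv.
have cG' : continuous G'.
  apply: (@continuous_itint_param _ _ _ _ _ (fun z : 'rV[R]_m * R => kernn h (y' - z.1) * partial 0 f (cons_rv z.2 z.1))).
  refine (@continuousT_mul _ _ (fun z : 'rV[R]_m * R => kernn h (y' - z.1)) (fun z => partial 0 f (cons_rv z.2 z.1)) _ _).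
    by refine (@continuousT_comp _ _ _ fst _ _ ck); cont.
  refine (@continuousT_comp _ _ _ (fun z : 'rV[R]_m * R => (z.2, z.1)) (fun z => partial 0 f (cons_rv z.1 z.2)) _ (continuous_cons_rv cpf)).
  by cont.
have G'M t : a 0 0 < t < b 0 0 -> `|G' t| <= M * (1 + c) ^+ m.
  move=> /andP[at_ tb]; apply: is_derive_norm_le (dG t) _.
  near=> t'; apply: lipG; last by lra.
  apply/andP; split; apply: ltW; near: t'; [exact: lt_nbhsr|exact: lt_nbhsl].
have -> : itint a b (fun x => kernn h (y - x) * f x) =
    oint (a 0 0) (b 0 0) (fun t => kern h (y 0 0 - t) * G t).
  rewrite itintS; apply: eq_oint => t; rewrite /G -itintZ; last first.
    by have := continuous_cons_rvr (t := t) cf => ?; cont.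
  by apply: eq_itint => x; rewrite kernn_cons mulrA.
have key := kern_estimate h0 t0 ts ya0 yb0 cG' dG (fun t tab => (slice t tab).1) G'M.
have [S1 S2] := slice (y 0 0) ltac:(lra).
have yE : cons_rv (y 0 0) y' = y :> 'rV[R]_m.+1.
  apply/rowP => j; case: (@split_ordP 1 m j) => k ->; last by rewrite cons_rvS mxE.
  rewrite (_ : lshift m k = 0 :> 'I_m.+1) ?cons_rv0//.
  by apply: val_inj; rewrite ord1.
rewrite yE in S2.
have P0 : 1 <= (1 + c) ^+ m by rewrite exprn_ege1// lerDl.
move: key; set I := oint _ _ _ => key.
have {}key : `|I - G (y 0 0)| <= M * (1 + c) ^+ m * c.
  apply: le_trans key _; apply: ler_wpM2l; first by rewrite mulr_ge0// (le_trans ler01).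
  by apply: lerD => //; apply: ler_wpM2r; [rewrite invr_ge0 mulr_ge0// ltW|exact: abl].
split.
  rewrite exprS (_ : M * _ = M * (1 + c) ^+ m * c + M * (1 + c) ^+ m); last by ring.
  by rewrite -[X in `|X|](subrK (G (y 0 0))) (le_trans (ler_normD _ _))// lerD.
rewrite (_ : I - f y = (I - G (y 0 0)) + (G (y 0 0) - f y)); last by ring.
rewrite exprS (_ : M * _ = M * (1 + c) ^+ m * c + M * ((1 + c) ^+ m - 1)); last by ring.
by rewrite (le_trans (ler_normD _ _))// lerD.
Unshelve. all: by end_near. Qed.

End DirichletKernelN.

(** * Explicit integrals, and dependence on the endpoints *)

Section ExplicitIntegrals.
Context {R : realType}.

Lemma itint_prod n (a b : 'rV[R]_n) (g : 'I_n -> R -> R) :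
  (forall j, continuous (g j)) ->
  itint a b (fun x => \prod_j g j (x 0 j)) = \prod_j oint (a 0 j) (b 0 j) (g j).
Proof.
elim: n a b g => [|m IH] a b g cg; first by rewrite /= !big_ord0.
have cP : continuous (fun x : 'rV[R]_m => \prod_(i < m) g (lift ord0 i) (x 0 i)).
  refine (@continuousT_prod _ _ _ (fun i (x : 'rV[R]_m) => g (lift ord0 i) (x 0 i)) _) => i.
  by refine (@continuousT_comp _ _ _ (fun x : 'rV[R]_m => x 0 i) _ _ (cg _)); cont.
rewrite itintS big_ord_recl.
rewrite (_ : (fun t => itint _ _ _) = (fun t => (\prod_(i < m)
    oint (a 0 (lift ord0 i)) (b 0 (lift ord0 i)) (g (lift ord0 i))) * g ord0 t)).
  by rewrite ointZ// mulrC.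
apply/funext => t.
have E x : \prod_(i < m.+1) g i (cons_rv t x 0 i) =
    g ord0 t * \prod_(i < m) g (lift ord0 i) (x 0 i).
  rewrite big_ord_recl; congr (g _ _ * _); first exact: cons_rv0.
  by apply: eq_bigr => i _; rewrite -rshift1 cons_rvS.
rewrite (eq_itint _ _ E) itintZ// mulrC (IH _ _ (fun i => g (lift ord0 i)))//; congr (_ * _); apply: eq_bigr => i _.
by rewrite !mxE -rshift1.
Qed.

Definition dotv n (x y : 'rV[R]_n) : R := \sum_j x 0 j * y 0 j.

Lemma continuousT_dotv {S : topologicalType} n (f g : S -> 'rV[R]_n) :
  continuous f -> continuous g -> continuous (fun x : S => dotv (f x) (g x)).
Proof.
move=> cf cg; refine (@continuousT_sum _ _ _ (fun j x => f x 0 j * g x 0 j) _) => j.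
by cont.
Qed.

Lemma dotvC n (x y : 'rV[R]_n) : dotv x y = dotv y x.
Proof. by apply: eq_bigr => j _; rewrite mulrC. Qed.

Lemma dotvBl n (x y z : 'rV[R]_n) : dotv (x - y) z = dotv x z - dotv y z.
Proof.
by rewrite /dotv -sumrB; apply: eq_bigr => j _; rewrite !mxE mulrBl.
Qed.

Lemma dotvNl n (x z : 'rV[R]_n) : dotv (- x) z = - dotv x z.
Proof. by rewrite -sub0r dotvBl /dotv big1 ?sub0r// => j _; rewrite mxE mul0r. Qed.

Lemma dotv_cons m (z : 'rV[R]_(1 + m)) t x :
  dotv z (cons_rv t x) = z 0 0 * t + dotv (rsubmx z) x.
Proof.
rewrite /dotv big_ord_recl; congr (_ * _ + _); first exact: cons_rv0.
by apply: eq_bigr => i _; rewrite -rshift1 cons_rvS mxE.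
Qed.

Lemma oint_cos_sym (h z : R) : oint (- h) h (fun t => cos (z * t)) = 2 * h * sinc (h * z).
Proof.
have [->|z0] := eqVneq z 0.
  rewrite (_ : (fun t => _) = (fun=> 1)); last by apply/funext => t; rewrite mul0r cos0.
  by rewrite oint_cst mulr0 sinc0; ring.
rewrite oint_cos_lin// mulrN sinN opprK mulrC.
by rewrite (mulrC z h) sinx_sinc; field.
Qed.

Lemma oint_sin_sym (h z : R) : oint (- h) h (fun t => sin (z * t)) = 0.
Proof.
have [->|z0] := eqVneq z 0.
  rewrite (_ : (fun t => _) = (fun=> 0)); last by apply/funext => t; rewrite mul0r sin0.
  by rewrite oint_cst mul0r.
have dF (t : R) : is_derive t 1 (fun t => - z^-1 * cos (0 + z * t)) (sin (z * t)).
  have -> : (fun t => - z^-1 * cos (0 + z * t)) = (- z^-1) \*: (fun t => cos (0 + z * t)) by [].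
  have dc := @is_derive_comp_lin _ 0 z cos _ t (is_derive_cos _).
  by apply: is_derive_eq; rewrite /GRing.scale/= add0r; field.
rewrite (oint_FTC _ _ dF); last by cont.
by rewrite !add0r mulrN cosN subrr.
Qed.

(** The addition formulas mix the two integrals, hence the joint induction; each term with a sine in
    it dies by symmetry of the interval. *)
Lemma itint_cos_sin n (h : R) (z : 'rV[R]_n) :
  itint (const_mx (- h)) (const_mx h) (fun w => cos (dotv z w)) =
    \prod_j (2 * h * sinc (h * z 0 j)) /\
  itint (const_mx (- h)) (const_mx h) (fun w => sin (dotv z w)) = 0.
Proof.
elim: n z => [|m IH] z.
  by rewrite /= /dotv !big_ord0 cos0 sin0.
have [IHc IHs] := IH (rsubmx (z : 'rV[R]_(1 + m))).
have cr (c : R) : rsubmx (const_mx c : 'rV[R]_(1 + m)) = const_mx c by apply/rowP => i; rewrite !mxE.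
have cc : continuous (fun w => cos (dotv (rsubmx (z : 'rV[R]_(1 + m))) w)).
  by cont; apply: continuousT_dotv; cont.
have cs : continuous (fun w => sin (dotv (rsubmx (z : 'rV[R]_(1 + m))) w)).
  by cont; apply: continuousT_dotv; cont.
split; rewrite itintS !cr ![const_mx _ _ _]mxE.
  rewrite (_ : (fun t => _) = (fun t => (\prod_j (2 * h * sinc (h * (rsubmx (z : 'rV[R]_(1 + m))) 0 j))) *
      cos (z 0 0 * t))); last first.
    apply/funext => t; under eq_itint => x do rewrite dotv_cons cosD.
    by rewrite itintB ?itintZ//; [rewrite IHc IHs mulr0 subr0 mulrC|cont|cont].
  rewrite ointZ; last by cont.
  rewrite oint_cos_sym mulrC big_ord_recl; congr (_ * _).
  by apply: eq_bigr => i _; rewrite mxE rshift1.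
rewrite (_ : (fun t => _) = (fun t => (\prod_j (2 * h * sinc (h * (rsubmx (z : 'rV[R]_(1 + m))) 0 j))) *
      sin (z 0 0 * t))); last first.
    apply/funext => t; under eq_itint => x do rewrite dotv_cons sinD.
    by rewrite itintD ?itintZ//; [rewrite IHc IHs mulr0 addr0 mulrC|cont|cont].
by rewrite ointZ ?oint_sin_sym ?mulr0//; cont.
Qed.

Lemma kernn_fourier n (h : R) (z : 'rV[R]_n) :
  kernn h z = (2 * pi) ^- n * itint (const_mx (- h)) (const_mx h) (fun w => cos (dotv z w)).
Proof.
rewrite (itint_cos_sin h z).1 -exprVn -[X in _ ^+ X](card_ord n) -prodr_const -big_split/=.
apply: eq_bigr => j _; rewrite /kern; have := @pi_gt0 R => p0.
by rewrite invfM; set q := pi^-1; field.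
Qed.

Lemma kernnN n (h : R) (z : 'rV[R]_n) : kernn h (- z) = kernn h z.
Proof. by apply: eq_bigr => j _; rewrite mxE kernN. Qed.

(** Replacing the endpoints one variable at a time costs two integrals over segments of length at
    most [eta] per variable, times the size of the other edges. The base is [1 + L] rather than [L]
    so that its powers increase with the dimension. A negligible [eta] thus changes the integral by
    a negligible amount. *)
Lemma itint_endpoints n (lo hi a b A B : 'rV[R]_n) (eta L M : R) (f : 'rV[R]_n -> R) :
  continuous f ->
  (forall j, [/\ lo 0 j <= a 0 j <= hi 0 j, lo 0 j <= b 0 j <= hi 0 j,
    lo 0 j <= A 0 j <= hi 0 j & lo 0 j <= B 0 j <= hi 0 j]) ->
  (forall j, `|a 0 j - A 0 j| <= eta /\ `|b 0 j - B 0 j| <= eta) ->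
  (forall j, hi 0 j - lo 0 j <= L) -> 0 <= L -> 0 <= eta ->
  (forall x, in_box lo hi x -> `|f x| <= M) ->
  `|itint a b f - itint A B f| <= n%:R * (2 * eta) * (1 + L) ^+ n * M.
Proof.
move=> cf box ab loL L0 e0 fM.
elim: n lo hi a b A B f cf box ab loL fM => [|m IH] lo hi a b A B f cf box ab loL fM.
  by rewrite /= subrr normr0 !mul0r.
have cfs t := continuous_cons_rvr (t := t) cf.
have [/andP[a1 a2] /andP[b1 b2] /andP[A1 A2] /andP[B1 B2]] := box 0.
have lohi : lo 0 0 <= hi 0 0 by lra.
have M0 : 0 <= M.
  apply: le_trans (normr_ge0 _) (fM a _) => j; have [/andP[? ?] _ _ _] := box j.
  by rewrite min_l ?max_r; [apply/andP|lra|lra].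
pose G t := itint (rsubmx (a : 'rV_(1 + m))) (rsubmx (b : 'rV_(1 + m))) (fun x => f (cons_rv t x)).
pose H t := itint (rsubmx (A : 'rV_(1 + m))) (rsubmx (B : 'rV_(1 + m))) (fun x => f (cons_rv t x)).
have cG : continuous G by exact: continuous_itint_cons.
have cH : continuous H by exact: continuous_itint_cons.
have inbox t x : lo 0 0 <= t <= hi 0 0 ->
    in_box (rsubmx (lo : 'rV_(1 + m))) (rsubmx (hi : 'rV_(1 + m))) x -> in_box lo hi (cons_rv t x).
  by move=> tlh xlh; apply: (@in_box_cons _ m lo hi) => //; rewrite min_l ?max_r.
have GH t : lo 0 0 <= t <= hi 0 0 -> `|G t - H t| <= m%:R * (2 * eta) * (1 + L) ^+ m * M.
  move=> tlh; apply: (IH (rsubmx (lo : 'rV_(1 + m))) (rsubmx (hi : 'rV_(1 + m)))) => //.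
  - by move=> j; rewrite !mxE; exact: box.
  - by move=> j; rewrite !mxE; exact: ab.
  - by move=> j; rewrite !mxE; exact: loL.
  - by move=> x xlh; apply: fM; exact: inbox.
have L1 : 1 <= 1 + L by lra.
have HM t : lo 0 0 <= t <= hi 0 0 -> `|H t| <= M * (1 + L) ^+ m.
  move=> tlh; apply: le_trans (le_itint (M := M) _ _) _ => //.
    move=> x xAB; apply: fM; apply: inbox => // j.
    have := xAB j; rewrite !mxE; have [_ _ /andP[? ?] /andP[? ?]] := box (rshift 1 j).
    move=> /andP[]; rewrite ge_min le_max => /orP[] ? /orP[] ?;
      by rewrite min_l ?max_r; [apply/andP; split; lra|lra|lra].
  rewrite ler_wpM2l// -[X in _ <= _ ^+ X](card_ord m) -prodr_const.
  apply: ler_prod => j _; rewrite normr_ge0/= !mxE.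
  have [_ _ /andP[? ?] /andP[? ?]] := box (rshift 1 j); have := loL (rshift 1 j).
  by rewrite ler_norml => ?; apply/andP; split; lra.
have hab t : Num.min (a 0 0) (b 0 0) < t < Num.max (a 0 0) (b 0 0) -> lo 0 0 <= t <= hi 0 0.
  by move=> /strictly_between[] /andP[? ?]; apply/andP; split; lra.
have e1 : `|oint (a 0 0) (b 0 0) G - oint (a 0 0) (b 0 0) H| <=
    m%:R * (2 * eta) * (1 + L) ^+ m * M * L.
  rewrite (_ : _ - _ = oint (a 0 0) (b 0 0) (fun t => G t + -1 * H t)); last first.
    by rewrite ointD ?(ointZ (-1)) ?mulN1r//; cont.
  apply: le_trans (le_oint (M := m%:R * (2 * eta) * (1 + L) ^+ m * M) _ _) _.
  - by cont.
  - by move=> t /hab tlh; rewrite mulN1r; exact: GH.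
  - apply: ler_wpM2l.
      by rewrite !mulr_ge0 ?ler0n ?exprn_ge0//; lra.
    by rewrite ler_norml; have := loL 0 => ?; apply/andP; split; lra.
have e2 : `|oint (a 0 0) (b 0 0) H - oint (A 0 0) (B 0 0) H| <= 2 * eta * (M * (1 + L) ^+ m).
  have -> : oint (a 0 0) (b 0 0) H - oint (A 0 0) (B 0 0) H = oint (a 0 0) (A 0 0) H - oint (b 0 0) (B 0 0) H.
    rewrite -(oint_cat (a 0 0) (A 0 0) (b 0 0) cH) -(oint_cat (A 0 0) (b 0 0) (B 0 0) cH).
    by ring.
  have [aA bB] := ab 0.
  have step u v : lo 0 0 <= u <= hi 0 0 -> lo 0 0 <= v <= hi 0 0 -> `|u - v| <= eta ->
      `|oint u v H| <= eta * (M * (1 + L) ^+ m).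
    move=> /andP[? ?] /andP[? ?] uv; apply: le_trans (le_oint (M := M * (1 + L) ^+ m) _ _) _ => //.
      by move=> t /strictly_between[] /andP[? ?]; apply: HM; apply/andP; split; lra.
    rewrite mulrC distrC ler_wpM2r// mulr_ge0// exprn_ge0//; lra.
  apply: le_trans (ler_normB _ _) _; rewrite -mulrA mulr_natl mulr2n lerD// step//;
    by apply/andP.
have P0 : 1 <= (1 + L) ^+ m by rewrite exprn_ege1.
rewrite !itintS -/G -/H.
rewrite (_ : oint (a 0 0) (b 0 0) G - _ = (oint (a 0 0) (b 0 0) G - oint (a 0 0) (b 0 0) H) +
  (oint (a 0 0) (b 0 0) H - oint (A 0 0) (B 0 0) H)); last by ring.
apply: le_trans (ler_normD _ _) _; apply: le_trans (lerD e1 e2) _.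
rewrite exprS -natr1; set P := (1 + L) ^+ m in P0 *; set N := m%:R.
have N0 : 0 <= N by rewrite ler0n.
rewrite -subr_ge0 (_ : _ - _ = N * (2 * eta) * P * M + (2 * eta) * P * M * L); last by ring.
by rewrite addr_ge0// !mulr_ge0//; lra.
Qed.

Lemma box_max n (lo hi : 'rV[R]_n) (g : 'rV[R]_n -> R) : continuous g ->
  (forall j, lo 0 j <= hi 0 j) ->
  exists x : 'rV[R]_n, (forall j, lo 0 j <= x 0 j <= hi 0 j) /\
    forall x' : 'rV[R]_n, (forall j, lo 0 j <= x' 0 j <= hi 0 j) -> `|g x'| <= `|g x|.
Proof.
move=> cg lohi.
pose A := [set v : 'rV[R]_n | forall i, `[lo 0 i, hi 0 i]%classic (v ord0 i)].
have cA : compact A by apply: (rV_compact (A := fun i => `[lo 0 i, hi 0 i]%classic)) => i; exact: segment_compact.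
have A0 : A !=set0 by exists lo => i; rewrite /= in_itv/= lexx lohi.
have [|x xA xmax] := @EVT_max_rV R n (fun x => `|g x|) A A0 cA.
  by apply: continuous_subspaceT => v; apply: continuous_comp; [exact: cg|exact: norm_continuous].
exists x; split=> [j|x' x'lh].
  by move: xA; rewrite inE => /(_ j); rewrite /= in_itv.
by apply: xmax; rewrite inE => i; rewrite /= in_itv/=; exact: x'lh.
Qed.

End ExplicitIntegrals.

(** * The Leibniz rule *)

Section SmoothProducts.
Context {R : realType}.

(** The index set of the Leibniz rule for words: each letter goes to one of the two factors and the
    order is kept. Both parts of a sorted word are therefore sorted, as [rgsfM] requires. *)
Fixpoint splits (T : Type) (s : seq T) : seq (seq T * seq T) :=
  if s is j :: s' then
    flatten [seq [:: (j :: p.1, p.2); (p.1, j :: p.2)] | p <- splits s']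
  else [:: ([::], [::])].

Lemma splits_subseq (T : eqType) (s : seq T) p : p \in splits s ->
  subseq p.1 s /\ subseq p.2 s.
Proof.
elim: s p => [|j s IH] p; first by rewrite inE => /eqP ->.
move=> /flattenP[_ /mapP[q /IH[q1 q2] ->]]; rewrite !inE => /orP[] /eqP -> /=.
  by rewrite eqxx; split=> //; exact: subseq_trans (subseq_cons s j).
by rewrite eqxx; split=> //; exact: subseq_trans (subseq_cons s j).
Qed.

Local Lemma sum_prod_derive n (I : Type) (l : seq I) (f g : I -> 'rV[R]_n -> R) :
  (forall i, smooth (f i)) -> (forall i, smooth (g i)) ->
  let S := fun x => \sum_(i <- l) f i x * g i x in
  continuous S /\ forall j x, is_derive x (delta_mx 0 j) S
    (\sum_(i <- l) (partial j (f i) x * g i x + f i x * partial j (g i) x)).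
Proof.
move=> sf sg; elim: l => [|i l [IHc IHd]] /=.
  rewrite (_ : (fun _ => _) = cst 0); last by apply/funext => x; rewrite big_nil.
  by split=> [|j x]; [exact: cst_continuous|rewrite big_nil; exact: is_derive_cst].
rewrite (_ : (fun _ => _) = (fun x => f i x * g i x + \sum_(i <- l) f i x * g i x)); last first.
  by apply/funext => x; rewrite big_cons.
split.
  have := smooth_continuous (sf i); have := smooth_continuous (sg i) => ? ?.
  by refine (@continuousT_add _ _ (fun x => f i x * g i x) _ _ IHc); cont.
move=> j x; rewrite big_cons.
have df := derivableP (smooth_derivable (j := j) (x := x) (sf i)).
have dg := derivableP (smooth_derivable (j := j) (x := x) (sg i)).
apply: (@is_deriveD _ _ _ (fun x => f i x * g i x) _ x _ _ _ _ (IHd j x)).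
rewrite (_ : partial j (f i) x * g i x + f i x * partial j (g i) x =
  f i x *: 'D_(delta_mx 0 j) (g i) x + g i x *: 'D_(delta_mx 0 j) (f i) x).
  exact: (is_deriveM df dg).
by rewrite addrC [partial j (f i) x * _]mulrC.
Qed.

Lemma partialsM n (f g : 'rV[R]_n -> R) s : smooth f -> smooth g ->
  partials s (fun x => f x * g x) =
  (fun x => \sum_(p <- splits s) partials p.1 f x * partials p.2 g x).
Proof.
move=> sf sg; elim: s => [|j s IH] /=; first by apply/funext => x; rewrite big_seq1.
have [_ dS] := @sum_prod_derive n _ (splits s) (fun p => partials p.1 f) (fun p => partials p.2 g)
  (fun p => smooth_partials p.1 sf) (fun p => smooth_partials p.2 sg).
rewrite /partials/= -/(partials s _) IH; apply/funext => x.
rewrite [LHS](@derive_val _ _ _ _ _ _ _ (dS j x)) big_flatten big_map; apply: eq_bigr => p _.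
by rewrite big_cons big_seq1.
Qed.

Lemma smoothM n (f g : 'rV[R]_n -> R) : smooth f -> smooth g ->
  smooth (fun x => f x * g x).
Proof.
move=> sf sg s; rewrite partialsM//.
have [cS dS] := @sum_prod_derive n _ (splits s) (fun p => partials p.1 f) (fun p => partials p.2 g)
  (fun p => smooth_partials p.1 sf) (fun p => smooth_partials p.2 sg).
by split=> // j x; case: (dS j x).
Qed.

Lemma partials0 n (s : seq 'I_n) : partials s (fun=> 0 : R) = (fun=> 0).
Proof. by elim: s => //= j s ->; apply/funext => x; exact: derive_cst. Qed.

Lemma smooth0 n : smooth (fun _ : 'rV[R]_n => 0 : R).
Proof.
move=> s; rewrite partials0; split; first exact: cst_continuous.
by move=> j x; exact: derivable_cst.
Qed.

Lemma smoothD n (f g : 'rV[R]_n -> R) : smooth f -> smooth g -> smooth (fun x => f x + g x).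
Proof.
move=> sf sg; have := smoothB sf (smoothB (@smooth0 n) sg).
by rewrite (_ : (fun x => _) = (fun x => f x + g x))//; apply/funext => x; rewrite sub0r opprK.
Qed.

Lemma partialsD n (f g : 'rV[R]_n -> R) s : smooth f -> smooth g ->
  partials s (fun x => f x + g x) = (fun x => partials s f x + partials s g x).
Proof.
move=> sf sg; have := partialsB s sf (smoothB (@smooth0 n) sg).
rewrite (_ : (fun x => f x - _) = (fun x => f x + g x)); last first.
  by apply/funext => x; rewrite sub0r opprK.
move=> ->; apply/funext => x; rewrite partialsB// ?partials0 ?sub0r ?opprK//.
exact: smooth0.
Qed.

End SmoothProducts.

(** * Trigonometric integrals with moderate derivatives *)

Section Waves.
Context {R : realType} (m n : nat).
Implicit Types (a b : 'rV[R]_m) (lam : 'rV[R]_m -> 'rV[R]_n) (p q : 'rV[R]_m -> R).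

(* A family closed under differentiation in [x] that contains the plane waves
   (for [m = 0]), the Fourier transforms and the translates of the Dirichlet
   kernel. *)
Definition wave a b lam p q (x : 'rV[R]_n) : R :=
  itint a b (fun u => p u * cos (dotv x (lam u)) + q u * sin (dotv x (lam u))).

Lemma continuous_wave_integrand lam p q x :
  continuous lam -> continuous p -> continuous q ->
  continuous (fun u => p u * cos (dotv x (lam u)) + q u * sin (dotv x (lam u))).
Proof. by move=> cl cp cq; cont; apply: continuousT_dotv; cont. Qed.

Lemma wave_bound a b lam p q x C : continuous lam -> continuous p -> continuous q ->
  (forall u, in_box a b u -> `|p u| <= C /\ `|q u| <= C) ->
  `|wave a b lam p q x| <= 2 * C * \prod_j `|b 0 j - a 0 j|.
Proof.
move=> cl cp cq pqC; apply: le_itint; first exact: continuous_wave_integrand.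
move=> u /pqC[pC qC]; apply: le_trans (ler_normD _ _) _.
rewrite mulr_natl mulr2n !normrM lerD// -[leRHS]mulr1 ler_pM//.
  exact: norm_cos_le1.
exact: norm_sin_le1.
Qed.

(** Along the line through [x] in direction [j] the phase is affine in the line parameter, so this
    is differentiation under the integral sign in one real variable. *)
Lemma is_derive_wave a b lam p q (x : 'rV[R]_n) j :
  continuous lam -> continuous p -> continuous q ->
  is_derive x (delta_mx 0 j) (wave a b lam p q)
    (wave a b lam (fun u => lam u 0 j * q u) (fun u => - (lam u 0 j * p u)) x).
Proof.
move=> cl cp cq.
have dotE (h : R) u : dotv (h *: delta_mx 0 j + x) (lam u) = dotv x (lam u) + lam u 0 j * h.
  rewrite /dotv (eq_bigr (fun i => h * (i == j)%:R * lam u 0 i + x 0 i * lam u 0 i)); last first.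
    by move=> i _; rewrite !mxE eqxx mulrDl.
  rewrite big_split/= addrC; congr (_ + _).
  rewrite (bigD1 j)//= eqxx mulr1 big1; first by rewrite addr0 mulrC.
  by move=> i ij; rewrite (negbTE ij) mulr0 mul0r.
pose phi t u := p u * cos (dotv x (lam u) + lam u 0 j * t) + q u * sin (dotv x (lam u) + lam u 0 j * t).
pose phi' t u := (lam u 0 j * q u) * cos (dotv x (lam u) + lam u 0 j * t) +
   - (lam u 0 j * p u) * sin (dotv x (lam u) + lam u 0 j * t).
have cd : continuous (fun u => dotv x (lam u)) by apply: continuousT_dotv; cont.
have dH : forall t : R, is_derive t 1 (fun t => itint a b (phi t)) (itint a b (phi' t)).
  apply: is_derive_itint.
  - by move=> t; rewrite /phi; cont.
  - move=> u t; have dc := @is_derive_comp_lin _ (dotv x (lam u)) (lam u 0 j) cos _ t (is_derive_cos _).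
    have ds := @is_derive_comp_lin _ (dotv x (lam u)) (lam u 0 j) sin _ t (is_derive_sin _).
    have -> : phi^~ u = (p u \*: (fun t => cos (dotv x (lam u) + lam u 0 j * t))) +
       (q u \*: (fun t => sin (dotv x (lam u) + lam u 0 j * t))) by [].
    by apply: is_derive_eq; rewrite /GRing.scale/= /phi'; ring.
  - rewrite /phi'; have cl2 : continuous (fun z : R * 'rV[R]_m => lam z.2).
      by refine (@continuousT_comp _ _ _ snd lam _ cl); cont.
    have cp2 : continuous (fun z : R * 'rV[R]_m => p z.2).
      by refine (@continuousT_comp _ _ _ snd p _ cp); cont.
    have cq2 : continuous (fun z : R * 'rV[R]_m => q z.2).
      by refine (@continuousT_comp _ _ _ snd q _ cq); cont.
    have cd2 : continuous (fun z : R * 'rV[R]_m => dotv x (lam z.2)).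
      by refine (@continuousT_comp _ _ _ snd _ _ cd); cont.
    by cont.
have E (h : R) : wave a b lam p q (h *: delta_mx 0 j + x) =
   (fun t => itint a b (phi t)) (h *: (1 : R^o) + 0).
  by apply: eq_itint => u; rewrite /phi dotE addr0 [h *: 1]mulr1.
have [D1 D2] := @derive_transfer R _ R^o _ (fun t => itint a b (phi t)) x _ 0 1 E.
have [dd de] := dH 0.
apply: DeriveDef; first exact/D2.
rewrite D1 [LHS]de; apply: eq_itint => u; rewrite /phi' mulr0 addr0//.
Qed.

Lemma partial_wave a b lam p q j : continuous lam -> continuous p -> continuous q ->
  partial j (wave a b lam p q) =
  wave a b lam (fun u => lam u 0 j * q u) (fun u => - (lam u 0 j * p u)).
Proof.
by move=> cl cp cq; apply/funext => x; exact: (@derive_val _ _ _ _ _ _ _ (is_derive_wave a b x j cl cp cq)).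
Qed.

Lemma continuous_wave a b lam p q : continuous lam -> continuous p -> continuous q ->
  continuous (wave a b lam p q).
Proof.
move=> cl cp cq.
apply: (@continuous_itint_param _ _ _ a b (fun z : 'rV[R]_m * 'rV[R]_n =>
  p z.1 * cos (dotv z.2 (lam z.1)) + q z.1 * sin (dotv z.2 (lam z.1)))).
have cl2 : continuous (fun z : 'rV[R]_m * 'rV[R]_n => lam z.1).
  by refine (@continuousT_comp _ _ _ fst lam _ cl); cont.
have cp2 : continuous (fun z : 'rV[R]_m * 'rV[R]_n => p z.1).
  by refine (@continuousT_comp _ _ _ fst p _ cp); cont.
have cq2 : continuous (fun z : 'rV[R]_m * 'rV[R]_n => q z.1).
  by refine (@continuousT_comp _ _ _ fst q _ cq); cont.
have cd2 : continuous (fun z : 'rV[R]_m * 'rV[R]_n => dotv z.2 (lam z.1)).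
  by apply: continuousT_dotv; cont.
by cont.
Qed.

Lemma smooth_wave a b lam p q : continuous lam -> continuous p -> continuous q ->
  smooth (wave a b lam p q).
Proof.
move=> cl cp cq; apply: (@smooth_coind _ _ (fun g => exists p q, [/\ continuous p, continuous q &
  g = wave a b lam p q])); last by exists p, q.
move=> _ [{}p [{}q [{}cp {}cq ->]]]; split; first exact: continuous_wave.
move=> j; split=> [x|]; first by case: (is_derive_wave a b x j cl cp cq).
rewrite partial_wave//; exists (fun u => lam u 0 j * q u), (fun u => - (lam u 0 j * p u)).
by split=> //; cont.
Qed.

Lemma partials_wave_bound a b lam p q C Lam s x :
  continuous lam -> continuous p -> continuous q -> 0 <= Lam ->
  (forall u, in_box a b u -> `|p u| <= C /\ `|q u| <= C) ->
  (forall u j, in_box a b u -> `|lam u 0 j| <= Lam) ->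
  `|partials s (wave a b lam p q) x| <= 2 * (Lam ^+ size s * C) * \prod_j `|b 0 j - a 0 j|.
Proof.
move=> cl cp cq L0 pqC lamL.
suff [p' [q' [-> cp' cq' pqC']]] : exists p' q', [/\ partials s (wave a b lam p q) = wave a b lam p' q',
    continuous p', continuous q' & forall u, in_box a b u -> `|p' u| <= Lam ^+ size s * C /\ `|q' u| <= Lam ^+ size s * C].
  exact: wave_bound.
elim: s => [|j s [p' [q' [E cp' cq' pqC']]]].
  by exists p, q; split=> // u /pqC; rewrite expr0 mul1r.
exists (fun u => lam u 0 j * q' u), (fun u => - (lam u 0 j * p' u)); split.
- by rewrite /= E partial_wave.
- by cont.
- by cont.
- move=> u uab; have [? ?] := pqC' u uab; have ? := lamL u j uab.
  by rewrite normrN !normrM /= exprS -mulrA; split; apply: ler_pM.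
Qed.

End Waves.

(** * Nets and their classes *)

Section Nets.
Local Open Scope quotient_scope.
Context {R : realType} {rho : gauge R}.
Implicit Types (x y z : R -> R).
Local Notation moderate := (Defs.moderate rho).
Local Notation negligible := (Defs.negligible rho).
Local Notation gcls := (gcls rho).

(** The bound [1 / 2] lets one extra power of the gauge absorb a factor [2]; this explains the
    successors in most exponents below. *)
Lemma gauge_half : \forall e \near 0^'+, [/\ 0 < rho e, rho e <= 1 & rho e <= 2^-1].
Proof.
near=> e; have /andP[? ?] : 0 < rho e <= 1 by near: e; exact: gauge_near.
by split=> //; near: e; exact: gauge_near_le.
Unshelve. all: by end_near. Qed.

Lemma gauge_exp_le (r : R) i j : 0 < r -> r <= 1 -> (i <= j)%N -> r ^+ j <= r ^+ i.
Proof. by move=> r0 r1 ij; rewrite ler_wiXn2l// ltW. Qed.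

Lemma gauge_expV_le (r : R) i j : 0 < r -> r <= 1 -> (i <= j)%N -> r ^- i <= r ^- j.
Proof. by move=> r0 r1 ij; rewrite lef_pV2 ?posrE ?exprn_gt0// gauge_exp_le. Qed.

Lemma moderate_le x y : moderate y ->
  (\forall e \near 0^'+, `|x e| <= `|y e|) -> moderate x.
Proof.
by move=> [N hN] xy; exists N; apply: filterS2 hN xy => e h1 h2; exact: le_trans h1.
Qed.

Lemma moderateB x y : moderate x -> moderate y -> moderate (fun e => x e - y e).
Proof.
have [_ B _] := @moderate_subring _ rho.
by move=> /asboolP hx /asboolP hy; apply/asboolP; exact: B hx hy.
Qed.

Lemma moderateM x y : moderate x -> moderate y -> moderate (fun e => x e * y e).
Proof.
have [_ _ M] := @moderate_subring _ rho.
by move=> /asboolP hx /asboolP hy; apply/asboolP; exact: M hx hy.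
Qed.

Lemma moderate_cst c : moderate (fun=> c).
Proof.
have [n cn] : exists n : nat, `|c| <= 2 ^+ n.
  exists (Num.truncn `|c|).+1; apply: ltW; apply: lt_trans (truncnS_gt _) _.
  by rewrite -natrX ltr_nat ltn_expl.
exists n; apply: filterS gauge_half => e [r0 _ r2]; apply: le_trans cn _.
rewrite -exprVn; apply: lerXn2r; rewrite ?nnegrE ?invr_ge0 ?(ltW r0)//.
by rewrite -[leLHS]invrK lef_pV2// posrE.
Qed.

Lemma moderateN x : moderate x -> moderate (fun e => - x e).
Proof. by move=> hx; apply: moderate_le hx _; apply: nearW => e; rewrite normrN. Qed.

Lemma moderateD x y : moderate x -> moderate y -> moderate (fun e => x e + y e).
Proof.
move=> hx hy; have := moderateB hx (moderateN hy).
by rewrite (_ : (fun e => _) = (fun e => x e + y e))//; apply/funext => e; rewrite opprK.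
Qed.

Lemma moderate_norm x : moderate x -> moderate (fun e => `|x e|).
Proof. by move=> hx; apply: moderate_le hx _; apply: nearW => e; rewrite normr_id. Qed.

Lemma moderateX x n : moderate x -> moderate (fun e => x e ^+ n).
Proof.
move=> hx; elim: n => [|n IH]; first exact: (@moderate_cst 1).
have := moderateM hx IH.
by rewrite (_ : (fun e => x e * _) = (fun e => x e ^+ n.+1))//; apply/funext => e; rewrite exprS.
Qed.

Lemma moderate_sum (I : Type) (r : seq I) (f : I -> R -> R) :
  (forall i, moderate (f i)) -> moderate (fun e => \sum_(i <- r) f i e).
Proof.
move=> hf; elim: r => [|i r IH].
  by rewrite (_ : (fun e => _) = cst 0); [exact: moderate_cst|apply/funext => e; rewrite big_nil].
rewrite (_ : (fun e => _) = (fun e => f i e + \sum_(i <- r) f i e)); first exact: moderateD.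
by apply/funext => e; rewrite big_cons.
Qed.

Lemma moderate_prod (I : Type) (r : seq I) (f : I -> R -> R) :
  (forall i, moderate (f i)) -> moderate (fun e => \prod_(i <- r) f i e).
Proof.
move=> hf; elim: r => [|i r IH].
  by rewrite (_ : (fun e => _) = cst 1); [exact: moderate_cst|apply/funext => e; rewrite big_nil].
rewrite (_ : (fun e => _) = (fun e => f i e * \prod_(i <- r) f i e)); first exact: moderateM.
by apply/funext => e; rewrite big_cons.
Qed.

Lemma moderate_rhoV N : moderate (fun e => rho e ^- N).
Proof.
exists N; apply: filterS gauge_half => e [r0 _ _].
by rewrite ger0_norm// invr_ge0 exprn_ge0// ltW.
Qed.

Lemma moderate_rhoX N : moderate (fun e => rho e ^+ N).
Proof.
apply: moderate_le (@moderate_cst 1) _; apply: filterS gauge_half => e [r0 r1 _].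
by rewrite normr1 ger0_norm ?exprn_ge0 ?(ltW r0)// exprn_ile1// ltW.
Qed.

Lemma negligible_le x y : negligible y ->
  (\forall e \near 0^'+, `|x e| <= `|y e|) -> negligible x.
Proof.
by move=> hy xy m; apply: filterS2 (hy m) xy => e h1 h2; exact: le_trans h1.
Qed.

Lemma negligible_moderate x : negligible x -> moderate x.
Proof.
by move=> hx; exists 0%N; apply: filterS (hx 0%N) => e; rewrite !expr0 invr1.
Qed.

Lemma negligibleD x y : negligible x -> negligible y -> negligible (fun e => x e + y e).
Proof.
move=> hx hy m; near=> e.
have [r0 r1 r2] : [/\ 0 < rho e, rho e <= 1 & rho e <= 2^-1] by near: e; exact: gauge_half.
have xe : `|x e| <= rho e ^+ m.+1 by near: e; exact: hx.
have ye : `|y e| <= rho e ^+ m.+1 by near: e; exact: hy.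
apply: le_trans (ler_normD _ _) _; apply: le_trans (lerD xe ye) _.
rewrite exprS -mulrDl ler_piMl ?exprn_ge0 ?(ltW r0)//; lra.
Unshelve. all: by end_near. Qed.

Lemma negligible0 : negligible (fun=> 0).
Proof.
by move=> m; apply: filterS gauge_half => e [r0 _ _]; rewrite normr0 exprn_ge0// ltW.
Qed.

Lemma negligible_near0 x : (\forall e \near 0^'+, x e = 0) -> negligible x.
Proof. by move=> x0; apply: negligible_le negligible0 _; apply: filterS x0 => e ->. Qed.

Lemma negligibleM x y : moderate x -> negligible y -> negligible (fun e => x e * y e).
Proof.
move=> [N hx] hy m; near=> e.
have [r0 r1 r2] : [/\ 0 < rho e, rho e <= 1 & rho e <= 2^-1] by near: e; exact: gauge_half.
have xe : `|x e| <= rho e ^- N by near: e.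
have ye : `|y e| <= rho e ^+ (N + m) by near: e; exact: hy.
rewrite normrM; apply: le_trans (ler_pM _ _ xe ye) _ => //.
by rewrite exprD mulrA mulVf ?mul1r// expf_neq0// gt_eqF.
Unshelve. all: by end_near. Qed.

Lemma negligible_sum (I : Type) (r : seq I) (f : I -> R -> R) :
  (forall i, negligible (f i)) -> negligible (fun e => \sum_(i <- r) f i e).
Proof.
move=> hf; elim: r => [|i r IH].
  by rewrite (_ : (fun e => _) = cst 0); [exact: negligible0|apply/funext => e; rewrite big_nil].
rewrite (_ : (fun e => _) = (fun e => f i e + \sum_(i <- r) f i e)); first exact: negligibleD.
by apply/funext => e; rewrite big_cons.
Qed.

Definition mk_mnet x (hx : moderate x) : mnet rho := Mnet (asboolT hx : x \in moderate_pred rho).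

Lemma gcls_pi (u : mnet rho) : gcls u = \pi_(gR rho) u.
Proof. by rewrite /Defs.gcls valKd. Qed.

Lemma gcls_mk x (hx : moderate x) : gcls x = \pi_(gR rho) (mk_mnet hx).
Proof. by rewrite -gcls_pi. Qed.

Lemma gcls_eq x y : moderate x -> moderate y ->
  gcls x = gcls y <-> negligible (fun e => x e - y e).
Proof.
move=> hx hy; rewrite (gcls_mk hx) (gcls_mk hy).
split=> [/eqP|n].
  by rewrite -Quotient.idealrBE => /asboolP.
by apply/eqP; rewrite -Quotient.idealrBE; apply/asboolP.
Qed.

Lemma moderate_gnet (X : gR rho) : moderate (gnet X).
Proof. by have /asboolP := valP (repr X). Qed.

Lemma gnetK (X : gR rho) : gcls (gnet X) = X.
Proof. by rewrite /gnet gcls_pi reprK. Qed.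

Lemma gnet_gcls x : moderate x -> negligible (fun e => gnet (gcls x) e - x e).
Proof. by move=> hx; apply/gcls_eq => //; [exact: moderate_gnet|exact: gnetK]. Qed.

Lemma gcls_near x y : moderate x -> moderate y ->
  (\forall e \near 0^'+, x e = y e) -> gcls x = gcls y.
Proof.
move=> hx hy xy; apply/gcls_eq => //; apply: negligible_near0.
by apply: filterS xy => e ->; rewrite subrr.
Qed.

Lemma gclsD x y : moderate x -> moderate y -> gcls (fun e => x e + y e) = gcls x + gcls y.
Proof.
move=> hx hy; rewrite (gcls_mk (moderateD hx hy)) (gcls_mk hx) (gcls_mk hy).
rewrite -[RHS](Quotient.pi_add _ (mk_mnet hx) (mk_mnet hy)).
have -> : mk_mnet (moderateD hx hy) = mk_mnet hx + mk_mnet hy by exact: val_inj.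
reflexivity.
Qed.

Lemma gclsM x y : moderate x -> moderate y -> gcls (fun e => x e * y e) = gcls x * gcls y.
Proof.
move=> hx hy; rewrite (gcls_mk (moderateM hx hy)) (gcls_mk hx) (gcls_mk hy).
rewrite -[RHS](Quotient.pi_mul _ (mk_mnet hx) (mk_mnet hy)).
have -> : mk_mnet (moderateM hx hy) = mk_mnet hx * mk_mnet hy by exact: val_inj.
reflexivity.
Qed.

Lemma gclsN x : moderate x -> gcls (fun e => - x e) = - gcls x.
Proof.
move=> hx; rewrite (gcls_mk (moderateN hx)) (gcls_mk hx).
rewrite -[RHS](Quotient.pi_opp _ (mk_mnet hx)).
have -> : mk_mnet (moderateN hx) = - mk_mnet hx by exact: val_inj.
reflexivity.
Qed.

Lemma gclsB x y : moderate x -> moderate y -> gcls (fun e => x e - y e) = gcls x - gcls y.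
Proof. by move=> hx hy; rewrite gclsD ?gclsN//; exact: moderateN. Qed.

Lemma gcls1 : gcls (fun=> 1) = 1.
Proof.
rewrite -[LHS]mulr1 -(gnetK 1) -gclsM; [|exact: moderate_cst|exact: moderate_gnet].
by congr gcls; apply/funext => e; rewrite mul1r.
Qed.

Lemma gcls0 : gcls (fun=> 0) = 0.
Proof.
by have := gclsB (moderate_cst 0) (moderate_cst 0); rewrite !subrr.
Qed.

Lemma gclsX x n : moderate x -> gcls (fun e => x e ^+ n) = gcls x ^+ n.
Proof.
move=> hx; elim: n => [|n IH]; first by rewrite expr0 -gcls1.
rewrite exprS -IH -gclsM//; last exact: moderateX.
by congr gcls; apply/funext => e; rewrite exprS.
Qed.

Lemma gcls_prod (I : Type) (r : seq I) (f : I -> R -> R) :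
  (forall i, moderate (f i)) ->
  gcls (fun e => \prod_(i <- r) f i e) = \prod_(i <- r) gcls (f i).
Proof.
move=> hf; elim: r => [|i r IH].
  by rewrite big_nil -gcls1; congr gcls; apply/funext => e; rewrite big_nil.
rewrite big_cons -IH -gclsM//; last exact: moderate_prod.
by congr gcls; apply/funext => e; rewrite big_cons.
Qed.

Lemma gcls_sum (I : Type) (r : seq I) (f : I -> R -> R) :
  (forall i, moderate (f i)) ->
  gcls (fun e => \sum_(i <- r) f i e) = \sum_(i <- r) gcls (f i).
Proof.
move=> hf; elim: r => [|i r IH].
  by rewrite big_nil -gcls0; congr gcls; apply/funext => e; rewrite big_nil.
rewrite big_cons -IH -gclsD//; last exact: moderate_sum.
by congr gcls; apply/funext => e; rewrite big_cons.
Qed.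

Lemma gle_gcls x y : moderate x -> moderate y ->
  gle (gcls x) (gcls y) <-> forall m : nat, \forall e \near 0^'+, x e <= y e + rho e ^+ m.
Proof.
move=> hx hy; split=> [[u [v [ux vy uv]]] m|xy].
  have mu : moderate u by have /asboolP := valP u.
  have mv : moderate v by have /asboolP := valP v.
  have /(gcls_eq mu hx).1 /(_ m.+1) hu : gcls u = gcls x by rewrite gcls_pi.
  have /(gcls_eq mv hy).1 /(_ m.+1) hv : gcls v = gcls y by rewrite gcls_pi.
  near=> e.
  have [r0 r1 r2] : [/\ 0 < rho e, rho e <= 1 & rho e <= 2^-1] by near: e; exact: gauge_half.
  have h1 : `|u e - x e| <= rho e ^+ m.+1 by near: e; exact: hu.
  have h2 : `|v e - y e| <= rho e ^+ m.+1 by near: e; exact: hv.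
  have h3 : u e <= v e by apply: uv; near: e; exact: near_itv01.
  have h4 : rho e ^+ m.+1 <= 2^-1 * rho e ^+ m.
    by rewrite exprS ler_wpM2r// exprn_ge0// ltW.
  by move: h1 h2; rewrite !ler_norml => /andP[? ?] /andP[? ?]; lra.
(* The positive part of [x - y] is negligible, so [y + d] is another representative of the class of
   [y], and it dominates [x] at every index. *)
pose d e := Num.max (x e - y e) 0.
have d0 e : 0 <= d e by rewrite le_max lexx orbT.
have nd : negligible d.
  move=> m; apply: filterS2 gauge_half (xy m) => e [r0 _ _] h.
  by rewrite ger0_norm// ge_max exprn_ge0 ?(ltW r0)// andbT; lra.
have hyd := moderateD hy (negligible_moderate nd).
exists (mk_mnet hx), (mk_mnet hyd); split.
- by rewrite -gcls_mk.
- rewrite -gcls_mk; apply/gcls_eq => //.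
  by apply: negligible_le nd _; apply: nearW => e; rewrite addrAC subrr add0r.
- by move=> e _ /=; rewrite /d -lerBlDl le_max lexx.
Unshelve. all: by end_near. Qed.

Lemma gle_gnet (X Y : gR rho) :
  gle X Y <-> forall m : nat, \forall e \near 0^'+, gnet X e <= gnet Y e + rho e ^+ m.
Proof.
by rewrite -[X in gle X _]gnetK -[X in gle _ X]gnetK; apply: gle_gcls; exact: moderate_gnet.
Qed.

Lemma gle_near x y : moderate x -> moderate y -> (\forall e \near 0^'+, x e <= y e) ->
  gle (gcls x) (gcls y).
Proof.
move=> hx hy xy; apply/gle_gcls => // m.
apply: filterS2 gauge_half xy => e [r0 _ _] xye.
by rewrite (le_trans xye)// lerDl exprn_ge0// ltW.
Qed.

(** If [Y] is an inverse with [|Y| <= rho ^ (- N)], then [|Y x| >= 1 / 2] forces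
    [|x| >= rho ^ (N + 1)]. Since [x >= - rho ^ (N + 2)], the negative sign is excluded. *)
Lemma gunit_lower x : moderate x -> gcls x \is a GRing.unit -> gle 0 (gcls x) ->
  exists p : nat, \forall e \near 0^'+, rho e ^+ p <= x e.
Proof.
move=> hx /asboolP[Y]; rewrite -(gnetK Y) -gclsM//; last exact: moderate_gnet.
have [N hN] := moderate_gnet Y.
have mYx : moderate (fun e => gnet Y e * x e) by apply: moderateM => //; exact: moderate_gnet.
rewrite -gcls1 => /(gcls_eq mYx (moderate_cst 1)).1 /(_ 1%N) hYx.
rewrite -gcls0 => /(gle_gcls (moderate_cst 0) hx).1 /(_ N.+2) x0.
exists N.+1; near=> e.
have [r0 r1 r2] : [/\ 0 < rho e, rho e <= 1 & rho e <= 2^-1] by near: e; exact: gauge_half.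
have h1 : `|gnet Y e * x e - 1| <= rho e ^+ 1 by near: e.
have h2 : `|gnet Y e| <= rho e ^- N by near: e.
have h3 : 0 <= x e + rho e ^+ N.+2 by near: e.
have rN : 0 < rho e ^+ N by rewrite exprn_gt0.
have h4 : rho e ^+ N.+1 <= `|x e|.
  have h5 : 2^-1 <= `|gnet Y e * x e|.
    have := ler_normD (1 - gnet Y e * x e) (gnet Y e * x e).
    by rewrite subrK normr1 distrC; move: h1; rewrite expr1; lra.
  rewrite exprS; apply: le_trans (ler_wpM2r (ltW rN) (le_trans r2 h5)) _.
  rewrite normrM mulrAC ler_piMl//.
  by apply: le_trans (ler_wpM2r (ltW rN) h2) _; rewrite mulVf// gt_eqF.
have [x0'|xneg] := leP 0 (x e); first by rewrite ger0_norm in h4.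
rewrite ltr0_norm// in h4; move: h3 h4; rewrite [rho e ^+ N.+2]exprS.
have : rho e * rho e ^+ N.+1 <= 2^-1 * rho e ^+ N.+1 by rewrite ler_wpM2r// exprn_ge0// ltW.
have : 0 < rho e ^+ N.+1 by rewrite exprn_gt0.
by lra.
Unshelve. all: by end_near. Qed.

Lemma lower_gunit x p : moderate x -> (\forall e \near 0^'+, rho e ^+ p <= x e) ->
  gcls x \is a GRing.unit.
Proof.
move=> hx xp; have hxV : moderate (fun e => (x e)^-1).
  exists p; apply: filterS2 gauge_half xp => e [r0 _ _] xe.
  have x0 : 0 < x e by apply: lt_le_trans xe; rewrite exprn_gt0.
  by rewrite normfV gtr0_norm// lef_pV2 ?posrE ?exprn_gt0.
apply/asboolP; exists (gcls (fun e => (x e)^-1)); rewrite -gclsM// -gcls1.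
apply: gcls_near; [exact: moderateM|exact: moderate_cst|].
apply: filterS2 gauge_half xp => e [r0 _ _] xe; rewrite mulVf// gt_eqF//.
by apply: lt_le_trans xe; rewrite exprn_gt0.
Qed.

Lemma gconst_unit (c : R) : c != 0 -> gconst rho c \is a GRing.unit /\
  (gconst rho c)^-1 = gconst rho c^-1.
Proof.
move=> c0.
have cc : gconst rho c^-1 * gconst rho c = 1.
  by rewrite /gconst -gclsM; [rewrite mulVf// gcls1|exact: moderate_cst..].
have cu : gconst rho c \is a GRing.unit by apply/asboolP; exists (gconst rho c^-1).
by split=> //; apply: (mulIr cu); rewrite mulVr.
Qed.

Lemma normc_le (a b : R) : 0 <= Normc.normc (Complex a b) <= `|a| + `|b|.
Proof.
rewrite /Normc.normc sqrtr_ge0/= -(@ler_pXn2r _ 2)// ?nnegrE ?sqrtr_ge0 ?addr_ge0//.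
rewrite sqr_sqrtr ?addr_ge0 ?sqr_ge0// sqrrD !real_normK ?num_real//.
by rewrite lerD2r lerDl mulrn_wge0// mulr_ge0.
Qed.

Lemma normc_ge (a b : R) : `|a| <= Normc.normc (Complex a b) /\ `|b| <= Normc.normc (Complex a b).
Proof.
rewrite /Normc.normc; split; rewrite -(@ler_pXn2r _ 2)// ?nnegrE ?sqrtr_ge0//;
  by rewrite sqr_sqrtr ?addr_ge0 ?sqr_ge0// real_normK ?num_real// ?lerDl ?lerDr sqr_ge0.
Qed.

Lemma gcabs_le (a b : R -> R) q : moderate a -> moderate b ->
  (\forall e \near 0^'+, `|a e| <= rho e ^+ q.+2 /\ `|b e| <= rho e ^+ q.+2) ->
  gle (gcabs (Complex (gcls a) (gcls b))) (dgauge rho ^+ q).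
Proof.
move=> ha hb ab; have mrho : moderate rho by exact: (moderate_rhoX 1).
rewrite /dgauge -gclsX//; apply: gle_near; last 1 first.
- near=> e.
  have [r0 r1 r2] : [/\ 0 < rho e, rho e <= 1 & rho e <= 2^-1] by near: e; exact: gauge_half.
  have [h1 h2] : `|a e| <= rho e ^+ q.+2 /\ `|b e| <= rho e ^+ q.+2 by near: e.
  have h3 : `|gnet (gcls a) e - a e| <= rho e ^+ q.+2 by near: e; exact: gnet_gcls.
  have h4 : `|gnet (gcls b) e - b e| <= rho e ^+ q.+2 by near: e; exact: gnet_gcls.
  have /andP[_ h] := normc_le (gnet (gcls a) e) (gnet (gcls b) e).
  apply: le_trans h _.
  have rq : rho e ^+ q.+2 <= 4^-1 * rho e ^+ q.
    rewrite -addn2 exprD mulrC ler_wpM2r ?exprn_ge0 ?(ltW r0)//.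
    have -> : 4^-1 = 2^-1 ^+ 2 :> R by rewrite expr2; field.
    by apply: lerXn2r; rewrite ?nnegrE ?(ltW r0).
  by move: h1 h2 h3 h4; rewrite !ler_norml => /andP[? ?] /andP[? ?] /andP[? ?] /andP[? ?];
    have [?|?] := ler0P (gnet (gcls a) e); have [?|?] := ler0P (gnet (gcls b) e); lra.
- apply: moderate_le (moderateD (moderate_norm (moderate_gnet (gcls a))) (moderate_norm (moderate_gnet (gcls b)))) _.
  apply: nearW => e; have /andP[h0 h1] := normc_le (gnet (gcls a) e) (gnet (gcls b) e).
  by rewrite ger0_norm// (le_trans h1)// ler_norm.
- exact: moderateX.
Unshelve. all: by end_near. Qed.

Lemma cmoderateP (z : R -> R[i]%C) : cmoderate rho z <->
  moderate (fun e => complex.Re (z e)) /\ moderate (fun e => complex.Im (z e)).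
Proof.
split=> [hz|[h1 h2]].
  split; apply: moderate_le hz _; apply: nearW => e; case: (z e) => a b /=;
    have /andP[h0 _] := normc_le a b; rewrite (ger0_norm h0); have [] := normc_ge a b; done.
apply: moderate_le (moderateD (moderate_norm h1) (moderate_norm h2)) _.
apply: nearW => e; case: (z e) => a b /=; have /andP[h0 h] := normc_le a b.
by rewrite ger0_norm// (le_trans h)// ler_norm.
Qed.

(** Meant for [sinc], [cos] and [sin]: the Lipschitz bound frees [gsinc] and [gexpi] from the chosen
    representative, and boundedness by [1] gives moderateness. *)
Lemma gcls_lip (f : R -> R) x : (forall a b, `|f a - f b| <= `|a - b|) ->
  (forall a, `|f a| <= 1) -> moderate x ->
  gcls (fun e => f (gnet (gcls x) e)) = gcls (fun e => f (x e)).
Proof.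
move=> fL f1 hx; have mf y : moderate (fun e => f (y e)).
  by apply: moderate_le (moderate_cst 1) _; apply: nearW => e; rewrite normr1.
by apply/gcls_eq => //; apply: negligible_le (gnet_gcls hx) _; exact: nearW.
Qed.

End Nets.

(** * Generalized smooth functions and their integrals *)

Section SortedPartials.
Context {n : nat}.
Implicit Types (s t : seq 'I_n).

Definition ord_leq : rel 'I_n := fun i j => (i <= j)%N.

Lemma ord_leq_trans : transitive ord_leq.
Proof. by move=> j i k; exact: leq_trans. Qed.

Lemma ord_leq_anti : antisymmetric ord_leq.
Proof. by move=> i j /anti_leq /val_inj. Qed.

Lemma sorted_enum_ord : sorted ord_leq (enum 'I_n).
Proof.
have := iota_sorted 0 n; rewrite -val_enum_ord sorted_map; exact.
Qed.

Lemma sorted_subseq_enum s : subseq s (enum 'I_n) -> sorted ord_leq s.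
Proof. by move=> sn; apply: (subseq_sorted ord_leq_trans sn); exact: sorted_enum_ord. Qed.

Lemma sorted_mpartial (alpha : 'I_n -> nat) :
  sorted ord_leq (flatten [seq nseq (alpha j) j | j <- enum 'I_n]).
Proof.
rewrite (sorted_pairwise ord_leq_trans).
have := sorted_enum_ord; rewrite (sorted_pairwise ord_leq_trans).
elim: (enum 'I_n) => //= j t IH /andP[/allP jt tp]; rewrite pairwise_cat IH// andbT.
apply/andP; split.
  apply/allrelP => x y; rewrite mem_nseq => /andP[_ /eqP->].
  by move=> /flattenP[_ /mapP[i it ->]]; rewrite mem_nseq => /andP[_ /eqP->]; exact: jt.
elim: (alpha j) => //= a IHa; rewrite IHa andbT; apply/allP => x.
by rewrite mem_nseq => /andP[_ /eqP->]; exact: leqnn.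
Qed.

(** Sorted words with equal multiplicities coincide, so sorted words and multi-indices carry the
    same information. *)
Lemma mpartial_sorted s : sorted ord_leq s ->
  flatten [seq nseq (count_mem j s) j | j <- enum 'I_n] = s.
Proof.
move=> ss; apply: (sorted_eq ord_leq_trans ord_leq_anti) => //.
  exact: sorted_mpartial.
apply/allP => x _ /=; apply/eqP.
rewrite count_flatten -map_comp sumnE big_map big_enum/= (bigD1 x)//=.
rewrite count_nseq /= eqxx mul1n big1 ?addn0// => i ix.
by rewrite count_nseq /= (negbTE ix) mul0n.
Qed.

End SortedPartials.

(** * Real-valued nets, and well-definedness of the integral *)

Section RealGSF.
Context {R : realType} {rho : gauge R}.
Local Notation moderate := (Defs.moderate rho).
Local Notation negligible := (Defs.negligible rho).
Local Notation gcls := (gcls rho).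
Local Notation gR := (gR rho).
Local Notation gC := (gC rho).
Local Notation gvcls := (gvcls rho).
Local Notation vmoderate := (vmoderate rho).

(* Real-valued nets; derivatives are indexed by sorted sequences of variables
   instead of multi-indices. *)
Definition rgsf n (X : set 'rV[gR]_n) (F : R -> 'rV[R]_n -> R) : Prop :=
  (forall e, 0 < e <= 1 -> smooth (F e)) /\
  forall x, vmoderate x -> X (gvcls x) -> forall s, sorted ord_leq s ->
    moderate (fun e => partials s (F e) (x e)).

Lemma rgsf_sub n (X Y : set 'rV[gR]_n) F : X `<=` Y -> rgsf Y F -> rgsf X F.
Proof. by move=> XY [sF mF]; split=> // x hx Xx; apply: mF => //; exact: XY. Qed.

Lemma rgsf_moderate n (X : set 'rV[gR]_n) F x : rgsf X F -> vmoderate x -> X (gvcls x) ->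
  moderate (fun e => F e (x e)).
Proof. by move=> [_ mF] hx Xx; exact: (mF x hx Xx [::]). Qed.

Lemma moderate_eq01 x y : (forall e, 0 < e <= 1 -> x e = y e) -> moderate y -> moderate x.
Proof.
by move=> xy hy; apply: moderate_le hy _; apply: filterS near_itv01 => e /xy ->.
Qed.

Lemma rgsfB n (X : set 'rV[gR]_n) F G : rgsf X F -> rgsf X G ->
  rgsf X (fun e x => F e x - G e x).
Proof.
move=> [sF mF] [sG mG]; split=> [e e01|x hx Xx s ss].
  by apply: smoothB; [exact: sF|exact: sG].
apply: (moderate_eq01 (y := fun e => partials s (F e) (x e) - partials s (G e) (x e))).
  by move=> e e01; rewrite partialsB; [|exact: sF|exact: sG].
by apply: moderateB; [exact: mF|exact: mG].
Qed.

Lemma rgsfD n (X : set 'rV[gR]_n) F G : rgsf X F -> rgsf X G ->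
  rgsf X (fun e x => F e x + G e x).
Proof.
move=> [sF mF] [sG mG]; split=> [e e01|x hx Xx s ss].
  by apply: smoothD; [exact: sF|exact: sG].
apply: (moderate_eq01 (y := fun e => partials s (F e) (x e) + partials s (G e) (x e))).
  by move=> e e01; rewrite partialsD; [|exact: sF|exact: sG].
by apply: moderateD; [exact: mF|exact: mG].
Qed.

Lemma moderate_sum_seq (I : eqType) (r : seq I) (f : I -> R -> R) :
  (forall i, i \in r -> moderate (f i)) -> moderate (fun e => \sum_(i <- r) f i e).
Proof.
move=> hf; rewrite (_ : (fun e => _) = (fun e => \sum_(i <- r) (if i \in r then f i e else 0))).
  by apply: moderate_sum => i; case ir: (i \in r); [exact: hf|exact: moderate_cst].
by apply/funext => e; apply: eq_big_seq => i ->.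
Qed.

Lemma rgsfM n (X : set 'rV[gR]_n) F G : rgsf X F -> rgsf X G ->
  rgsf X (fun e x => F e x * G e x).
Proof.
move=> [sF mF] [sG mG]; split=> [e e01|x hx Xx s ss].
  by apply: smoothM; [exact: sF|exact: sG].
apply: (moderate_eq01 (y := fun e => \sum_(p <- splits s)
    partials p.1 (F e) (x e) * partials p.2 (G e) (x e))).
  by move=> e e01; rewrite partialsM; [|exact: sF|exact: sG].
apply: (@moderate_sum_seq _ (splits s) (fun p e => partials p.1 (F e) (x e) * partials p.2 (G e) (x e))) => p /splits_subseq[p1 p2].
by apply: moderateM; [apply: mF|apply: mG] => //; apply: (subseq_sorted ord_leq_trans _ ss).
Qed.

Lemma rgsf0 n (X : set 'rV[gR]_n) : rgsf X (fun _ _ => 0).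
Proof.
split=> [e _|x _ _ s _]; first exact: smooth0.
by rewrite partials0; exact: moderate_cst.
Qed.

Lemma rgsf_eq n (X : set 'rV[gR]_n) F G : rgsf X F -> (forall e x, F e x = G e x) -> rgsf X G.
Proof.
by move=> hF FG; rewrite (_ : G = F)//; apply/funext => e; apply/funext => x; rewrite FG.
Qed.

(** The estimate of the derivatives of a wave does not involve the point, so [X] is arbitrary; the
    data have to be controlled only on the box of integration. *)
Lemma rgsf_wave m n (X : set 'rV[gR]_n) (a b : R -> 'rV[R]_m) lam p q (N : nat) :
  (forall e, 0 < e <= 1 -> [/\ continuous (lam e : 'rV[R]_m -> 'rV[R]_n),
    continuous (p e) & continuous (q e)]) ->
  (\forall e \near 0^'+, forall u, in_box (a e) (b e) u ->
    [/\ `|p e u| <= rho e ^- N, `|q e u| <= rho e ^- N & forall j, `|lam e u 0 j| <= rho e ^- N]) ->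
  (\forall e \near 0^'+, forall j, `|b e 0 j - a e 0 j| <= rho e ^- N) ->
  rgsf X (fun e => wave (a e) (b e) (lam e) (p e) (q e)).
Proof.
move=> cc bnd ab; split=> [e /cc[? ? ?]|x hx _ s _]; first exact: smooth_wave.
have my : moderate (fun e => 2 * ((rho e ^- N) ^+ size s * rho e ^- N) * (\prod_(j < m) rho e ^- N)).
  apply: moderateM.
    apply: moderateM; first exact: moderate_cst.
    by apply: moderateM; [apply: moderateX|]; exact: moderate_rhoV.
  by apply: moderate_prod => _; exact: moderate_rhoV.
apply: moderate_le my _; near=> e.
have [r0 r1 r2] : [/\ 0 < rho e, rho e <= 1 & rho e <= 2^-1] by near: e; exact: gauge_half.
have rN : 0 <= rho e ^- N by rewrite invr_ge0 exprn_ge0// ltW.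
have [? ? ?] : [/\ continuous (lam e), continuous (p e) & continuous (q e)].
  by apply: cc; near: e; exact: near_itv01.
have bnde : forall u, in_box (a e) (b e) u ->
    [/\ `|p e u| <= rho e ^- N, `|q e u| <= rho e ^- N & forall j, `|lam e u 0 j| <= rho e ^- N].
  by near: e.
have abe : forall j, `|b e 0 j - a e 0 j| <= rho e ^- N by near: e.
have P0 : 0 <= \prod_(j < m) rho e ^- N by apply: prodr_ge0.
rewrite [leRHS]ger0_norm; last by rewrite !mulr_ge0// exprn_ge0.
apply: le_trans (partials_wave_bound (C := rho e ^- N) (Lam := rho e ^- N) _ _ _ _ _ _ _ _) _ => //.
- by move=> u /bnde[].
- by move=> u j /bnde[].
apply: ler_wpM2l; first by rewrite !mulr_ge0// exprn_ge0.
by apply: ler_prod => j _; rewrite normr_ge0 abe.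
Unshelve. all: by end_near. Qed.

Lemma gsf_netP n (X : set 'rV[gR]_n) f F :
  gsf_net X f F <->
  [/\ rgsf X (fun e x => complex.Re (F e x)), rgsf X (fun e x => complex.Im (F e x)) &
  forall x, vmoderate x -> X (gvcls x) -> f (gvcls x) = gcclass rho (fun e => F e (x e))].
Proof.
split=> [[sF mF]|[[sR mR] [sI mI] fF]].
  split; [split|split|].
  - by move=> e /sF[].
  - move=> x hx Xx s ss; have [_ /(_ (fun j => count_mem j s))] := mF x hx Xx.
    by move=> /cmoderateP[+ _]; rewrite /cmpartial/= /mpartial mpartial_sorted.
  - by move=> e /sF[].
  - move=> x hx Xx s ss; have [_ /(_ (fun j => count_mem j s))] := mF x hx Xx.
    by move=> /cmoderateP[_ +]; rewrite /cmpartial/= /mpartial mpartial_sorted.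
  - by move=> x hx Xx; have [] := mF x hx Xx.
split=> [e e01|x hx Xx]; first by split; [exact: sR|exact: sI].
split=> [|alpha]; first exact: fF.
by apply/cmoderateP; split=> /=; [apply: mR|apply: mI] => //; exact: sorted_mpartial.
Qed.

Lemma gcclassE (z : R -> R[i]%C) : gcclass rho z =
  Complex (gcls (fun e => complex.Re (z e))) (gcls (fun e => complex.Im (z e))).
Proof. by []. Qed.

Lemma gsf_netM n (X : set 'rV[gR]_n) f g F G : gsf_net X f F -> gsf_net X g G ->
  gsf_net X (fun x => f x * g x) (fun e x =>
    Complex (complex.Re (F e x) * complex.Re (G e x) - complex.Im (F e x) * complex.Im (G e x))
            (complex.Re (F e x) * complex.Im (G e x) + complex.Im (F e x) * complex.Re (G e x))).
Proof.
move=> /gsf_netP[F1 F2 fF] /gsf_netP[G1 G2 gG]; apply/gsf_netP; split.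
- exact: (rgsfB (rgsfM F1 G1) (rgsfM F2 G2)).
- exact: (rgsfD (rgsfM F1 G2) (rgsfM F2 G1)).
move=> x hx Xx; rewrite fF// gG// !gcclassE /=.
have m1 := rgsf_moderate F1 hx Xx; have m2 := rgsf_moderate F2 hx Xx.
have m3 := rgsf_moderate G1 hx Xx; have m4 := rgsf_moderate G2 hx Xx.
rewrite (gclsB (moderateM m1 m3) (moderateM m2 m4)) (gclsD (moderateM m1 m4) (moderateM m2 m3)).
by rewrite !gclsM.
Qed.

Lemma gsf_net_sub n (X Y : set 'rV[gR]_n) f F : X `<=` Y -> gsf_net Y f F -> gsf_net X f F.
Proof.
move=> XY /gsf_netP[F1 F2 fF]; apply/gsf_netP; split; [exact: rgsf_sub F1|exact: rgsf_sub F2|].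
by move=> x hx Xx; apply: fF => //; exact: XY.
Qed.

Lemma vmoderate_gvnet n (a : 'rV[gR]_n) : vmoderate (gvnet a).
Proof.
by move=> j; apply: (moderate_eq01 (y := gnet (a 0 j))); [move=> e _; rewrite mxE|exact: moderate_gnet].
Qed.

Lemma gvnetK n (a : 'rV[gR]_n) : gvcls (gvnet a) = a.
Proof.
apply/rowP => j; rewrite mxE -[RHS]gnetK; congr Defs.gcls.
by apply/funext => e; rewrite mxE.
Qed.

Lemma gvcls_coord n (A : R -> 'rV[R]_n) a j : gvcls A = a ->
  gcls (fun e => A e 0 j) = a 0 j.
Proof. by move=> <-; rewrite mxE. Qed.

(** A net squeezed between all four representatives still defines a point of [[a, b]], although
    these representatives may be misordered at some indices. Points of the hull of two boxes are
    thus points of the generalized box. *)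
Lemma gle_hull (a b : gR) (A B A' B' : R -> R) :
  gle a b -> moderate A -> moderate B -> moderate A' -> moderate B' ->
  gcls A = a -> gcls A' = a -> gcls B = b -> gcls B' = b ->
  forall x, moderate x ->
   (forall e, Num.min (Num.min (A e) (A' e)) (Num.min (B e) (B' e)) <= x e <=
     Num.max (Num.max (A e) (A' e)) (Num.max (B e) (B' e))) ->
   gle a (gcls x) /\ gle (gcls x) b.
Proof.
move=> ab mA mB mA' mB' Aa A'a Bb B'b x mx xlh.
have le_of (u v : R -> R) : moderate u -> moderate v -> gle (gcls u) (gcls v) ->
    forall m : nat, \forall e \near 0^'+, u e <= v e + rho e ^+ m.
  by move=> mu mv /(gle_gcls mu mv).1.
have glexx c : gle c c by rewrite -[c]gnetK; apply: gle_near; [exact: moderate_gnet..|exact: nearW].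
split.
  rewrite -Aa; apply/gle_gcls => // m; near=> e.
  have : A e <= A' e + rho e ^+ m by near: e; apply: le_of => //; rewrite Aa A'a.
  have : A e <= B e + rho e ^+ m by near: e; apply: le_of => //; rewrite Aa Bb.
  have : A e <= B' e + rho e ^+ m by near: e; apply: le_of => //; rewrite Aa B'b.
  have : A e <= A e + rho e ^+ m by near: e; apply: le_of => //; exact: glexx.
  have /andP[+ _] := xlh e; rewrite !ge_min => /orP[/orP[]|/orP[]] ? ? ? ? ?; lra.
rewrite -Bb; apply/gle_gcls => // m; near=> e.
have : A' e <= B e + rho e ^+ m by near: e; apply: le_of => //; rewrite Bb A'a.
have : A e <= B e + rho e ^+ m by near: e; apply: le_of => //; rewrite Aa Bb.
have : B' e <= B e + rho e ^+ m by near: e; apply: le_of => //; rewrite Bb B'b.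
have : B e <= B e + rho e ^+ m by near: e; apply: le_of => //; exact: glexx.
have /andP[_] := xlh e; rewrite !le_max => /orP[/orP[]|/orP[]] ? ? ? ? ?; lra.
Unshelve. all: by end_near. Qed.

(* Maximal points, chosen for each value of the index, form a net of the box. *)
Lemma box_max_net n (lo hi : R -> 'rV[R]_n) (G : R -> 'rV[R]_n -> R) :
  vmoderate lo -> vmoderate hi -> (forall e j, lo e 0 j <= hi e 0 j) ->
  (forall e, 0 < e <= 1 -> continuous (G e)) ->
  exists x, [/\ vmoderate x, forall e j, lo e 0 j <= x e 0 j <= hi e 0 j &
    forall e, 0 < e <= 1 -> forall x', in_box (lo e) (hi e) x' -> `|G e x'| <= `|G e (x e)|].
Proof.
move=> mlo mhi lohi cG.
have H e : exists x : 'rV[R]_n, (forall j, lo e 0 j <= x 0 j <= hi e 0 j) /\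
    (0 < e <= 1 -> forall x', in_box (lo e) (hi e) x' -> `|G e x'| <= `|G e x|).
  (* [choice] asks for a point at every index; outside [(0, 1]] the corner [lo e] is a dummy. *)
  have [e01|e01] := pselect (0 < e <= 1); last by exists (lo e); split=> // j; rewrite lexx lohi.
  have [x [xlh xmax]] := box_max (cG e e01) (lohi e).
  exists x; split=> // _ x' x'lh; apply: xmax => j.
  by have := x'lh j; rewrite min_l// max_r.
have [x xP] := choice H.
exists x; split=> [j|e j|e e01 x'].
- apply: moderate_le (moderateD (moderate_norm (mlo j)) (moderate_norm (mhi j))) _.
  apply: nearW => e; have [/(_ j)/andP[h1 h2] _] := xP e.
  rewrite [leRHS]ger0_norm ?addr_ge0// ler_norml.
  have := ler_norm (hi e 0 j); have := ler_norm (- lo e 0 j); rewrite normrN.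
  have := normr_ge0 (hi e 0 j); have := normr_ge0 (lo e 0 j).
  by move=> ? ? ? ?; apply/andP; split; lra.
- by have [+ _] := xP e; exact.
- by have [_ +] := xP e; exact.
Qed.

Lemma norm_min_le (u v : R) : `|Num.min u v| <= `|u| + `|v|.
Proof. by rewrite minEle; case: ifP => _; rewrite ?lerDl ?lerDr. Qed.

Lemma norm_max_le (u v : R) : `|Num.max u v| <= `|u| + `|v|.
Proof. by rewrite maxEle; case: ifP => _; rewrite ?lerDl ?lerDr. Qed.

(** Makes [gint] well defined. The hull [[lo, hi]] contains the boxes of both choices of endpoints;
    points of the hull where [F], [G] and [F - G] are maximal form nets of the generalized box, at
    which moderateness and negligibility can be read off. The difference is then split into a change
    of integrand and a change of endpoints. *)
Lemma itint_indep n (a b : 'rV[gR]_n) (A B A' B' : R -> 'rV[R]_n) (F G : R -> 'rV[R]_n -> R) :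
  (forall j, gle (a 0 j) (b 0 j)) ->
  vmoderate A -> vmoderate B -> vmoderate A' -> vmoderate B' ->
  gvcls A = a -> gvcls A' = a -> gvcls B = b -> gvcls B' = b ->
  rgsf (gbox a b) F -> rgsf (gbox a b) G ->
  (forall x, vmoderate x -> gbox a b (gvcls x) -> negligible (fun e => F e (x e) - G e (x e))) ->
  moderate (fun e => itint (A e) (B e) (F e)) /\
  negligible (fun e => itint (A e) (B e) (F e) - itint (A' e) (B' e) (G e)).
Proof.
move=> ab mA mB mA' mB' Aa A'a Bb B'b gF gG FG.
pose lo e : 'rV[R]_n := \row_j Num.min (Num.min (A e 0 j) (A' e 0 j)) (Num.min (B e 0 j) (B' e 0 j)).
pose hi e : 'rV[R]_n := \row_j Num.max (Num.max (A e 0 j) (A' e 0 j)) (Num.max (B e 0 j) (B' e 0 j)).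
have box e j : [/\ lo e 0 j <= A e 0 j <= hi e 0 j, lo e 0 j <= B e 0 j <= hi e 0 j,
    lo e 0 j <= A' e 0 j <= hi e 0 j & lo e 0 j <= B' e 0 j <= hi e 0 j].
  by rewrite !mxE !ge_min !le_max !lexx ?orbT.
have lohi e j : lo e 0 j <= hi e 0 j.
  by have [/andP[h1 h2] _ _ _] := box e j; exact: le_trans h2.
have msum j : moderate (fun e => `|A e 0 j| + `|A' e 0 j| + (`|B e 0 j| + `|B' e 0 j|)).
  by do 2 apply: moderateD; apply: moderate_norm; [exact: mA|exact: mA'|exact: mB|exact: mB'].
have mlo : vmoderate lo.
  move=> j; apply: moderate_le (msum j) _; apply: nearW => e; rewrite mxE [leRHS]ger0_norm ?addr_ge0//.
  exact: le_trans (norm_min_le _ _) (lerD (norm_min_le _ _) (norm_min_le _ _)).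
have mhi : vmoderate hi.
  move=> j; apply: moderate_le (msum j) _; apply: nearW => e; rewrite mxE [leRHS]ger0_norm ?addr_ge0//.
  exact: le_trans (norm_max_le _ _) (lerD (norm_max_le _ _) (norm_max_le _ _)).
have inbox x : vmoderate x -> (forall e j, lo e 0 j <= x e 0 j <= hi e 0 j) -> gbox a b (gvcls x).
  move=> mx xlh j; rewrite [gvcls x 0 j]mxE.
  apply: (gle_hull (ab j) (mA j) (mB j) (mA' j) (mB' j)) => //; try exact: gvcls_coord.
  by move=> e; have := xlh e j; rewrite !mxE.
have cF e : 0 < e <= 1 -> continuous (F e) by move=> e01; exact/smooth_continuous/gF.1.
have cG e : 0 < e <= 1 -> continuous (G e) by move=> e01; exact/smooth_continuous/gG.1.
have [xF [mxF xFlh xFmax]] := box_max_net mlo mhi lohi cF.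
have [xG [mxG xGlh xGmax]] := box_max_net mlo mhi lohi cG.
have [xD [mxD xDlh xDmax]] := box_max_net mlo mhi lohi (fun e e01 =>
  continuousT_add (cF e e01) (continuousT_opp (cG e e01))).
have mF := rgsf_moderate gF mxF (inbox _ mxF xFlh).
have mG := rgsf_moderate gG mxG (inbox _ mxG xGlh).
have nD := FG _ mxD (inbox _ mxD xDlh).
have sub e x : in_box (A e) (B e) x -> in_box (lo e) (hi e) x.
  move=> xAB j; rewrite min_l// max_r//; have := xAB j.
  have [/andP[? ?] /andP[? ?] _ _] := box e j.
  move=> /andP[]; rewrite ge_min le_max => /orP[] ? /orP[] ?; apply/andP; split; lra.
have mprod : moderate (fun e => \prod_j `|B e 0 j - A e 0 j|).
  by apply: moderate_prod => j; apply: moderate_norm; apply: moderateB; [exact: mB|exact: mA].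
have prod0 e : 0 <= \prod_j `|B e 0 j - A e 0 j| by apply: prodr_ge0 => j _; exact: normr_ge0.
split.
  apply: moderate_le (moderateM (moderate_norm mF) mprod) _.
  apply: filterS near_itv01 => e e01; rewrite [leRHS]ger0_norm ?mulr_ge0//.
  apply: le_itint; first exact: cF.
  by move=> x xAB; apply: xFmax => //; exact: sub.
have E : forall e, 0 < e <= 1 -> itint (A e) (B e) (F e) - itint (A' e) (B' e) (G e) =
    itint (A e) (B e) (fun x => F e x - G e x) + (itint (A e) (B e) (G e) - itint (A' e) (B' e) (G e)).
  by move=> e e01; rewrite itintB; [ring|exact: cF|exact: cG].
have n1 : negligible (fun e => itint (A e) (B e) (fun x => F e x - G e x)).
  apply: negligible_le (negligibleM mprod nD) _.
  apply: filterS near_itv01 => e e01; rewrite normrM (ger0_norm (prod0 e)) mulrC.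
  apply: le_itint; first by have := cF e e01; have := cG e e01 => ? ?; cont.
  by move=> x xAB; apply: xDmax => //; exact: sub.
have n2 : negligible (fun e => itint (A e) (B e) (G e) - itint (A' e) (B' e) (G e)).
  pose eta e := \sum_j (`|A e 0 j - A' e 0 j| + `|B e 0 j - B' e 0 j|).
  pose L e := \sum_j (hi e 0 j - lo e 0 j).
  have eta0 e : 0 <= eta e by apply: sumr_ge0 => j _; rewrite addr_ge0.
  have L0 e : 0 <= L e by apply: sumr_ge0 => j _; rewrite subr_ge0.
  have neta : negligible eta.
    apply: negligible_sum => j; apply: negligibleD.
      have h : negligible (fun e => A e 0 j - A' e 0 j).
        by apply/(gcls_eq (mA j) (mA' j)); rewrite (gvcls_coord _ Aa) (gvcls_coord _ A'a).
      by apply: negligible_le h _; apply: nearW => e; rewrite normr_id.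
    have h : negligible (fun e => B e 0 j - B' e 0 j).
      by apply/(gcls_eq (mB j) (mB' j)); rewrite (gvcls_coord _ Bb) (gvcls_coord _ B'b).
    by apply: negligible_le h _; apply: nearW => e; rewrite normr_id.
  have mL : moderate L by apply: moderate_sum => j; apply: moderateB; [exact: mhi|exact: mlo].
  have mc : moderate (fun e => n%:R * 2 * ((1 + L e) ^+ n * `|G e (xG e)|)).
    apply: moderateM; first exact: moderate_cst.
    apply: moderateM; last exact: moderate_norm.
    by apply: moderateX; apply: moderateD => //; exact: moderate_cst.
  apply: negligible_le (negligibleM mc neta) _.
  apply: filterS near_itv01 => e e01; rewrite [leRHS]ger0_norm; last first.
    by rewrite !mulr_ge0 ?ler0n ?exprn_ge0// addr_ge0.
  apply: le_trans (itint_endpoints (lo := lo e) (hi := hi e) (eta := eta e) (L := L e) (M := `|G e (xG e)|) _ _ _ _ _ _ _) _ => //.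
  - exact: cG.
  - move=> j; rewrite /eta (bigD1 j)//=.
    have : 0 <= \sum_(i < n | i != j) (`|A e 0 i - A' e 0 i| + `|B e 0 i - B' e 0 i|).
      by apply: sumr_ge0 => i _; rewrite addr_ge0.
    have := normr_ge0 (A e 0 j - A' e 0 j); have := normr_ge0 (B e 0 j - B' e 0 j).
    by move=> ? ? ?; split; lra.
  - move=> j; rewrite /L (bigD1 j)//= lerDl; apply: sumr_ge0 => i _.
    by rewrite subr_ge0.
  - by move=> x; exact: xGmax.
  by rewrite le_eqVlt; apply/orP; left; apply/eqP; ring.
apply: negligible_le (negligibleD n1 n2) _.
by apply: filterS near_itv01 => e e01; rewrite E.
Qed.

Lemma gint_eq n (a b : 'rV[gR]_n) (A B : R -> 'rV[R]_n) f F :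
  (forall j, gle (a 0 j) (b 0 j)) -> vmoderate A -> vmoderate B ->
  gvcls A = a -> gvcls B = b -> gsf_net (gbox a b) f F ->
  [/\ gint a b f = gcclass rho (fun e => citint (A e) (B e) (F e)),
    moderate (fun e => itint (A e) (B e) (fun x => complex.Re (F e x))) &
    moderate (fun e => itint (A e) (B e) (fun x => complex.Im (F e x)))].
Proof.
move=> ab mA mB Aa Bb gF; have [F1 F2 fF] := (gsf_netP _ _ _).1 gF.
have mA' := @vmoderate_gvnet _ a; have mB' := @vmoderate_gvnet _ b.
have key G : gsf_net (gbox a b) f G ->
    [/\ gcclass rho (fun e => citint (gvnet a e) (gvnet b e) (G e)) =
      gcclass rho (fun e => citint (A e) (B e) (F e)),
    moderate (fun e => itint (A e) (B e) (fun x => complex.Re (F e x))) &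
    moderate (fun e => itint (A e) (B e) (fun x => complex.Im (F e x)))].
  move=> gG; have [G1 G2 fG] := (gsf_netP _ _ _).1 gG.
  have FG x : vmoderate x -> gbox a b (gvcls x) ->
      gcls (fun e => complex.Re (F e (x e))) = gcls (fun e => complex.Re (G e (x e))) /\
      gcls (fun e => complex.Im (F e (x e))) = gcls (fun e => complex.Im (G e (x e))).
    by move=> mx Xx; have := fF _ mx Xx; rewrite (fG _ mx Xx) !gcclassE => -[-> ->].
  have [m1 n1] := itint_indep ab mA mB mA' mB' Aa (gvnetK a) Bb (gvnetK b) F1 G1
    (fun x mx Xx => (gcls_eq (rgsf_moderate F1 mx Xx) (rgsf_moderate G1 mx Xx)).1 (FG x mx Xx).1).
  have [m2 n2] := itint_indep ab mA mB mA' mB' Aa (gvnetK a) Bb (gvnetK b) F2 G2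
    (fun x mx Xx => (gcls_eq (rgsf_moderate F2 mx Xx) (rgsf_moderate G2 mx Xx)).1 (FG x mx Xx).2).
  have mod_of (u v : R -> R) : moderate u -> negligible (fun e => u e - v e) -> moderate v.
    move=> mu /negligible_moderate nuv; have := moderateB mu nuv.
    by apply: moderate_eq01 => e _; rewrite opprB addrCA subrr addr0.
  have m1' := mod_of _ _ m1 n1; have m2' := mod_of _ _ m2 n2.
  split=> //; rewrite !gcclassE /citint/=; congr Complex; apply/esym.
    exact: (gcls_eq m1 m1').2.
  exact: (gcls_eq m2 m2').2.
have [_ mR mI] := key F gF; split=> //.
(* Either some net [G] was chosen, and [key] compares it with [F], or the default [0] was returned,
   which the existence of [F] excludes. *)
rewrite /gint; case: xgetP => [_ _ [G gG ->]|/(_ (gcclass rho (fun e => citint (gvnet a e) (gvnet b e) (F e))))].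
  by have [] := key G gG.
by move=> /= h; exfalso; apply: h; exists F.
Qed.

End RealGSF.

(** * Fourier inversion and the rate of convergence at a fixed index *)

Section FourierInversion.
Context {R : realType}.

(** The sign in the exponent of a Fourier kernel as a boolean, so that the direct and the inverse
    transform, and both orders of composing them, are handled at once. *)
Definition flip (V : zmodType) (b : bool) (v : V) : V := if b then - v else v.

Lemma kernn_flip n b (h : R) (z : 'rV[R]_n) : kernn h (flip b z) = kernn h z.
Proof. by case: b; rewrite /flip// kernnN. Qed.

Lemma dotv_flip n b (x y : 'rV[R]_n) : dotv x (flip b y) = dotv (flip b x) y.
Proof. by case: b; rewrite /flip// dotvNl dotvC dotvNl dotvC. Qed.

Lemma continuous_flip n b : continuous (flip b : 'rV[R]_n -> 'rV[R]_n).
Proof.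
case: b; rewrite /flip; last exact: continuousT_id.
by move=> x; apply: (@cvgN R 'rV[R]_n 'rV[R]_n (nbhs x) _ id x); exact: cvg_id.
Qed.

Lemma wave_opp m n (a b : 'rV[R]_m) (lam : 'rV[R]_m -> 'rV[R]_n) p q x :
  continuous lam -> continuous p -> continuous q ->
  wave a b lam (fun u => - p u) (fun u => - q u) x = - wave a b lam p q x.
Proof.
move=> cl cp cq; rewrite -itintN; last exact: continuous_wave_integrand.
by apply: eq_itint => u; rewrite !mulNr opprD.
Qed.

(** The left side is the real part of two successive transforms of [u + i v], with [c1] and [c2]
    sharing the normalization. The phases combine into [(y - x) . w]; after Fubini the sine part
    integrates to [0] and the cosine part is the kernel. The imaginary part is the case
    [(v, - u)]. *)
Lemma fourier_inversion n (b : bool) (A B y : 'rV[R]_n) (h c1 c2 : R) u v :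
  c1 * c2 = (2 * pi) ^- n -> continuous u -> continuous v ->
  wave (const_mx (- h)) (const_mx h) (flip (~~ b))
    (fun w => c2 * wave A B (flip b) (fun x => c1 * u x) (fun x => - (c1 * v x)) w)
    (fun w => - (c2 * wave A B (flip b) (fun x => c1 * v x) (fun x => c1 * u x) w)) y =
  itint A B (fun x => kernn h (y - x) * u x).
Proof.
move=> c12 cu cv; set c := (2 * pi) ^- n in c12.
have cfl b' : continuous (flip b' : 'rV[R]_n -> 'rV[R]_n) by exact: continuous_flip.
pose Phi (z : 'rV[R]_n * 'rV[R]_n) := c * (u z.1 * cos (dotv (y - z.1) (flip (~~ b) z.2)) -
  v z.1 * sin (dotv (y - z.1) (flip (~~ b) z.2))).
have cyx : continuous (fun x : 'rV[R]_n => y - x).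
  by move=> x; apply: (@cvgB R 'rV[R]_n 'rV[R]_n (nbhs x) _ (fun=> y) id y x); [exact: cvg_cst|exact: cvg_id].
have cPhi : continuous Phi.
  have cd : continuous (fun z : 'rV[R]_n * 'rV[R]_n => dotv (y - z.1) (flip (~~ b) z.2)).
    apply: continuousT_dotv.
      by refine (@continuousT_comp _ _ _ fst _ _ cyx); cont.
    by refine (@continuousT_comp _ _ _ snd _ _ (cfl (~~ b))); cont.
  have cu1 : continuous (fun z : 'rV[R]_n * 'rV[R]_n => u z.1).
    by refine (@continuousT_comp _ _ _ fst u _ cu); cont.
  have cv1 : continuous (fun z : 'rV[R]_n * 'rV[R]_n => v z.1).
    by refine (@continuousT_comp _ _ _ fst v _ cv); cont.
  by rewrite /Phi; cont.
have cPhil w : continuous (fun x => Phi (x, w)).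
  by refine (@continuousT_comp _ _ _ (fun x => (x, w)) Phi _ cPhi); cont.
transitivity (itint (const_mx (- h)) (const_mx h) (fun w => itint A B (fun x => Phi (x, w)))).
  apply: eq_itint => w; set th := dotv y _.
  have cP : continuous (fun x => c1 * u x * cos (dotv w (flip b x)) + - (c1 * v x) * sin (dotv w (flip b x))).
    by apply: continuous_wave_integrand; [exact: cfl|cont|cont].
  have cQ : continuous (fun x => c1 * v x * cos (dotv w (flip b x)) + c1 * u x * sin (dotv w (flip b x))).
    by apply: continuous_wave_integrand; [exact: cfl|cont|cont].
  rewrite [c2 * _ * _]mulrAC -[- (c2 * _)]mulNr [- c2 * _ * _]mulrAC /wave -!itintZ//.
  rewrite -itintD; last 2 first.
  - by refine (@continuousT_mul _ _ (fun=> _) _ _ cP); cont.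
  - by refine (@continuousT_mul _ _ (fun=> _) _ _ cQ); cont.
  apply: eq_itint => x; rewrite /Phi/= dotvBl -/th -c12.
  have -> : dotv x (flip (~~ b) w) = - dotv w (flip b x).
    by rewrite [dotv w _]dotvC dotv_flip; case: (b) => /=; rewrite /flip ?dotvNl ?opprK// dotvC dotvNl dotvC.
  by rewrite opprK cosD sinD; ring.
rewrite -itint_itint//; apply: eq_itint => x; rewrite /Phi/=.
have Ew w : dotv (y - x) (flip (~~ b) w) = dotv (flip (~~ b) (y - x)) w by rewrite dotv_flip.
have [_ S0] := itint_cos_sin h (flip (~~ b) (y - x)).
have cc : continuous (fun w : 'rV[R]_n => cos (dotv (flip (~~ b) (y - x)) w)).
  by cont; apply: continuousT_dotv; cont.
have cs : continuous (fun w : 'rV[R]_n => sin (dotv (flip (~~ b) (y - x)) w)).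
  by cont; apply: continuousT_dotv; cont.
rewrite (@eq_itint _ _ _ _ _ (fun w => c * u x * cos (dotv (flip (~~ b) (y - x)) w) +
    - (c * v x) * sin (dotv (flip (~~ b) (y - x)) w))); last by move=> w; rewrite Ew; ring.
rewrite itintD ?itintZ//; [|cont|cont].
by rewrite S0 mulr0 addr0 mulrAC -kernn_fourier kernn_flip.
Qed.

(** In this form the smoothness of the kernel and the moderateness of its derivatives are instances
    of [rgsf_wave]. *)
Lemma kernn_wave n (h : R) (y x : 'rV[R]_n) : kernn h (y - x) =
  wave (const_mx (- h)) (const_mx h) id (fun w => (2 * pi) ^- n * cos (dotv y w))
    (fun w => (2 * pi) ^- n * sin (dotv y w)) x.
Proof.
rewrite kernn_fourier -itintZ; last by cont; apply: continuousT_dotv; cont.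
by apply: eq_itint => w; rewrite dotvBl cosB; ring.
Qed.

Lemma oint_kern (h a b : R) : oint a b (kern h) = kernI h b - kernI h a.
Proof.
have dk (t : R) : is_derive t 1 (fun t => kernI h (t - 0)) (kern h t).
  by have := is_derive_kernI h 0 t; rewrite sub0r kernN.
rewrite (oint_FTC _ _ dk) ?subr0//.
by apply: (@continuousT_kern _ _ h (fun t => t)); cont.
Qed.

(** With [T = N + q + n], the cut is at [tau = r ^ (T + 3 + p)] and the distance to the faces is
    [r ^ p]. The exponent required of [h] makes each of the three terms of [c] at most
    [r ^ (T + 2)], so [c <= r ^ T]. Multiplication by [M = r ^ (- N)] and by [2 ^ n <= r ^ (- n)]
    leaves [r ^ q]. *)
Lemma kernn_rate (r h : R) n (N N' p q : nat) (a b y : 'rV[R]_n) f :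
  0 < r -> r <= 2^-1 -> r ^- (N' + 2 * (N + q + n) + 6 + 2 * p) <= h ->
  (forall j, a 0 j + r ^+ p <= y 0 j /\ y 0 j + r ^+ p <= b 0 j) ->
  (forall j, b 0 j - a 0 j <= r ^- N') -> smooth f ->
  (forall s, subseq s (enum 'I_n) -> forall x, in_box a b x -> `|partials s f x| <= r ^- N) ->
  `|itint a b (fun x => kernn h (y - x) * f x) - f y| <= r ^+ q.
Proof.
move=> r0 r2; set T := (N + q + n)%N; set P := (_ + _)%N => Ph yab abl sf fM.
have r1 : r <= 1 by lra.
have rX i : 0 < r ^+ i by rewrite exprn_gt0.
have rV i : 0 < r ^- i by rewrite invr_gt0.
have h0 : 0 < h by exact: lt_le_trans Ph.
have hV : h^-1 <= r ^+ P by rewrite -[leRHS]invrK lef_pV2 ?posrE.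
have tp : r ^+ (T + 3 + p) <= r ^+ p by apply: gauge_exp_le => //; lia.
have [_ +] := kernn_estimate h0 (rX _) tp yab abl (ltW (rV N')) sf fM.
set c := _ + _ + _ => key.
have half i : 2 * r ^+ i.+1 <= r ^+ i.
  by rewrite exprS mulrA ler_piMl ?(ltW (rX i))//; lra.
have ge i j : (i <= j)%N -> r ^+ j <= r ^+ i by exact: gauge_exp_le.
have c1 : 2 / (h * r ^+ p) <= r ^+ (T + 2).
  rewrite invfM.
  have : h^-1 * r ^- p <= r ^+ (T + 3).
    rewrite -[leRHS](mulfK (lt0r_neq0 (rX p))); apply: ler_wpM2r; first exact: ltW (rV p).
    apply: le_trans hV _; rewrite -exprD; apply: ge; rewrite /P; lia.
  by have := half (T + 2)%N; rewrite -addnS; lra.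
have c2 : 2 * r ^+ (T + 3 + p) <= r ^+ (T + 2).
  apply: le_trans (half (T + 2)%N); rewrite ler_wpM2l//; apply: ge; lia.
have c3 : r ^- N' / (h * r ^+ (T + 3 + p)) <= r ^+ (T + 2).
  rewrite invfM mulrCA -[leRHS](mulfK (lt0r_neq0 (rX (N' + (T + 3 + p)))))%N.
  have -> : r ^- (N' + (T + 3 + p)) = r ^- N' / r ^+ (T + 3 + p) by rewrite exprD invfM.
  apply: ler_wpM2r; first exact: mulr_ge0 (ltW (rV _)) (ltW (rV _)).
  apply: le_trans hV _; rewrite -exprD; apply: ge; rewrite /P; lia.
have cT : c <= r ^+ T.
  have := half T; have := half T.+1; have := rX T.+2.
  by move: c1 c2 c3; rewrite /c !addnS !addn0; lra.
have c0 : 0 <= c.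
  have hp := mulr_gt0 h0 (rX p); have hp' := mulr_gt0 h0 (rX (T + 3 + p)%N).
  by rewrite /c addr_ge0 ?addr_ge0 ?divr_ge0 ?mulr_ge0// ltW.
(* The error is linear in [c], uniformly for [c <= 1]; the crude constant [2 ^ n] is paid by [n]
   powers of [r]. *)
have pw : (1 + c) ^+ n - 1 <= c * 2 ^+ n.
  have c01 : c <= 1 by apply: le_trans cT _; rewrite exprn_ile1// ltW.
  elim: (n) => [|i IH]; first by rewrite !expr0 subrr mulr1.
  have : (1 + c) ^+ i <= 2 ^+ i by apply: lerXn2r; rewrite ?nnegrE; lra.
  rewrite !exprS => h1; have := ler_wpM2l c0 h1; move: IH; set X := (1 + c) ^+ i.
  by set Y := 2 ^+ i; lra.
apply: le_trans key _; apply: le_trans (ler_wpM2l (ltW (rV N)) pw) _.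
apply: (@le_trans _ _ (r ^- N * (r ^+ T * r ^- n))).
  apply: ler_wpM2l; first exact: ltW (rV N).
  apply: ler_pM; rewrite ?exprn_ge0// -exprVn.
  apply: lerXn2r; rewrite ?nnegrE ?invr_ge0 ?(ltW r0)//.
  by rewrite -[leLHS]invrK lef_pV2 ?posrE.
by rewrite /T !exprD mulfK ?lt0r_neq0// mulrA mulVf ?mul1r// lt0r_neq0.
Qed.

End FourierInversion.

(** * Dirichlet kernels and plane waves as generalized smooth functions *)

Section DirichletGSF.
Context {R : realType} {rho : gauge R}.
Local Notation moderate := (Defs.moderate rho).
Local Notation negligible := (Defs.negligible rho).
Local Notation gcls := (gcls rho).
Local Notation gR := (gR rho).
Local Notation gC := (gC rho).
Local Notation gvcls := (gvcls rho).
Local Notation vmoderate := (vmoderate rho).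

Lemma moderate_le1 (x : R -> R) : (forall e, `|x e| <= 1) -> moderate x.
Proof.
by move=> x1; apply: moderate_le (moderate_cst 1) _; apply: nearW => e; rewrite normr1.
Qed.

Lemma vmoderate_bound n (x : R -> 'rV[R]_n) : vmoderate x ->
  exists N : nat, \forall e \near 0^'+, forall j, `|x e 0 j| <= rho e ^- N.
Proof.
move=> mx; have [N hN] : moderate (fun e => \sum_j `|x e 0 j|).
  by apply: moderate_sum => j; exact: moderate_norm.
exists N; apply: filterS hN => e; rewrite ger0_norm ?sumr_ge0// => h j.
by apply: le_trans h; rewrite (bigD1 j)//= lerDl sumr_ge0.
Qed.

Lemma gvclsB n (x y : R -> 'rV[R]_n) : vmoderate x -> vmoderate y ->
  gvcls (fun e => x e - y e) = gvcls x - gvcls y.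
Proof.
move=> mx my; apply/rowP => j; rewrite !mxE -gclsB; [|exact: mx|exact: my].
by congr Defs.gcls; apply/funext => e; rewrite !mxE.
Qed.

Lemma vmoderateB n (x y : R -> 'rV[R]_n) : vmoderate x -> vmoderate y ->
  vmoderate (fun e => x e - y e).
Proof.
move=> mx my j; apply: moderate_eq01 (moderateB (mx j) (my j)) => e _.
by rewrite !mxE.
Qed.

Lemma vmoderate0 n : vmoderate (fun=> 0 : 'rV[R]_n).
Proof. by move=> j; apply: moderate_eq01 (moderate_cst 0) => e _; rewrite mxE. Qed.

Lemma gvcls0 n : gvcls (fun=> 0 : 'rV[R]_n) = 0.
Proof.
by apply/rowP => j; rewrite !mxE -[RHS]gcls0.
Qed.

Lemma vmoderate_const n (x : R -> R) : moderate x -> vmoderate (fun e => const_mx (x e) : 'rV[R]_n).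
Proof. by move=> mx j; apply: moderate_eq01 mx => e _; rewrite mxE. Qed.

Lemma gvcls_const n (x : R -> R) : gvcls (fun e => const_mx (x e) : 'rV[R]_n) = const_mx (gcls x).
Proof.
by apply/rowP => j; rewrite !mxE; congr Defs.gcls; apply/funext => e; rewrite mxE.
Qed.

Lemma moderate_kern (eta x : R -> R) : moderate eta -> moderate (fun e => kern (eta e) (x e)).
Proof.
move=> me; apply: moderateM; first by apply: moderateM => //; exact: moderate_cst.
by apply: moderate_le1 => e; exact: norm_sinc_le1.
Qed.

Lemma dirichlet_gcls n (eta : R -> R) (z : R -> 'rV[R]_n) : moderate eta -> vmoderate z ->
  dirichlet (gcls eta) (gvcls z) = gcls (fun e => kernn (eta e) (z e)).
Proof.
move=> me mz; rewrite /dirichlet /kernn gcls_prod; last by move=> j; exact: moderate_kern.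
apply: eq_bigr => j _; have [_ ->] := @gconst_unit _ rho pi (lt0r_neq0 (pi_gt0 R)).
rewrite mxE -(gclsM me (mz j)) /gsinc (gcls_lip sinc_lip norm_sinc_le1 (moderateM me (mz j))).
rewrite /gconst -gclsM//; last exact: moderate_cst.
rewrite -gclsM//; last by apply: moderate_le1 => e; exact: norm_sinc_le1.
by apply: moderateM => //; exact: moderate_cst.
Qed.

Lemma norm_2piV_le1 n : 0 <= ((2 * pi) ^- n : R) <= 1.
Proof.
have p2 := @pi_ge2 R; rewrite invr_ge0 exprn_ge0/= ?invf_le1 ?exprn_gt0 ?exprn_ege1//; lra.
Qed.

Lemma rgsf_kernn n (X : set 'rV[gR]_n) (eta : R -> R) (y : R -> 'rV[R]_n) : moderate eta ->
  rgsf X (fun e x => kernn (eta e) (y e - x)).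
Proof.
move=> [N hN]; apply: rgsf_eq (fun e x => esym (kernn_wave (eta e) (y e) x)).
(* The edges of the frequency cube have length [2 |eta|]; the extra power absorbs the [2]. *)
apply: (@rgsf_wave _ _ _ _ _ _ _ _ _ _ N.+1).
- move=> e _; split; [exact: continuousT_id|..];
    by cont; apply: continuousT_dotv; cont.
- near=> e.
  have [r0 r1 r2] : [/\ 0 < rho e, rho e <= 1 & rho e <= 2^-1] by near: e; exact: gauge_half.
  have hNe : `|eta e| <= rho e ^- N by near: e.
  have rN : rho e ^- N <= rho e ^- N.+1 by exact: gauge_expV_le.
  have rN1 : 1 <= rho e ^- N.+1.
    by have := gauge_expV_le r0 r1 (leq0n N.+1); rewrite expr0 invr1.
  have /andP[c0 c1] := norm_2piV_le1 n.
  have bd t : `|t| <= 1 -> `|(2 * pi) ^- n * t| <= rho e ^- N.+1.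
    move=> t1; apply: le_trans rN1; rewrite normrM (ger0_norm c0) -[leRHS]mulr1.
    exact: ler_pM.
  move=> u uab; split; [exact/bd/norm_cos_le1|exact/bd/norm_sin_le1|].
  move=> j; apply: le_trans rN; apply: le_trans hNe.
  have := uab j; rewrite !mxE => /andP[]; rewrite ge_min le_max ler_norml.
  have := ler_norm (eta e); have := ler_norm (- eta e); rewrite normrN.
  by move=> ? ? /orP[] ? /orP[] ?; apply/andP; split; lra.
- near=> e.
  have [r0 r1 r2] : [/\ 0 < rho e, rho e <= 1 & rho e <= 2^-1] by near: e; exact: gauge_half.
  have hNe : `|eta e| <= rho e ^- N by near: e.
  move=> j; rewrite !mxE opprK -mulr2n -mulr_natl normrM ger0_norm// exprS invfM ler_pM//.
  by rewrite -[leLHS]invrK lef_pV2 ?posrE.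
Unshelve. all: by end_near. Qed.

Lemma gsf_dirichlet n (X : set 'rV[gR]_n) (eta : R -> R) (y : R -> 'rV[R]_n) :
  moderate eta -> vmoderate y ->
  gsf_net X (fun x => dirichletC (gcls eta) (gvcls y - x))
    (fun e x => Complex (kernn (eta e) (y e - x)) 0).
Proof.
move=> me my; apply/gsf_netP; split=> /=; [exact: rgsf_kernn|exact: rgsf0|].
move=> x mx _; rewrite /dirichletC -gvclsB// dirichlet_gcls//; last exact: vmoderateB.
by rewrite gcclassE /= gcls0.
Qed.

(** Evenness of the kernel, checked on representatives; it turns a convolution at [0] into an
    integral against the kernel. *)
Lemma dirichletC_sub0 n (h : gR) (x : 'rV[gR]_n) : dirichletC h (0 - x) = dirichletC h x.
Proof.
have mh := moderate_gnet h; have mx := vmoderate_gvnet x; have m0 := @vmoderate0 n.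
have E : 0 - x = gvcls (fun e => 0 - gvnet x e) by rewrite gvclsB// gvcls0 gvnetK.
have E1 : dirichlet h (0 - x) = gcls (fun e => kernn (gnet h e) (0 - gvnet x e)).
  by rewrite E -[h in LHS]gnetK (dirichlet_gcls mh (vmoderateB m0 mx)).
have E2 : dirichlet h x = gcls (fun e => kernn (gnet h e) (gvnet x e)).
  by rewrite -[h in LHS]gnetK -[x in LHS]gvnetK (dirichlet_gcls mh mx).
rewrite /dirichletC E1 E2; congr (gRtoC (Defs.gcls _ _)).
by apply/funext => e; rewrite sub0r kernnN.
Qed.

Lemma gdot_gvcls n (x w : R -> 'rV[R]_n) : vmoderate x -> vmoderate w ->
  gdot (gvcls x) (gvcls w) = gcls (fun e => dotv (x e) (w e)).
Proof.
move=> mx mw; rewrite gcls_sum; last by move=> j; exact: moderateM.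
by apply: eq_bigr => j _; rewrite !mxE gclsM.
Qed.

Lemma gexpi_gcls (t : R -> R) : moderate t ->
  gexpi (gcls t) = gcclass rho (fun e => Complex (cos (t e)) (sin (t e))).
Proof.
move=> mt; rewrite /gexpi gcclassE/=.
by rewrite (gcls_lip cos_lip norm_cos_le1 mt) (gcls_lip sin_lip norm_sin_le1 mt).
Qed.

Lemma gexpi0 : gexpi (0 : gR) = 1.
Proof.
rewrite -gcls0 gexpi_gcls; last exact: moderate_cst.
by rewrite gcclassE /= cos0 sin0 gcls1 gcls0.
Qed.

Lemma moderate_dotv n (x w : R -> 'rV[R]_n) : vmoderate x -> vmoderate w ->
  moderate (fun e => dotv (x e) (w e)).
Proof. by move=> mx mw; apply: moderate_sum => j; exact: moderateM. Qed.

Lemma rgsf_plane n (X : set 'rV[gR]_n) (w : R -> 'rV[R]_n) (p q : R) : vmoderate w ->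
  rgsf X (fun e x => p * cos (dotv x (w e)) + q * sin (dotv x (w e))).
Proof.
move=> /vmoderate_bound[N1 h1].
have [N2 h2] := moderate_cst (rho := rho) p; have [N3 h3] := moderate_cst (rho := rho) q.
(* A plane wave is a wave over a space of dimension [0], where the iterated integral is evaluation
   at the only point. *)
apply: (rgsf_eq (F := fun e => wave (0 : 'rV_0) 0 (fun=> w e) (fun=> p) (fun=> q))); last by [].
apply: (@rgsf_wave _ _ _ _ _ _ _ _ _ _ (N1 + N2 + N3)%N).
- by move=> e _; split; exact: continuousT_cst.
- near=> e.
  have [r0 r1 r2] : [/\ 0 < rho e, rho e <= 1 & rho e <= 2^-1] by near: e; exact: gauge_half.
  have h1e : forall j, `|w e 0 j| <= rho e ^- N1 by near: e.
  have h2e : `|p| <= rho e ^- N2 by near: e.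
  have h3e : `|q| <= rho e ^- N3 by near: e.
  move=> u _; split; [apply: le_trans h2e _|apply: le_trans h3e _|move=> j; apply: le_trans (h1e j) _];
    apply: gauge_expV_le => //; lia.
- by apply: nearW => e -[].
Unshelve. all: by end_near. Qed.

Lemma gsf_expi n (X : set 'rV[gR]_n) (w : R -> 'rV[R]_n) : vmoderate w ->
  gsf_net X (fun x => gexpi (gdot x (gvcls w)))
    (fun e x => Complex (cos (dotv x (w e))) (sin (dotv x (w e)))).
Proof.
move=> mw; apply/gsf_netP; split=> /=.
- by apply: rgsf_eq (rgsf_plane X 1 0 mw) _ => e x; rewrite mul1r mul0r addr0.
- by apply: rgsf_eq (rgsf_plane X 0 1 mw) _ => e x; rewrite mul1r mul0r add0r.
- by move=> x mx _; rewrite gdot_gvcls// gexpi_gcls//; exact: moderate_dotv.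
Qed.

End DirichletGSF.

(** * Limits of convolutions with the Dirichlet kernel *)

Section Limits.
Context {R : realType} {rho : gauge R}.
Local Notation moderate := (Defs.moderate rho).
Local Notation negligible := (Defs.negligible rho).
Local Notation gcls := (gcls rho).
Local Notation gR := (gR rho).
Local Notation gC := (gC rho).
Local Notation gvcls := (gvcls rho).
Local Notation vmoderate := (vmoderate rho).
Implicit Types (k h : gR).

(** The chosen representative of [k >= 0] may be negative at some indices. Its absolute value is
    again a representative, and the cube it spans is correctly ordered everywhere. *)
Definition absnet (k : gR) (e : R) : R := `|gnet k e|.

Lemma absnet_ge0 k e : 0 <= absnet k e. Proof. exact: normr_ge0. Qed.

Lemma moderate_absnet k : moderate (absnet k).
Proof. exact/moderate_norm/moderate_gnet. Qed.

Lemma absnetK k : gle 0 k -> gcls (absnet k) = k.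
Proof.
move=> k0; rewrite -[RHS]gnetK; apply/gcls_eq; [exact: moderate_absnet|exact: moderate_gnet|].
have {}k0 : forall m : nat, \forall e \near 0^'+, 0 <= gnet k e + rho e ^+ m.
  by apply/(gle_gcls (moderate_cst 0) (moderate_gnet k)); rewrite gcls0 gnetK.
move=> m; near=> e.
have [r0 r1 r2] : [/\ 0 < rho e, rho e <= 1 & rho e <= 2^-1] by near: e; exact: gauge_half.
have h : 0 <= gnet k e + rho e ^+ m.+1 by near: e; exact: k0.
have h4 : rho e ^+ m.+1 <= 2^-1 * rho e ^+ m by rewrite exprS ler_wpM2r// exprn_ge0// ltW.
rewrite /absnet; have [g0|g0] := ler0P (gnet k e); last by rewrite subrr normr0 exprn_ge0// ltW.
by rewrite ger0_norm; lra.
Unshelve. all: by end_near. Qed.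

Lemma gle_oppK k : gle 0 k -> gle (- k) k.
Proof.
move=> k0; rewrite -(absnetK k0) -gclsN; last exact: moderate_absnet.
apply: gle_near; [exact/moderateN/moderate_absnet|exact: moderate_absnet|].
by apply: nearW => e; have := absnet_ge0 k e; lra.
Qed.

Definition cubel n (k : gR) (e : R) : 'rV[R]_n := const_mx (- absnet k e).
Definition cuber n (k : gR) (e : R) : 'rV[R]_n := const_mx (absnet k e).

Lemma vmoderate_cubel n k : vmoderate (@cubel n k).
Proof. exact/vmoderate_const/moderateN/moderate_absnet. Qed.

Lemma vmoderate_cuber n k : vmoderate (@cuber n k).
Proof. exact/vmoderate_const/moderate_absnet. Qed.

Lemma gvcls_cubel n k : gle 0 k -> gvcls (@cubel n k) = const_mx (- k).
Proof. by move=> k0; rewrite gvcls_const gclsN ?absnetK//; exact: moderate_absnet. Qed.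

Lemma gvcls_cuber n k : gle 0 k -> gvcls (@cuber n k) = const_mx k.
Proof. by move=> k0; rewrite gvcls_const absnetK. Qed.

Lemma in_box_cubeP n k e (x : 'rV[R]_n) : in_box (cubel n k e) (cuber n k e) x <->
  forall j, - absnet k e <= x 0 j <= absnet k e.
Proof.
have h := absnet_ge0 k e.
by split=> xlh j; have := xlh j; rewrite !mxE min_l ?max_r//; lra.
Qed.

Lemma cube_mem n k (x : R -> 'rV[R]_n) : gle 0 k -> vmoderate x ->
  (\forall e \near 0^'+, forall j, - absnet k e <= x e 0 j <= absnet k e) ->
  gcube n (- k) k (gvcls x).
Proof.
move=> k0 mx xk j; rewrite !mxE -(absnetK k0) -gclsN; last exact: moderate_absnet.
split; apply: gle_near => //; try exact: moderate_absnet; try exact/moderateN/moderate_absnet.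
  by apply: filterS xk => e /(_ j)/andP[].
by apply: filterS xk => e /(_ j)/andP[].
Qed.

Lemma gcubint_eq n k f F : gle 0 k -> gsf_net (gcube n (- k) k) f F ->
  [/\ gcubint (- k) k f = gcclass rho (fun e => citint (cubel n k e) (cuber n k e) (F e)),
    moderate (fun e => itint (cubel n k e) (cuber n k e) (fun x => complex.Re (F e x))) &
    moderate (fun e => itint (cubel n k e) (cuber n k e) (fun x => complex.Im (F e x)))].
Proof.
move=> k0 gF; apply: gint_eq => //.
- by move=> j; rewrite !mxE; exact: gle_oppK.
- exact: vmoderate_cubel.
- exact: vmoderate_cuber.
- exact: gvcls_cubel.
- exact: gvcls_cuber.
Qed.

Lemma cube_sup n k F s : gle 0 k -> rgsf (gcube n (- k) k) F -> sorted ord_leq s ->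
  exists N : nat, \forall e \near 0^'+, forall x, in_box (cubel n k e) (cuber n k e) x ->
    `|partials s (F e) x| <= rho e ^- N.
Proof.
move=> k0 gF ss.
have cF e : 0 < e <= 1 -> continuous (partials s (F e)).
  by move=> e01; exact/smooth_continuous/smooth_partials/gF.1.
have lohi e j : cubel n k e 0 j <= cuber n k e 0 j.
  by rewrite !mxE; have := absnet_ge0 k e; lra.
have [x [mx xlh xmax]] := box_max_net (@vmoderate_cubel n k) (@vmoderate_cuber n k) lohi cF.
have xK : gcube n (- k) k (gvcls x).
  by apply: cube_mem => //; apply: nearW => e j; have := xlh e j; rewrite !mxE.
have [N hN] := gF.2 x mx xK s ss.
exists N; apply: filterS2 near_itv01 hN => e e01 h x' x'k; apply: le_trans h.
exact: xmax.
Qed.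

Lemma cube_sup_all n k F : gle 0 k -> rgsf (gcube n (- k) k) F ->
  exists N : nat, \forall e \near 0^'+, forall s, subseq s (enum 'I_n) ->
    forall x, in_box (cubel n k e) (cuber n k e) x -> `|partials s (F e) x| <= rho e ^- N.
Proof.
move=> k0 gF.
(* Subsequences of the enumeration are given by masks, which form a finite type; a common exponent
   is the maximum over all masks. *)
have H (m : n.-tuple bool) := cube_sup k0 gF (sorted_subseq_enum (mask_subseq m (enum 'I_n))).
have [N hN] := choice H.
exists (\max_m N m)%N; near=> e.
have [r0 r1 r2] : [/\ 0 < rho e, rho e <= 1 & rho e <= 2^-1] by near: e; exact: gauge_half.
have hNe : forall m : n.-tuple bool, forall x, in_box (cubel n k e) (cuber n k e) x ->
    `|partials (mask m (enum 'I_n)) (F e) x| <= rho e ^- N m.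
  by near: e; apply: filter_forall.
move=> s /subseqP[m sm ->] x xk; rewrite size_enum_ord in sm.
have := hNe (Tuple (introT eqP sm)) x xk => /= h; apply: le_trans h _.
by apply: gauge_expV_le => //; exact: leq_bigmax.
Unshelve. all: by end_near. Qed.

Lemma conv_value n k (eta : R -> R) (y : R -> 'rV[R]_n) f F :
  gle 0 k -> moderate eta -> vmoderate y -> gsf_net (gcube n (- k) k) f F ->
  let Ire e := itint (cubel n k e) (cuber n k e)
    (fun x => kernn (eta e) (y e - x) * complex.Re (F e x)) in
  let Iim e := itint (cubel n k e) (cuber n k e)
    (fun x => kernn (eta e) (y e - x) * complex.Im (F e x)) in
  [/\ dirichlet_conv (gcls eta) k f (gvcls y) = Complex (gcls Ire) (gcls Iim),
    moderate Ire & moderate Iim].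
Proof.
move=> k0 me my gF Ire Iim.
have [] := gcubint_eq k0 (gsf_netM (gsf_dirichlet (gcube n (- k) k) me my) gF).
have EI : (fun e => itint (cubel n k e) (cuber n k e) (fun x =>
    kernn (eta e) (y e - x) * complex.Re (F e x) - 0 * complex.Im (F e x))) = Ire.
  by apply/funext => e; apply: eq_itint => x; rewrite mul0r subr0.
have EJ : (fun e => itint (cubel n k e) (cuber n k e) (fun x =>
    kernn (eta e) (y e - x) * complex.Im (F e x) + 0 * complex.Re (F e x))) = Iim.
  by apply/funext => e; apply: eq_itint => x; rewrite mul0r addr0.
by rewrite gcclassE /citint /= EI EJ.
Qed.

(** The order yields an inequality of representatives only up to an error, here [1]. The spare power
    covers it, since [rho ^ (- P - 1) >= 2 rho ^ (- P)] and [rho ^ (- P) >= 1]. *)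
Lemma gle_rhoV P (h : gR) : gle (gcls (fun e => rho e ^- P.+1)) h ->
  \forall e \near 0^'+, rho e ^- P <= gnet h e.
Proof.
rewrite -[h in gle _ h]gnetK => /(gle_gcls (moderate_rhoV P.+1) (moderate_gnet h)).1 /(_ 0%N) hP.
near=> e.
have [r0 r1 r2] : [/\ 0 < rho e, rho e <= 1 & rho e <= 2^-1] by near: e; exact: gauge_half.
have h1 : rho e ^- P.+1 <= gnet h e + rho e ^+ 0 by near: e.
rewrite expr0 exprS invfM in h1.
have P1 : 1 <= rho e ^- P.
  by have := gauge_expV_le r0 r1 (leq0n P); rewrite [rho e ^+ 0]expr0 invr1.
have r2' : 2 <= (rho e)^-1 by rewrite -[leLHS]invrK lef_pV2 ?posrE.
have := ler_wpM2r (le_trans ler01 P1) r2'; lra.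
Unshelve. all: by end_near. Qed.

(** The distance [rho ^ p] of [y] to the faces keeps the peak of the kernel inside the cube, and
    enters the rate as the parameter [s] of [kernn_estimate]. *)
Lemma conv_limit n k (y : R -> 'rV[R]_n) f F p :
  gle 0 k -> vmoderate y -> gsf_net (gcube n (- k) k) f F ->
  (\forall e \near 0^'+, forall j, - absnet k e + rho e ^+ p <= y e 0 j /\
    y e 0 j + rho e ^+ p <= absnet k e) ->
  glim (fun h => dirichlet_conv h k f (gvcls y)) (f (gvcls y)).
Proof.
move=> k0 my gF yk q.
have [F1 F2 fF] := (gsf_netP _ _ _).1 gF.
have yK : gcube n (- k) k (gvcls y).
  apply: cube_mem => //; apply: filterS2 gauge_half yk => e [r0 _ _] h j.
  have [? ?] := h j; have := exprn_gt0 p r0; move=> ?; apply/andP; split; lra.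
have [N1 h1] := cube_sup_all k0 F1; have [N2 h2] := cube_sup_all k0 F2.
have [N' hN'] := moderate_absnet k.
(* [N'.+1] accounts for the edge length [2 |k|] and [q.+2] for [gcabs_le]; [P1] serves the real part
   and [P2] the imaginary part. *)
pose P1 := (N'.+1 + 2 * (N1 + q.+2 + n) + 6 + 2 * p)%N.
pose P2 := (N'.+1 + 2 * (N2 + q.+2 + n) + 6 + 2 * p)%N.
exists (gcls (fun e => rho e ^- (P1 + P2).+1)) => h /gle_rhoV hP.
rewrite -[h]gnetK; have [-> m1 m2] := conv_value k0 (moderate_gnet h) my gF.
rewrite (fF _ my yK) gcclassE.
have mR := rgsf_moderate F1 my yK; have mI := rgsf_moderate F2 my yK.
set I1 := fun e => itint _ _ _ in m1 *; set I2 := fun e => itint _ _ _ in m2 *.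
have -> : Complex (gcls I1) (gcls I2) - Complex (gcls (fun e => complex.Re (F e (y e))))
    (gcls (fun e => complex.Im (F e (y e)))) =
    Complex (gcls (fun e => I1 e - complex.Re (F e (y e)))) (gcls (fun e => I2 e - complex.Im (F e (y e)))) :> gC.
  by rewrite !gclsB.
apply: gcabs_le; [exact: moderateB|exact: moderateB|].
near=> e.
have [r0 r1 r2] : [/\ 0 < rho e, rho e <= 1 & rho e <= 2^-1] by near: e; exact: gauge_half.
have e01 : 0 < e <= 1 by near: e; exact: near_itv01.
have hPe : rho e ^- (P1 + P2) <= gnet h e by near: e.
have yke : forall j, - absnet k e + rho e ^+ p <= y e 0 j /\ y e 0 j + rho e ^+ p <= absnet k e.
  by near: e.
have yab j : cubel n k e 0 j + rho e ^+ p <= y e 0 j /\ y e 0 j + rho e ^+ p <= cuber n k e 0 j.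
  by rewrite !mxE.
have hNe : `|absnet k e| <= rho e ^- N' by near: e.
have abl j : cuber n k e 0 j - cubel n k e 0 j <= rho e ^- N'.+1.
  rewrite !mxE opprK exprS invfM; have r2' : 2 <= (rho e)^-1 by rewrite -[leLHS]invrK lef_pV2 ?posrE.
  have rN : 0 <= rho e ^- N' by rewrite invr_ge0 exprn_ge0// ltW.
  have := ler_wpM2r rN r2'; move: hNe; rewrite ger0_norm ?absnet_ge0//; lra.
split.
  apply: (@kernn_rate _ _ _ _ N1 N'.+1 p _ _ _ _ _ r0 r2 _ yab abl (F1.1 e e01) _).
    by apply: le_trans hPe; apply: gauge_expV_le => //; exact: (leq_addr P2 P1).
  by near: e.
apply: (@kernn_rate _ _ _ _ N2 N'.+1 p _ _ _ _ _ r0 r2 _ yab abl (F2.1 e e01) _).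
  by apply: le_trans hPe; apply: gauge_expV_le => //; exact: (leq_addl P1 P2).
by near: e.
Unshelve. all: by end_near. Qed.

(** A triangle inequality with the sum of absolute values on the perturbation. Cauchy-Schwarz is
    avoided: in the cross term each [|u j|] is at most the Euclidean norm of [u]. *)
Lemma sqrt_sum_shift n (u w : 'I_n -> R) :
  Num.sqrt (\sum_j (u j + w j) ^+ 2) <= Num.sqrt (\sum_j u j ^+ 2) + \sum_j `|w j|.
Proof.
have S0 : 0 <= \sum_j u j ^+ 2 by apply: sumr_ge0 => j _; exact: sqr_ge0.
have W0 : 0 <= \sum_j `|w j| by apply: sumr_ge0.
rewrite -(@ler_pXn2r _ 2)// ?nnegrE ?addr_ge0 ?sqrtr_ge0// sqr_sqrtr; last first.
  by apply: sumr_ge0 => j _; exact: sqr_ge0.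
rewrite sqrrD sqr_sqrtr//.
have -> : \sum_j (u j + w j) ^+ 2 = \sum_j u j ^+ 2 + (\sum_j u j * w j) *+ 2 + \sum_j w j ^+ 2.
  by rewrite -sumrMnl -!big_split/=; apply: eq_bigr => j _; rewrite sqrrD.
apply: lerD; first apply: lerD => //.
  rewrite lerMn2r/= mulr_sumr; apply: ler_sum => j _.
  apply: le_trans (ler_norm _) _; rewrite normrM ler_wpM2r//.
  rewrite -sqrtr_sqr; apply: ler_wsqrtr; rewrite (bigD1 j)//= lerDl.
  by apply: sumr_ge0 => i _; exact: sqr_ge0.
rewrite expr2 mulr_sumr; apply: ler_sum => j _; rewrite -real_normK ?num_real// expr2 ler_wpM2r//.
by rewrite (bigD1 j)//= lerDl; apply: sumr_ge0.
Qed.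

Lemma moderate_vnorm n (x : R -> 'rV[R]_n) : vmoderate x ->
  moderate (fun e => Num.sqrt (\sum_j x e 0 j ^+ 2)).
Proof.
move=> mx.
have mS : moderate (fun e => \sum_j `|x e 0 j|) by apply: moderate_sum => j; exact: moderate_norm.
apply: moderate_le mS _; apply: nearW => e; rewrite !ger0_norm ?sqrtr_ge0 ?sumr_ge0//.
have h := sqrt_sum_shift (fun _ : 'I_n => 0) (fun j => x e 0 j).
rewrite [X in Num.sqrt X + _]big1 in h; last by move=> j _; rewrite expr0n.
rewrite sqrtr0 add0r in h; apply: le_trans h.
by rewrite (eq_bigr (fun j => (0 + x e 0 j) ^+ 2))// => j _; rewrite add0r.
Qed.

(** Turns a topological hypothesis into a distance at the level of representatives. Moving [y] by a
    power of the gauge along either direction of a coordinate axis stays in the ball, hence in the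
    cube, which separates [y] from both faces. *)
Lemma sharp_interior_cube n k y : gle 0 k -> sharp_interior (gcube n (- k) k) y ->
  exists p : nat, \forall e \near 0^'+, forall j,
    - absnet k e + rho e ^+ p <= gvnet y e 0 j /\ gvnet y e 0 j + rho e ^+ p <= absnet k e.
Proof.
move=> k0 [r [c [_ [yr yu] sub]]].
pose d := gvnet (y - c); have md : vmoderate d := @vmoderate_gvnet _ _ _ _.
pose nd e := Num.sqrt (\sum_j d e 0 j ^+ 2).
have mnd : moderate nd by exact: moderate_vnorm.
have mr := moderate_gnet r.
(* Strict inequality includes invertibility of the difference, so the room left in the ball is at
   least a power of the gauge. *)
have [p hp] : exists p : nat, \forall e \near 0^'+, rho e ^+ p <= gnet r e - nd e.
  apply: gunit_lower; first exact: moderateB.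
    by rewrite gclsB// gnetK.
  rewrite gclsB// gnetK -gcls0.
  have yr' : gle (gcls nd) (gcls (gnet r)) by rewrite gnetK.
  rewrite -[X in gle _ (X - _)]gnetK -gclsB//; apply/(gle_gcls (moderate_cst 0) (moderateB mr mnd)) => m.
  have := (gle_gcls mnd mr).1 yr' m; apply: filterS => e; lra.
(* The shift and the change of representatives each cost at most [rho ^ (p + 2)], a quarter of the
   room [rho ^ p]; what remains is at least [rho ^ (p + 1)]. *)
have shift (sg : R) (i : 'I_n) : `|sg| <= 1 ->
    gle (- k) (y 0 i + gcls (fun e => sg * rho e ^+ p.+2)) /\
    gle (y 0 i + gcls (fun e => sg * rho e ^+ p.+2)) k.
  move=> sg1; pose w e : 'rV[R]_n := \row_j (if j == i then sg * rho e ^+ p.+2 else 0).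
  have msr : moderate (fun e => sg * rho e ^+ p.+2).
    by apply: moderateM; [exact: moderate_cst|exact: moderate_rhoX].
  have mw : vmoderate w.
    move=> j; case ji: (j == i).
      by apply: moderate_eq01 msr => e _; rewrite mxE ji.
    by apply: moderate_eq01 (moderate_cst 0) => e _; rewrite mxE ji.
  have : gball r c (y + gvcls w).
    have E : y + gvcls w - c = gvcls (fun e => d e + w e).
      rewrite addrAC -[y - c]gvnetK -/d; apply/rowP => j; rewrite !mxE.
      by rewrite -gclsD; [congr Defs.gcls; apply/funext => e; rewrite !mxE|exact: md|exact: mw].
    have mdw : vmoderate (fun e => d e + w e).
      by move=> j; apply: moderate_eq01 (moderateD (md j) (mw j)) => e _; rewrite mxE.
    have mv := @moderate_vnorm n _ (@vmoderate_gvnet _ _ _ (y + gvcls w - c)).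
    have lower : \forall e \near 0^'+, rho e ^+ p.+1 <=
        gnet r e - Num.sqrt (\sum_j gvnet (y + gvcls w - c) e 0 j ^+ 2).
      have nz : negligible (fun e => \sum_j `|gvnet (y + gvcls w - c) e 0 j - (d e + w e) 0 j|).
        apply: negligible_sum => j.
        have h : negligible (fun e => gvnet (y + gvcls w - c) e 0 j - (d e + w e) 0 j).
          apply/(gcls_eq (vmoderate_gvnet _ j) (mdw j)).
          by rewrite (gvcls_coord _ (gvnetK _)) (gvcls_coord _ (esym E)).
        by apply: negligible_le h _; apply: nearW => e; rewrite normr_id.
      near=> e.
      have [r0 r1 r2] : [/\ 0 < rho e, rho e <= 1 & rho e <= 2^-1] by near: e; exact: gauge_half.
      have h1 : rho e ^+ p <= gnet r e - nd e by near: e.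
      have h2 : `|\sum_j `|gvnet (y + gvcls w - c) e 0 j - (d e + w e) 0 j| | <= rho e ^+ p.+2.
        by near: e; exact: nz.
      rewrite ger0_norm ?sumr_ge0// in h2.
      have s1 := sqrt_sum_shift (fun j => (d e + w e) 0 j) (fun j => gvnet (y + gvcls w - c) e 0 j - (d e + w e) 0 j).
      have s2 := sqrt_sum_shift (fun j => d e 0 j) (fun j => w e 0 j).
      have s3 : \sum_j `|w e 0 j| <= rho e ^+ p.+2.
        rewrite (bigD1 i)//= mxE eqxx big1 => [|j ji]; last by rewrite mxE (negbTE ji) normr0.
        by rewrite addr0 normrM (ger0_norm (exprn_ge0 _ (ltW r0))) ler_piMl// exprn_ge0// ltW.
      have E1 : \sum_j ((d e + w e) 0 j + (gvnet (y + gvcls w - c) e 0 j - (d e + w e) 0 j)) ^+ 2 =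
          \sum_j gvnet (y + gvcls w - c) e 0 j ^+ 2.
        by apply: eq_bigr => j _; rewrite addrC subrK.
      have E2 : \sum_j (d e + w e) 0 j ^+ 2 = \sum_j (d e 0 j + w e 0 j) ^+ 2.
        by apply: eq_bigr => j _; rewrite [(d e + w e) 0 j]mxE.
      have p0 : 0 < rho e ^+ p by rewrite exprn_gt0.
      have q1 : rho e ^+ p.+1 <= 2^-1 * rho e ^+ p by rewrite exprS ler_wpM2r// ltW.
      have q2 : rho e ^+ p.+2 <= 2^-1 * rho e ^+ p.+1.
        by rewrite [rho e ^+ p.+2]exprS ler_wpM2r// exprn_ge0// ltW.
      move: s1 s2 s3 h1 h2; rewrite E1 E2 /nd.
      set a1 := Num.sqrt _; set a2 := Num.sqrt _; set a3 := Num.sqrt _.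
      set b1 := \sum_j _; set b2 := \sum_j _; lra.
    split; last first.
      have -> : r - gvabs (y + gvcls w - c) =
          gcls (fun e => gnet r e - Num.sqrt (\sum_j gvnet (y + gvcls w - c) e 0 j ^+ 2)).
        by rewrite gclsB// gnetK.
      by apply: lower_gunit lower; exact: moderateB.
    rewrite /gvabs -[r in gle _ r]gnetK; apply: gle_near => //.
    apply: filterS2 gauge_half lower => e [r0 _ _]; have := exprn_gt0 p.+1 r0; lra.
  move=> /sub /(_ i); rewrite !mxE.
  have -> : gcls (fun e => w e 0 i) = gcls (fun e => sg * rho e ^+ p.+2).
    by congr Defs.gcls; apply/funext => e; rewrite mxE eqxx.
  by [].
(* The shift [rho ^ (p + 2)] is at least twice [rho ^ (p + 3)]: one half covers the error of the
   order relation and the other is the distance to the face. *)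
exists p.+3.
have msr (sg : R) : moderate (fun e => sg * rho e ^+ p.+2).
  by apply: moderateM; [exact: moderate_cst|exact: moderate_rhoX].
have up (i : 'I_n) : \forall e \near 0^'+, gnet (y 0 i) e + 1 * rho e ^+ p.+2 <= absnet k e + rho e ^+ p.+3.
  have [_] := shift 1 i ltac:(by rewrite normr1).
  rewrite -[y 0 i]gnetK -gclsD//; last exact: moderate_gnet.
  rewrite -[X in gle _ X](absnetK k0) gnetK.
  by move=> /(gle_gcls (moderateD (moderate_gnet _) (msr 1)) (moderate_absnet k)).1; apply.
have dn (i : 'I_n) : \forall e \near 0^'+, - absnet k e <= gnet (y 0 i) e + -1 * rho e ^+ p.+2 + rho e ^+ p.+3.
  have [+ _] := shift (-1) i ltac:(by rewrite normrN normr1).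
  rewrite -[y 0 i]gnetK -gclsD//; last exact: moderate_gnet.
  rewrite -[X in gle (- X) _](absnetK k0) gnetK -gclsN; last exact: moderate_absnet.
  by move=> /(gle_gcls (moderateN (moderate_absnet k)) (moderateD (moderate_gnet _) (msr (-1)))).1; apply.
near=> e.
have [r0 r1 r2] : [/\ 0 < rho e, rho e <= 1 & rho e <= 2^-1] by near: e; exact: gauge_half.
have upe : forall i, gnet (y 0 i) e + 1 * rho e ^+ p.+2 <= absnet k e + rho e ^+ p.+3.
  by near: e; apply: filter_forall.
have dne : forall i, - absnet k e <= gnet (y 0 i) e + -1 * rho e ^+ p.+2 + rho e ^+ p.+3.
  by near: e; apply: filter_forall.
have q2 : rho e ^+ p.+3 <= 2^-1 * rho e ^+ p.+2.
  by rewrite [rho e ^+ p.+3]exprS ler_wpM2r// exprn_ge0// ltW.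
by move=> j; rewrite mxE; have := upe j; have := dne j; split; lra.
Unshelve. all: by end_near. Qed.

End Limits.

(** * The seven properties *)

Section Corollary.
Context {R : realType} {rho : gauge R}.
Local Notation moderate := (Defs.moderate rho).
Local Notation negligible := (Defs.negligible rho).
Local Notation gcls := (gcls rho).
Local Notation gR := (gR rho).
Local Notation gC := (gC rho).
Local Notation gvcls := (gvcls rho).
Local Notation vmoderate := (vmoderate rho).
Implicit Types (k h : gR).

Lemma gle_trans (x y z : gR) : gle x y -> gle y z -> gle x z.
Proof.
move=> /gle_gnet xy /gle_gnet yz; apply/gle_gnet => m; near=> e.
have [r0 r1 r2] : [/\ 0 < rho e, rho e <= 1 & rho e <= 2^-1] by near: e; exact: gauge_half.
have h1 : gnet x e <= gnet y e + rho e ^+ m.+1 by near: e; exact: xy.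
have h2 : gnet y e <= gnet z e + rho e ^+ m.+1 by near: e; exact: yz.
have h4 : rho e ^+ m.+1 <= 2^-1 * rho e ^+ m by rewrite exprS ler_wpM2r// exprn_ge0// ltW.
lra.
Unshelve. all: by end_near. Qed.

Lemma gRtoCM (c a b : gR) : gRtoC c * (Complex a b : gC) = Complex (c * a) (c * b).
Proof.
transitivity (Complex (c * a - 0 * b) (c * b + 0 * a)); first by [].
by rewrite !mul0r subr0 addr0.
Qed.

Lemma gconst2piV n : gconst rho (2 * pi) ^- n = gconst rho ((2 * pi) ^- n).
Proof.
have p0 : (2 * pi : R) ^+ n != 0 by rewrite expf_neq0// mulf_neq0// gt_eqF// pi_gt0.
have [_ <-] := @gconst_unit _ rho _ p0; congr (_^-1).
by rewrite /gconst -gclsX//; exact: moderate_cst.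
Qed.

(** Covers both cubes of (iii). The kernel is a product, so the integral over the cube is the [n]-th
    power of an increment of [kernI]; when both endpoints lie on the same side of [0], at distance
    at least [rho ^ p], the two halves cancel. *)
Lemma off_limit n (k1 k2 : gR) (a b : R -> R) p : (0 < n)%N ->
  gle k1 k2 -> moderate a -> moderate b -> gcls a = k1 -> gcls b = k2 ->
  (\forall e \near 0^'+, forall eta, 0 < eta ->
    `|kernI eta (b e) - kernI eta (a e)| <= 2 * (eta * rho e ^+ p)^-1) ->
  glim (fun h => gcubint k1 k2 (dirichletC (n := n) h)) 0.
Proof.
move=> n0 k12 ma mb ak bk Hab q.
(* Here [p] powers pay for the distance to [0], two for [gcabs_le], one for the factor [2] and the
   outer one for [gle_rhoV]. *)
exists (gcls (fun e => rho e ^- (q.+3 + p).+1)) => h /gle_rhoV hP.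
have E : dirichletC (n := n) h = (fun x => dirichletC (gcls (gnet h)) (gvcls (fun=> 0) - x)).
  by apply/funext => x; rewrite gnetK gvcls0 dirichletC_sub0.
have mh := moderate_gnet h.
have k12' (j : 'I_n) : gle ((const_mx k1 : 'rV_n) 0 j) ((const_mx k2 : 'rV_n) 0 j) by rewrite !mxE.
have ak' : gvcls (fun e => const_mx (a e) : 'rV[R]_n) = const_mx k1 by rewrite gvcls_const ak.
have bk' : gvcls (fun e => const_mx (b e) : 'rV[R]_n) = const_mx k2 by rewrite gvcls_const bk.
have [G m1 m2] := gint_eq k12' (vmoderate_const ma) (vmoderate_const mb) ak' bk'
  (gsf_dirichlet (gbox (const_mx k1) (const_mx k2)) mh (@vmoderate0 _ rho n)).
rewrite /gcubint E G gcclassE /citint/= subr0.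
have EI : (fun e => itint (const_mx (a e)) (const_mx (b e)) (fun x : 'rV[R]_n => kernn (gnet h e) (0 - x))) =
    (fun e => (kernI (gnet h e) (b e) - kernI (gnet h e) (a e)) ^+ n).
  apply/funext => e; transitivity (itint (const_mx (a e)) (const_mx (b e))
      (fun x : 'rV[R]_n => \prod_j kern (gnet h e) (x 0 j))).
    by apply: eq_itint => x; rewrite sub0r kernnN.
  rewrite (@itint_prod _ _ _ _ (fun=> kern (gnet h e))).
    under eq_bigr do rewrite !mxE oint_kern.
    by rewrite prodr_const card_ord.
  by move=> _; apply: (@continuousT_kern _ _ _ (fun t => t)); cont.
have EJ : (fun e => itint (const_mx (a e)) (const_mx (b e)) (fun x : 'rV[R]_n => 0 : R)) = (fun=> 0).
  by apply/funext => e; rewrite itint0.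
rewrite /= in m1 m2; rewrite EI in m1 *; rewrite EJ in m2 *.
apply: gcabs_le => //; near=> e.
have [r0 r1 r2] : [/\ 0 < rho e, rho e <= 1 & rho e <= 2^-1] by near: e; exact: gauge_half.
have hPe : rho e ^- (q.+3 + p) <= gnet h e by near: e.
have He : forall eta, 0 < eta -> `|kernI eta (b e) - kernI eta (a e)| <= 2 * (eta * rho e ^+ p)^-1.
  by near: e.
have rV : 0 < rho e ^- (q.+3 + p) by rewrite invr_gt0 exprn_gt0.
have h0 : 0 < gnet h e := lt_le_trans rV hPe.
split; last by rewrite normr0 exprn_ge0// ltW.
set v := _ - _; have vq : `|v| <= rho e ^+ q.+2.
  apply: le_trans (He _ h0) _; rewrite invfM.
  have hV : (gnet h e)^-1 <= rho e ^+ (q.+3 + p) by rewrite -[leRHS]invrK lef_pV2 ?posrE.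
  have rp : rho e ^+ p != 0 by rewrite expf_neq0// gt_eqF.
  have h1 : (gnet h e)^-1 * rho e ^- p <= rho e ^+ q.+3.
    rewrite -[leRHS](mulfK rp) -exprD; apply: ler_wpM2r => //.
    by rewrite invr_ge0 exprn_ge0// ltW.
  have h2 : rho e ^+ q.+3 <= 2^-1 * rho e ^+ q.+2.
    by rewrite [rho e ^+ q.+3]exprS ler_wpM2r// exprn_ge0// ltW.
  lra.
have v1 : `|v| <= 1 by apply: le_trans vq _; rewrite exprn_ile1// ltW.
(* [0 < n] enters here: a positive power of [v] is at most [|v|], while in dimension [0] the
   integral would be [1]. *)
rewrite normrX; apply: le_trans vq; rewrite -(prednK n0) exprS ler_piMr//.
exact: exprn_ile1.
Unshelve. all: by end_near. Qed.

(* [gfourier] for [b = true] and [c = 1], [gfourierV] for [b = false] and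
   [c = (2 pi) ^ (- n)]. *)
Definition gtrans n (b : bool) (c : R) k (f : 'rV[gR]_n -> gC) (w : 'rV[gR]_n) : gC :=
  gRtoC (gconst rho c) * gcubint (- k) k (fun x => f x * gexpi (gdot x (flip b w))).

Definition trans_net n (b : bool) (c : R) k (F : R -> 'rV[R]_n -> R[i]%C) (e : R) (w : 'rV[R]_n) : R[i]%C :=
  Complex (wave (cubel n k e) (cuber n k e) (flip b)
      (fun x => c * complex.Re (F e x)) (fun x => - (c * complex.Im (F e x))) w)
    (wave (cubel n k e) (cuber n k e) (flip b)
      (fun x => c * complex.Im (F e x)) (fun x => c * complex.Re (F e x)) w).

Lemma vmoderate_flip n b (w : R -> 'rV[R]_n) : vmoderate w -> vmoderate (fun e => flip b (w e)).
Proof.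
move=> mw; case: b => //= j.
by apply: moderate_eq01 (moderateN (mw j)) => e _; rewrite mxE.
Qed.

Lemma gvcls_flip n b (w : R -> 'rV[R]_n) : vmoderate w ->
  gvcls (fun e => flip b (w e)) = flip b (gvcls w).
Proof.
move=> mw; case: b => //=; apply/rowP => j; rewrite !mxE -gclsN; last exact: mw.
by congr Defs.gcls; apply/funext => e; rewrite mxE.
Qed.

Lemma gtrans_gcls n b c k f F (w : R -> 'rV[R]_n) : gle 0 k ->
  gsf_net (gcube n (- k) k) f F -> vmoderate w ->
  [/\ gtrans b c k f (gvcls w) = gcclass rho (fun e => trans_net b c k F e (w e)),
    moderate (fun e => complex.Re (trans_net b c k F e (w e))) &
    moderate (fun e => complex.Im (trans_net b c k F e (w e)))].
Proof.
move=> k0 gF mw; have mfw := vmoderate_flip b mw.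
have [F1 F2 _] := (gsf_netP _ _ _).1 gF.
have [] := gcubint_eq k0 (gsf_netM gF (gsf_expi (gcube n (- k) k) mfw)).
rewrite gvcls_flip// gcclassE /citint/= => E m1 m2.
have mc := @moderate_cst _ rho c.
rewrite /gtrans E gRtoCM /gconst -!gclsM// gcclassE.
have cF e : 0 < e <= 1 -> continuous (fun x => complex.Re (F e x)) /\ continuous (fun x => complex.Im (F e x)).
  by move=> e01; split; apply: smooth_continuous; [exact: F1.1|exact: F2.1].
have cw e : continuous (fun x : 'rV[R]_n => dotv x (flip b (w e))).
  by apply: continuousT_dotv; cont.
have Ed e x : dotv (w e) (flip b x) = dotv x (flip b (w e)) by rewrite dotv_flip dotvC.
have ER e : 0 < e <= 1 -> complex.Re (trans_net b c k F e (w e)) =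
   c * itint (cubel n k e) (cuber n k e) (fun x => complex.Re (F e x) * cos (dotv x (flip b (w e))) -
       complex.Im (F e x) * sin (dotv x (flip b (w e)))).
  move=> /cF[cR cI]; have cwe := cw e; rewrite -itintZ; last by cont.
  by apply: eq_itint => x; rewrite Ed; ring.
have EI e : 0 < e <= 1 -> complex.Im (trans_net b c k F e (w e)) =
   c * itint (cubel n k e) (cuber n k e) (fun x => complex.Re (F e x) * sin (dotv x (flip b (w e))) +
       complex.Im (F e x) * cos (dotv x (flip b (w e)))).
  move=> /cF[cR cI]; have cwe := cw e; rewrite -itintZ; last by cont.
  by apply: eq_itint => x; rewrite Ed; ring.
have mR : moderate (fun e => complex.Re (trans_net b c k F e (w e))).
  by apply: moderate_eq01 (moderateM mc m1) => e /ER.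
have mI : moderate (fun e => complex.Im (trans_net b c k F e (w e))).
  by apply: moderate_eq01 (moderateM mc m2) => e /EI.
split=> //; congr Complex; apply: gcls_near => //; try exact: moderateM.
  by apply: filterS near_itv01 => e /ER.
by apply: filterS near_itv01 => e /EI.
Qed.

(** The frequency is the integration variable up to sign, bounded by a representative of [k]; the
    transform is therefore generalized smooth on any set, in particular on the cube of the second
    transform. *)
Lemma rgsf_trans n (X : set 'rV[gR]_n) b k (u v : R -> 'rV[R]_n -> R) (c1 c2 : R) : gle 0 k ->
  rgsf (gcube n (- k) k) u -> rgsf (gcube n (- k) k) v ->
  rgsf X (fun e => wave (cubel n k e) (cuber n k e) (flip b)
    (fun x => c1 * u e x) (fun x => c2 * v e x)).
Proof.
move=> k0 gu gv.
have [N1 h1] := cube_sup (s := [::]) k0 gu isT; have [N2 h2] := cube_sup (s := [::]) k0 gv isT.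
have [N3 h3] := moderate_cst (rho := rho) c1; have [N4 h4] := moderate_cst (rho := rho) c2.
have [N5 h5] := moderate_absnet k.
pose N := (N1 + N2 + N3 + N4 + N5.+1)%N.
apply: (@rgsf_wave _ _ _ _ _ _ _ _ _ _ N).
- move=> e e01; have := smooth_continuous (gu.1 e e01); have := smooth_continuous (gv.1 e e01) => ? ?.
  by split; [exact: continuous_flip|cont|cont].
- near=> e.
  have [r0 r1 r2] : [/\ 0 < rho e, rho e <= 1 & rho e <= 2^-1] by near: e; exact: gauge_half.
  have h1e : forall x, in_box (cubel n k e) (cuber n k e) x -> `|u e x| <= rho e ^- N1 by near: e.
  have h2e : forall x, in_box (cubel n k e) (cuber n k e) x -> `|v e x| <= rho e ^- N2 by near: e.
  have h3e : `|c1| <= rho e ^- N3 by near: e.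
  have h4e : `|c2| <= rho e ^- N4 by near: e.
  have h5e : `|absnet k e| <= rho e ^- N5 by near: e.
  move=> x xk; split.
  + rewrite normrM; apply: le_trans (ler_pM _ _ h3e (h1e x xk)) _ => //.
    by rewrite -invfM -exprD; apply: gauge_expV_le => //; rewrite /N; lia.
  + rewrite normrM; apply: le_trans (ler_pM _ _ h4e (h2e x xk)) _ => //.
    by rewrite -invfM -exprD; apply: gauge_expV_le => //; rewrite /N; lia.
  + move=> j; have -> : `|flip b x 0 j| = `|x 0 j| by case: (b); rewrite /flip ?mxE ?normrN.
    apply: (@le_trans _ _ (rho e ^- N5)); last by apply: gauge_expV_le => //; rewrite /N; lia.
    apply: le_trans h5e; rewrite (ger0_norm (absnet_ge0 _ _)) ler_norml.
    exact: ((in_box_cubeP _ _ _).1 xk j).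
- near=> e.
  have [r0 r1 r2] : [/\ 0 < rho e, rho e <= 1 & rho e <= 2^-1] by near: e; exact: gauge_half.
  have h5e : `|absnet k e| <= rho e ^- N5 by near: e.
  move=> j; rewrite !mxE opprK; apply: (@le_trans _ _ (rho e ^- N5.+1)); last first.
    by apply: gauge_expV_le => //; rewrite /N; lia.
  rewrite exprS invfM -mulr2n -mulr_natl normrM ger0_norm//; apply: ler_pM => //.
  by rewrite -[leLHS]invrK lef_pV2 ?posrE.
Unshelve. all: by end_near. Qed.

Lemma gsf_trans n (X : set 'rV[gR]_n) b c k f F : gle 0 k ->
  gsf_net (gcube n (- k) k) f F -> gsf_net X (gtrans b c k f) (trans_net b c k F).
Proof.
move=> k0 gF; have [F1 F2 _] := (gsf_netP _ _ _).1 gF; apply/gsf_netP; split=> /=.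
- apply: (rgsf_eq (rgsf_trans X b c (- c) k0 F1 F2)) => e x; congr (wave _ _ _ _ _ _).
  by apply/funext => u; rewrite mulNr.
- exact: rgsf_trans.
- by move=> w mw _; have [] := gtrans_gcls b c k0 gF mw.
Qed.

Lemma gtrans_gtrans n b c1 c2 k h f F (y : R -> 'rV[R]_n) : gle 0 k -> gle 0 h ->
  c1 * c2 = (2 * pi) ^- n -> gsf_net (gcube n (- k) k) f F -> vmoderate y ->
  gtrans (~~ b) c2 h (gtrans b c1 k f) (gvcls y) = dirichlet_conv h k f (gvcls y).
Proof.
move=> k0 h0 c12 gF my; have [F1 F2 _] := (gsf_netP _ _ _).1 gF.
have [-> m1 m2] := gtrans_gcls (~~ b) c2 h0 (gsf_trans (gcube n (- h) h) b c1 k0 gF) my.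
have [E n1 n2] := conv_value k0 (moderate_absnet h) my gF.
rewrite -[h in RHS]absnetK// E gcclassE.
have cF e : 0 < e <= 1 -> continuous (fun x => complex.Re (F e x)) /\ continuous (fun x => complex.Im (F e x)).
  by move=> e01; split; apply: smooth_continuous; [exact: F1.1|exact: F2.1].
congr Complex; apply: gcls_near => //; apply: filterS near_itv01 => e /cF[cR cI].
  exact: (fourier_inversion b _ _ _ _ c12 cR cI).
(* The imaginary part is the real-part identity for [- i f], whose real and imaginary parts are
   [Im f] and [- Re f]. *)
have cNR : continuous (fun x => - complex.Re (F e x)) by cont.
rewrite -(fourier_inversion b (cubel n k e) (cuber n k e) (y e) (absnet h e) c12 cI cNR) /=.
congr (wave _ _ _ _ _ _); apply/funext => w.
  congr (_ * wave _ _ _ _ _ _); apply/funext => x; by rewrite mulrN opprK.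
rewrite -mulrN -wave_opp; [|exact: continuous_flip|cont|cont].
by congr (_ * wave _ _ _ _ _ _); apply/funext => x; rewrite mulrN// opprK.
Qed.

Lemma gdot_flip n b (x w : 'rV[gR]_n) : gdot x (flip b w) = flip b (gdot x w).
Proof.
case: b => //=; rewrite /gdot -sumrN; apply: eq_bigr => j _.
by rewrite mxE mulrN.
Qed.

Lemma gdotC n (x w : 'rV[gR]_n) : gdot x w = gdot w x.
Proof. by apply: eq_bigr => j _; rewrite mulrC. Qed.

Lemma gfourier_trans n k (f : 'rV[gR]_n -> gC) : gfourier k f = gtrans true 1 k f.
Proof.
apply/funext => w; rewrite /gtrans /gfourier.
have -> : gRtoC (gconst rho 1) = 1 :> gC by rewrite /gconst gcls1.
rewrite mul1r; congr (gcubint _ _ _); apply/funext => x.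
by rewrite (gdot_flip true).
Qed.

Lemma gfourierV_trans n k (f : 'rV[gR]_n -> gC) :
  gfourierV k f = gtrans false ((2 * pi) ^- n) k f.
Proof.
apply/funext => w; rewrite /gtrans /gfourierV gconst2piV.
by congr (_ * gcubint _ _ _); apply/funext => x; rewrite gdotC.
Qed.

Lemma gfourierV1 n h (z : 'rV[gR]_n) : gle 0 h ->
  gfourierV h (fun=> 1) z = dirichletC h z.
Proof.
move=> h0; have mz := vmoderate_gvnet z.
have E : (fun omega : 'rV[gR]_n => (1 : gC) * gexpi (gdot z omega)) = (fun x => gexpi (gdot x (gvcls (gvnet z)))).
  by apply/funext => x; rewrite mul1r gvnetK gdotC.
have [G m1 m2] := gcubint_eq h0 (gsf_expi (gcube n (- h) h) mz).
rewrite /gfourierV E G gconst2piV gcclassE gRtoCM /citint/= in m1 m2 *.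
have mc := @moderate_cst _ rho ((2 * pi) ^- n).
rewrite /gconst -!gclsM// /dirichletC -[z in RHS]gvnetK -[h in RHS]absnetK//.
rewrite (dirichlet_gcls (moderate_absnet h) mz).
congr Complex.
  congr Defs.gcls; apply/funext => e; rewrite kernn_fourier; congr (_ * _).
  by apply: eq_itint => x; rewrite dotvC.
rewrite -gcls0; congr Defs.gcls; apply/funext => e.
rewrite -[RHS](mulr0 ((2 * pi) ^- n)); congr (_ * _).
rewrite -[RHS](itint_cos_sin (absnet h e) (gvnet z e)).2.
by apply: eq_itint => x; rewrite dotvC.
Qed.

(** The common core of both halves: what is asked of [k] is a representative eventually at least
    [2]. The [2] comes from [delta <= 1], which at the level of representatives reads
    [delta <= 1 + rho ^ 0]. *)
Lemma corollary67_gauge n k (X : set 'rV[gR]_n) f h (delta : gR) : (0 < n)%N ->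
  gle 0 k -> (\forall e \near 0^'+, 2 <= gnet k e) ->
  gcube n (- k) k `<=` X -> gsf X f -> gle 0 h -> glt 0 delta -> gle delta 1 ->
    (forall z : 'rV[gR]_n,
      dirichlet h z = \prod_j dirichlet h (const_mx (z 0 j) : 'rV[gR]_1)) /\
    glim (fun h' => gcubint (- k) k (dirichletC (n := n) h')) 1 /\
    (glim (fun h' => gcubint (- k) (- delta) (dirichletC (n := n) h')) 0 /\
     glim (fun h' => gcubint delta k (dirichletC (n := n) h')) 0) /\
    (sharp_interior (gcube n (- k) k) 0 ->
      glim (fun h' => gcubint (- k) k (fun x => dirichletC h' x * f x)) (f 0)) /\
    (forall y, sharp_interior (gcube n (- k) k) y ->
      glim (fun h' => dirichlet_conv h' k f y) (f y)) /\
    ((forall omega : 'rV[gR]_n,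
       glim (fun h' => gfourier k (dirichletC (n := n) h') omega) 1) /\
     (forall z : 'rV[gR]_n,
       gfourierV h (fun=> 1) z = dirichletC h z)) /\
    (forall y : 'rV[gR]_n,
      gfourierV h (gfourier k f) y = dirichlet_conv h k f y /\
      gfourier h (gfourierV k f) y = dirichlet_conv h k f y).
Proof.
move=> n0 k0 k2 KX [F gFX] h0 [d0 du] d1.
have gF := gsf_net_sub KX gFX.
have conv y : sharp_interior (gcube n (- k) k) y ->
    glim (fun h' => dirichlet_conv h' k f y) (f y).
  move=> /(sharp_interior_cube k0)[p hp].
  rewrite -[y]gvnetK; exact: (conv_limit k0 (@vmoderate_gvnet _ _ _ y) gF hp).
have k2' : \forall e \near 0^'+, 2 <= absnet k e.
  by apply: filterS k2 => e; rewrite /absnet => k2e; exact: le_trans (ler_norm _).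
(* The transform of the kernel at [omega] is a convolution at [0] with the plane wave of frequency
   [- omega], whose value at [0] is [1]. The origin has distance at least [rho ^ 0 = 1] to the
   faces. *)
have wave0 omega : glim (fun h' => gfourier k (dirichletC (n := n) h') omega) 1.
  have mo := vmoderate_flip true (vmoderate_gvnet omega).
  have y0 : \forall e \near 0^'+, forall j : 'I_n,
      - absnet k e + rho e ^+ 0 <= (0 : 'rV[R]_n) 0 j /\ (0 : 'rV[R]_n) 0 j + rho e ^+ 0 <= absnet k e.
    by apply: filterS k2' => e ? j; rewrite !mxE expr0; split; lra.
  have := conv_limit k0 (@vmoderate0 _ rho n) (gsf_expi (gcube n (- k) k) mo) y0.
  rewrite gvcls0; have -> : gdot 0 (gvcls (fun e => flip true (gvnet omega e))) = 0 :> gR.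
    by rewrite /gdot big1// => j _; rewrite mxE mul0r.
  rewrite gexpi0 gvcls_flip ?gvnetK; last exact: vmoderate_gvnet.
  move=> lim q; have [hbar H] := lim q; exists hbar => h' /H.
  rewrite /dirichlet_conv /gfourier.
  have -> : (fun x => dirichletC h' (0 - x) * gexpi (gdot x (flip true omega))) =
      (fun x => dirichletC h' x * gexpi (- gdot x omega)) :> ('rV[gR]_n -> gC).
    by apply/funext => x; rewrite dirichletC_sub0 (gdot_flip true).
  by [].
split; [|split; [|split; [|split; [|split; [|split]]]]].
- by move=> z; apply: eq_bigr => j _; rewrite /dirichlet big_ord1 mxE.
(* (ii) is read off from (vi) at frequency [0]. *)
- move=> q; have [hbar H] := wave0 0 q; exists hbar => h' /H; rewrite /gfourier.
  have -> : (fun x => dirichletC h' x * gexpi (- gdot x 0)) = dirichletC h' :> ('rV[gR]_n -> gC).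
    apply/funext => x; have -> : gdot x 0 = 0 :> gR by rewrite /gdot big1// => j _; rewrite mxE mulr0.
    by rewrite oppr0 gexpi0 mulr1.
  by [].
- have md := moderate_gnet delta; have mk := moderate_absnet k.
  (* [delta] may be infinitesimal; being positive and invertible it is still at least a power of the
     gauge. *)
  have [p hp] : exists p : nat, \forall e \near 0^'+, rho e ^+ p <= gnet delta e.
    by apply: gunit_lower => //; rewrite gnetK//; rewrite subr0 in du.
  have d1e : \forall e \near 0^'+, gnet delta e <= 1 + rho e ^+ 0.
    by move: d1; rewrite -[X in gle X _]gnetK -gcls1 => /(gle_gcls md (moderate_cst 1)).1; apply.
  have dk : \forall e \near 0^'+, gnet delta e <= absnet k e.
    by apply: filterS2 d1e k2'=> e; rewrite expr0 => ? ?; lra.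
  have dk' : gle delta k.
    by rewrite -[delta]gnetK -(absnetK k0); exact: gle_near.
  have kI : \forall e \near 0^'+, forall eta, 0 < eta ->
      `|kernI eta (absnet k e) - kernI eta (gnet delta e)| <= 2 * (eta * rho e ^+ p)^-1.
    near=> e => eta eta0.
    have [r0 r1 r2] : [/\ 0 < rho e, rho e <= 1 & rho e <= 2^-1] by near: e; exact: gauge_half.
    have pd : rho e ^+ p <= gnet delta e by near: e.
    have dke : gnet delta e <= absnet k e by near: e.
    have rp : 0 < rho e ^+ p by rewrite exprn_gt0.
    have b1 := kernI_half_tail eta0 rp pd.
    have b2 := kernI_half_tail eta0 rp (le_trans pd dke).
    rewrite (_ : _ - _ = kernI eta (absnet k e) - 2^-1 - (kernI eta (gnet delta e) - 2^-1)); last by ring.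
    by apply: le_trans (ler_normB _ _) _; rewrite mulr_natl mulr2n lerD.
  split.
    apply: (@off_limit n (- k) (- delta) (fun e => - absnet k e) (fun e => - gnet delta e) p n0).
    + rewrite -(absnetK k0) -[delta]gnetK -!gclsN//.
      by apply: gle_near; [exact: moderateN|exact: moderateN|apply: filterS dk => e; rewrite lerN2].
    + exact: moderateN.
    + exact: moderateN.
    + by rewrite gclsN// absnetK.
    + by rewrite gclsN// gnetK.
    + apply: filterS kI => e H eta eta0; rewrite !kernIN opprK addrC; exact: H.
  exact: (@off_limit n delta k (gnet delta) (absnet k) p n0 dk' md mk (gnetK _) (absnetK k0) kI).
- move=> /conv lim q; have [hbar H] := lim q; exists hbar => h' /H; rewrite /dirichlet_conv.
  have -> : (fun x => dirichletC h' (0 - x) * f x) = (fun x => dirichletC h' x * f x).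
    by apply/funext => x; rewrite dirichletC_sub0.
  by [].
- exact: conv.
- by split=> // z; exact: gfourierV1.
- move=> y; rewrite !gfourierV_trans !gfourier_trans -[y]gvnetK.
  have my := vmoderate_gvnet y.
  split.
    by apply: (@gtrans_gtrans n true 1 _ k h f F _ k0 h0 _ gF my); rewrite mul1r.
  by apply: (@gtrans_gtrans n false _ 1 k h f F _ k0 h0 _ gF my); rewrite mulr1.
Unshelve. all: by end_near. Qed.

Lemma ginfinite_large k : gle 0 k -> ginfinite k -> \forall e \near 0^'+, 2 <= gnet k e.
Proof.
(* The value [3] leaves [2] after the error [rho ^ 0 = 1] of the order relation; [gnet k >= - 1]
   then excludes the negative sign. *)
move=> k0 /(_ 3 ltac:(lra)); rewrite /gconst /gabs.
move=> /(gle_gcls (moderate_cst 3) (moderate_norm (moderate_gnet k))).1 /(_ 0%N) k3.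
have {}k0 : \forall e \near 0^'+, 0 <= gnet k e + rho e ^+ 0.
  move: k0; rewrite -gcls0 -[X in gle _ X]gnetK.
  by move=> /(gle_gcls (moderate_cst 0) (moderate_gnet k)).1; apply.
apply: filterS2 k0 k3 => e; rewrite expr0.
by have [?|?] := ler0P (gnet k e); lra.
Qed.

End Corollary.

(** [sigma << rho] makes [1 / rho] moderate over [sigma]. The class of [rho] is thus a unit there,
    and the inverse in [gg_gauge] is the class of [1 / rho] rather than the default value of the
    inverse at a non-unit. *)
Lemma gg_gauge_large (R : realType) (sigma rho : gauge R) (k : gR sigma) :
  gauge_ll sigma rho -> gg_gauge rho k ->
  gle 0 k /\ \forall e \near 0^'+, 2 <= gnet k e.
Proof.
move=> [Q sr] /(_ 1%N); rewrite expr1 => kQ.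
have mr : Defs.moderate sigma rho.
  apply: moderate_le (moderate_cst 1) _; apply: filterS (gauge_near rho) => e /andP[r0 r1].
  by rewrite normr1 gtr0_norm.
have mV : Defs.moderate sigma (fun e => (rho e)^-1).
  exists Q; near=> e.
  have /andP[r0 r1] : 0 < rho e <= 1 by near: e; exact: gauge_near.
  have /andP[s0 s1] : 0 < sigma e <= 1 by near: e; exact: gauge_near.
  have h : sigma e ^+ Q <= rho e ^+ 1 by near: e.
  by rewrite normfV gtr0_norm// lef_pV2 ?posrE ?exprn_gt0.
have E : (gcls sigma rho)^-1 = gcls sigma (fun e => (rho e)^-1).
  have rr : gcls sigma (fun e => (rho e)^-1) * gcls sigma rho = 1.
    rewrite -gclsM// -gcls1; apply: gcls_near; [exact: moderateM|exact: moderate_cst|].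
    by apply: filterS (gauge_near rho) => e /andP[r0 _]; rewrite mulVf// gt_eqF.
  have ru : gcls sigma rho \is a GRing.unit by apply/asboolP; exists (gcls sigma (fun e => (rho e)^-1)).
  by apply: (mulIr ru); rewrite mulVr.
have k2 : \forall e \near 0^'+, 2 <= gnet k e.
  move: kQ; rewrite E -[X in gle _ X]gnetK => /(gle_gcls mV (moderate_gnet k)).1 /(_ 0%N) hk.
  near=> e.
  have /andP[r0 r1] : 0 < rho e <= 1 by near: e; exact: gauge_near.
  have r4 : rho e <= 3^-1 by near: e; apply: gauge_near_le.
  have h : (rho e)^-1 <= gnet k e + sigma e ^+ 0 by near: e.
  have : 3 <= (rho e)^-1 by rewrite -[leLHS]invrK lef_pV2 ?posrE.
  by rewrite expr0 in h; lra.
split=> //; rewrite -gcls0 -[X in gle _ X]gnetK; apply: gle_near; [exact: moderate_cst|exact: moderate_gnet|].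
by apply: filterS k2 => e ?; lra.
Unshelve. all: by end_near. Qed.

Lemma glim_geq_upto (R : realType) (sigma rho : gauge R) (a : gR sigma -> gC sigma) l :
  gauge_ll sigma rho -> glim a l -> for_large (fun h => geq_upto rho (a h) l).
Proof.
move=> [Q sr] /(_ Q)[hbar H]; exists hbar => h /H al q; apply: gle_trans al _.
have mr : Defs.moderate sigma rho.
  apply: moderate_le (moderate_cst 1) _; apply: filterS (gauge_near rho) => e /andP[r0 r1].
  by rewrite normr1 gtr0_norm.
have ms : Defs.moderate sigma sigma by exact: (moderate_rhoX 1).
rewrite /dgauge -!gclsX//; apply: gle_near; [exact: moderateX|exact: moderateX|].
exact: sr.
Qed.

Theorem corollary67 (R : realType) (rho : gauge R) (n : nat) (n_gt0 : (0 < n)%N) :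
  (forall (k : gR rho) (X : set 'rV[gR rho]_n) (f : 'rV[gR rho]_n -> gC rho)
      (h delta : gR rho),
    glt 0 k -> ginfinite k ->
    gcube n (- k) k `<=` X ->
    gsf X f ->
    glt 0 h -> ginfinite h ->
    glt 0 delta -> gle delta 1 ->
    (* (i) *)
    (forall z : 'rV[gR rho]_n,
      dirichlet h z = \prod_j dirichlet h (const_mx (z 0 j) : 'rV[gR rho]_1)) /\
    (* (ii) *)
    glim (fun h' => gcubint (- k) k (dirichletC (n := n) h')) 1 /\
    (* (iii) *)
    (glim (fun h' => gcubint (- k) (- delta) (dirichletC (n := n) h')) 0 /\
     glim (fun h' => gcubint delta k (dirichletC (n := n) h')) 0) /\
    (* (iv) *)
    (sharp_interior (gcube n (- k) k) 0 ->
      glim (fun h' => gcubint (- k) k (fun x => dirichletC h' x * f x)) (f 0)) /\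
    (* (v) *)
    (forall y, sharp_interior (gcube n (- k) k) y ->
      glim (fun h' => dirichlet_conv h' k f y) (f y)) /\
    (* (vi) *)
    ((forall omega : 'rV[gR rho]_n,
       glim (fun h' => gfourier k (dirichletC (n := n) h') omega) 1) /\
     (forall z : 'rV[gR rho]_n,
       gfourierV h (fun=> 1) z = dirichletC h z)) /\
    (* (vii) *)
    (forall y : 'rV[gR rho]_n,
      gfourierV h (gfourier k f) y = dirichlet_conv h k f y /\
      gfourier h (gfourierV k f) y = dirichlet_conv h k f y)) /\
  (forall sigma : gauge R, gauge_ll sigma rho ->
   forall (k : gR sigma) (X : set 'rV[gR sigma]_n)
      (f : 'rV[gR sigma]_n -> gC sigma) (h delta : gR sigma),
    gg_gauge rho k ->
    gcube n (- k) k `<=` X ->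
    gsf X f ->
    glt 0 h -> ginfinite h ->
    glt 0 delta -> gle delta 1 ->
    (* (i) *)
    (forall z : 'rV[gR sigma]_n,
      dirichlet h z = \prod_j dirichlet h (const_mx (z 0 j) : 'rV[gR sigma]_1)) /\
    (* (ii) *)
    for_large (fun h' => geq_upto rho
      (gcubint (- k) k (dirichletC (n := n) h')) 1) /\
    (* (iii) *)
    (for_large (fun h' => geq_upto rho
       (gcubint (- k) (- delta) (dirichletC (n := n) h')) 0) /\
     for_large (fun h' => geq_upto rho
       (gcubint delta k (dirichletC (n := n) h')) 0)) /\
    (* (iv) *)
    (sharp_interior (gcube n (- k) k) 0 ->
      for_large (fun h' => geq_upto rho
        (gcubint (- k) k (fun x => dirichletC h' x * f x)) (f 0))) /\
    (* (v) *)
    (forall y, sharp_interior (gcube n (- k) k) y ->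
      for_large (fun h' => geq_upto rho (dirichlet_conv h' k f y) (f y))) /\
    (* (vi) *)
    ((forall omega : 'rV[gR sigma]_n,
       for_large (fun h' => geq_upto rho
         (gfourier k (dirichletC (n := n) h') omega) 1)) /\
     (forall z : 'rV[gR sigma]_n,
       gfourierV h (fun=> 1) z = dirichletC h z)) /\
    (* (vii) *)
    (forall y : 'rV[gR sigma]_n,
      gfourierV h (gfourier k f) y = dirichlet_conv h k f y /\
      gfourier h (gfourierV k f) y = dirichlet_conv h k f y)).
Proof.
split=> [k X f h delta [k0 ku] kinf KX gf [h0 hu] hinf d0 d1|].
  exact: (corollary67_gauge n_gt0 k0 (ginfinite_large k0 kinf) KX gf h0 d0 d1).
move=> sigma sr k X f h delta kgg KX gf [h0 hu] hinf d0 d1.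
have [k0 k2] := gg_gauge_large sr kgg.
have [P1 [P2 [[P3 P4] [P5 [P6 [[P7 P8] P9]]]]]] := corollary67_gauge n_gt0 k0 k2 KX gf h0 d0 d1.
split; [exact: P1|split; [exact: glim_geq_upto sr P2|split]].
  by split; [exact: glim_geq_upto sr P3|exact: glim_geq_upto sr P4].
split=> [/P5 {}P5|]; first exact: glim_geq_upto sr P5.
split=> [y /P6 {}P6|]; first exact: glim_geq_upto sr P6.
split; [split=> // omega; exact: glim_geq_upto sr (P7 omega)|exact: P9].
Qed.
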